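(* Let $k$ be a positive integer, let $G$ be a $50k$-connected graph, and let $S \subseteq V(G)$. Then at least one of the following holds: (i) $G$ contains $k$ pairwise vertex-disjoint odd $S$-cycles; (ii) there is a set $X \subseteq V(G)$ with $|X| \le 2k-2$ such that $G - X$ contains no odd $S$-cycle, and, if moreover $|S| \ge k$, there is a set $Y \subseteq V(G)$ with $|Y| \le 3k-3$ such that $G - Y$ is bipartite.
   Context: All graphs are finite and simple. For $S \subseteq V(G)$, an $S$-cycle is a cycle of $G$ containing at least one vertex of $S$; an odd $S$-cycle is an $S$-cycle of odd length. *)

(* Defs.v *)
From mathcomp Require Import all_boot.
Set Implicit Arguments. Unset Strict Implicit. Unset Printing Implicit Defensive.

Definition simple_graph (T : finType) (e : rel T) : Prop :=
  symmetric e /\ irreflexive e.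

Definition del_rel (T : finType) (e : rel T) (X : {set T}) : rel T :=
  [rel x y | [&& e x y, x \notin X & y \notin X]].

Definition connected_minus (T : finType) (e : rel T) (X : {set T}) : Prop :=
  forall x y, x \notin X -> y \notin X -> connect (del_rel e X) x y.

Definition k_connected (T : finType) (e : rel T) (k : nat) : Prop :=
  k < #|T| /\ forall X : {set T}, #|X| < k -> connected_minus e X.

Definition is_cycle (T : finType) (e : rel T) (c : seq T) : Prop :=
  [/\ 3 <= size c, uniq c & cycle e c].

Definition odd_S_cycle (T : finType) (e : rel T) (S : {set T}) (c : seq T) : Prop :=
  [/\ is_cycle e c, odd (size c) & has (mem S) c].

Definition no_odd_S_cycle_minus (T : finType) (e : rel T) (S X : {set T}) : Prop :=
  forall c : seq T, odd_S_cycle (del_rel e X) S c -> False.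

Definition bipartite_minus (T : finType) (e : rel T) (Y : {set T}) : Prop :=
  exists f : T -> bool, forall x y, del_rel e Y x y -> f x != f y.

(* Main.v *)
Require Import Defs.
From mathcomp Require Import all_boot.
From mathcomp Require Import zify.
From Stdlib Require Import Classical ClassicalEpsilon.
Set Implicit Arguments. Unset Strict Implicit. Unset Printing Implicit Defensive.

(**
If |S| < k then X = S works, so let S' be k vertices of S, and let c be a maximum
cut of G - S'.  By a counting argument of Mader type, the cut contains a dense
highly connected bipartite subgraph on a vertex set U, and by the theorem of
Thomas and Wollan every pairing of at most 4k vertices
of U is linked in it by disjoint connected sets.

Call a path with ends in U and no inner vertex in U odd if its parity disagrees
with the colours c of its ends.  Odd U-paths correspond to a matching problem in
two layered copies of G - S': by the Tutte-Berge formula either there are 3k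
disjoint odd U-paths, or fewer than 6k vertices make G - S' bipartite.  In the
first case Menger's theorem gives 2k disjoint paths from neighbours of S' to U,
two for each vertex of S', and these can be rerouted so as to meet at most 2k of the
odd paths; the k remaining ones and the linkage in U yield k disjoint odd S-cycles.

In the second case, at most 7k vertices Y make G bipartite.  Extending the
colouring of G - Y to Y by majority, the properly coloured edges form a linked
graph, even after deleting k vertices, so k disjoint monochromatic edges together
with k distinct suitable vertices of S yield k disjoint odd S-cycles.  If they do not
exist, the ends of a maximal matching of monochromatic edges, together with k - 1
vertices of S for the second set, give the sets X and Y of the theorem.
*)

(** * Menger's theorem *)

(* zify is slow on large contexts, so only the numerical hypotheses are kept. *)
Ltac nlia := repeat match goal with H : ?P |- _ =>
  lazymatch type of P with Prop =>
    lazymatch P with is_true (leq _ _) => fail | is_true (~~ (leq _ _)) => fail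
      | @eq nat _ _ => fail | _ => clear H end end end; lia.

(** The obstacle is parity. A linkage in a properly 2-coloured graph joins its terminals by paths
    whose parity is dictated by the colours, so alone it never yields an odd cycle. Parity is
    imported by paths that contradict the colouring: odd [U]-paths in the first case, monochromatic
    edges in the second. A path through a vertex of [S] with both ends in the linked set either
    contradicts the colouring itself and is closed by one connection, or needs such a path as a
    partner and two connections. Hence up to [2 * k] connections and [4 * k] terminals. The number
    [3 * k] of odd paths allows for the [2 * k] that the legs from [S'] to [U] may spoil.

    Deleting [S'] leaves degrees of at least [49 * k], and a maximum cut keeps half of each. This
    amounts to slightly more than [12 * k] edges per vertex, which is the density at which [4 * k]
    vertices can be linked. Deleting [S'] also keeps the linked set clear of the vertices that the
    cycles have to visit. *)

Section Basics.
Variable T : finType.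
Implicit Types (e : rel T) (A B D S X Z : {set T}).

Definition ind e D : rel T := fun x y => [&& e x y, x \in D & y \in D].
Arguments ind e D x y /.

Lemma ind_sym e D : symmetric e -> symmetric (ind e D).
Proof. by move=> es x y; rewrite /ind /= es [(x \in D) && _]andbC. Qed.

Lemma connect_inv (r : rel T) (P : T -> Prop) x y :
  (forall u v, P u -> r u v -> P v) -> connect r x y -> P x -> P y.
Proof.
move=> st /connectP[p + ->]; elim: p x => //= z p IH x /andP[xz zp] Px.
by apply: IH zp _; apply: st xz.
Qed.

Lemma connect_mono (r r' : rel T) x y :
  (forall u v, r u v -> r' u v) -> connect r x y -> connect r' x y.
Proof. by move=> rr; move: x y; apply: connect_sub => u v /rr; apply: connect1. Qed.

Lemma connect_symr (r : rel T) x y : symmetric r -> connect r x y -> connect r y x.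
Proof. by move=> rs; rewrite (sym_connect_sym rs). Qed.

Lemma path_ind e D x p : path e x p -> {subset x :: p <= D} -> path (ind e D) x p.
Proof.
elim: p x => //= z p IH x /andP[xz zp] sub.
rewrite xz sub ?inE ?eqxx // sub ?inE ?eqxx ?orbT //=.
by apply: IH => // u uzp; apply: sub; rewrite inE uzp orbT.
Qed.

Lemma path_ind_sub e D x p : path (ind e D) x p -> path e x p.
Proof. by apply: sub_path => u v /and3P[]. Qed.

Lemma path_ind_in e D x p : path (ind e D) x p -> x \in D -> {subset x :: p <= D}.
Proof.
elim: p x => [|z p IH] x /=; first by move=> _ xD u; rewrite inE => /eqP->.
by move=> /andP[/and3P[_ _ zD] zp] xD u; rewrite inE => /predU1P[->|/IH->].
Qed.

Lemma path_connect_in e D x p : path e x p -> {subset x :: p <= D} ->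
  connect (ind e D) x (last x p).
Proof. by move=> pp sub; apply/connectP; exists p => //; apply: path_ind. Qed.

Lemma connect_path e D x y : x \in D -> connect (ind e D) x y ->
  exists p, [/\ path e x p, uniq (x :: p), last x p = y & {subset x :: p <= D}].
Proof.
move=> xD /connectP[p pp ->]; case: (shortenP pp) => p' pp' up' _.
by exists p'; split=> //; [exact: path_ind_sub pp' | exact: path_ind_in pp' xD].
Qed.

Lemma ex_min (I : Type) (P : I -> Prop) (f : I -> nat) :
  (exists i, P i) -> exists i, P i /\ forall j, P j -> f i <= f j.
Proof.
move=> [i0 Pi0]; have [n] := ubnP (f i0); elim: n i0 Pi0 => // n IH i Pi lei.
case: (classic (exists j, P j /\ f j < n)) => [[j [Pj lej]]|no]; first exact: IH Pj lej.
exists i; split=> // j Pj; rewrite leqNgt; apply/negP => lt; apply: no.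
by exists j; split=> //; nlia.
Qed.

Lemma ex_max (I : Type) (P : I -> Prop) (f : I -> nat) (b : nat) :
  (exists i, P i) -> (forall i, P i -> f i <= b) ->
  exists i, P i /\ forall j, P j -> f j <= f i.
Proof.
move=> exP bd; have [i [Pi mi]] := ex_min (fun i => b - f i) exP.
by exists i; split=> // j Pj; move: (mi j Pj) (bd i Pi) (bd j Pj); nlia.
Qed.

(** Trivial walks count, so a separator in this sense contains [A :&: B]. *)
Definition separates e A B Z :=
  forall a b, a \in A -> a \notin Z -> b \in B -> b \notin Z -> ~~ connect (ind e (~: Z)) a b.

Definition hits e B (a : T) (p : seq T) :=
  [/\ path e a p, uniq (a :: p), last a p \in B & forall v, v \in belast a p -> v \notin B].

Definition disj_paths (A : {set T}) (Q : T -> seq T) :=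
  forall a a' v, a \in A -> a' \in A -> v \in a :: Q a -> v \in a' :: Q a' -> a = a'.

Lemma path_sub_rel (r r' : rel T) x p : (forall u v, r u v -> r' u v) -> path r x p -> path r' x p.
Proof. by move=> rr; apply: sub_path. Qed.

Lemma belast_last (x : T) p v : v \in x :: p -> v \in belast x p \/ v = last x p.
Proof. by rewrite lastI mem_rcons inE => /predU1P[]; [right|left]. Qed.

(** For following a path relative to the part [D] reachable before a separator [P]: a step out of
    [D] must enter [P], so a path that meets [P] at its end at most cannot leave [D] earlier.
    [path_avoids] is the same argument read from the last vertex. *)
Lemma path_stays (r : rel T) (D : {set T}) (P : pred T) x p :
  (forall u v, u \in D -> r u v -> ~~ P v -> v \in D) -> path r x p ->
  (forall v, v \in belast x p -> ~~ P v) -> (p != [::] -> x \in D) ->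
  forall v, v \in belast x p -> v \in D.
Proof.
move=> cl; elim: p x => //= z q IHq x /andP[hz pq] bq xD v; rewrite inE => /predU1P[->|]; first exact: xD.
apply: IHq => // [u ub|qn]; first by apply: bq; rewrite inE ub orbT.
apply: cl (xD isT) hz _; apply: bq; rewrite inE; apply/orP; right.
by case: q qn {pq} => //= t q _; rewrite inE eqxx.
Qed.

Lemma path_avoids (r : rel T) (D : {set T}) (P : pred T) x p :
  (forall u v, u \in D -> r u v -> ~~ P v -> v \in D) -> path r x p ->
  (forall v, v \in p -> ~~ P v) -> last x p \notin D -> forall v, v \in x :: p -> v \notin D.
Proof.
move=> cl; elim: p x => [|z q IHq] x /=; first by move=> _ _ h v; rewrite inE => /eqP->.
move=> /andP[hz pq] tl lD; have IH' := IHq z pq (fun u uq => tl u (@mem_behead _ (z :: q) u uq)) lD.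
move=> v; rewrite inE => /predU1P[->|/IH' //]; apply/negP => xD.
move/negP: (IH' z (mem_head _ _)); apply; apply: cl xD hz _; apply: tl; exact: mem_head.
Qed.

(* Goring's induction: after deletion of the edge [x - y] a separator [S] smaller than [A] appears; the paths
   from [A] to [S + x] and from [S + y] to [B] given by the induction are glued together. *)
Lemma menger_wlog e (x y : T) (S A B : {set T}) : symmetric e ->
  let H : rel T := fun u v => [&& e u v, ~~ ((u == x) && (v == y)) & ~~ ((u == y) && (v == x))] in
  let RA := [set w | (w \notin S) && [exists a, [&& a \in A, a \notin S & connect (ind H (~: S)) a w]]] in
  e x y -> separates H A B S -> #|S| < #|A| -> x \in RA -> y \notin RA -> y \notin S ->
  (forall Z, separates e A B Z -> #|A| <= #|Z|) ->
  (forall A' B', (forall Z, separates H A' B' Z -> #|A'| <= #|Z|) ->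
     exists Q, (forall a, a \in A' -> hits H B' a (Q a)) /\ disj_paths A' Q) ->
  exists Q, (forall a, a \in A -> hits e B a (Q a)) /\ disj_paths A Q.
Proof.
move=> es H RA exy sepS ltS xRA yRA yS minA IH.
have Hs : symmetric H.
  by move=> u v; rewrite /H /= es; case: (e v u) => //=; rewrite andbC [(v == x) && _]andbC [(v == y) && _]andbC.
have He u v : H u v -> e u v by case/and3P.
have eH u v : e u v -> H u v \/ (u = x /\ v = y) \/ (u = y /\ v = x).
  move=> euv; rewrite /H /= euv; case: (boolP ((u == x) && (v == y))) => [/andP[/eqP-> /eqP->]|_] /=; first by right; left.
  by case: (boolP ((u == y) && (v == x))) => [/andP[/eqP-> /eqP->]|_] /=; auto.
clearbody H; have RA_S w : w \in RA -> w \notin S by rewrite inE => /andP[].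
have RA_cl u v : u \in RA -> H u v -> v \notin S -> v \in RA.
  move=> uR huv vS; have uS := RA_S u uR; move: uR; rewrite !inE vS uS /=.
  case/existsP=> a /and3P[aA aS c]; apply/existsP; exists a; rewrite aA aS /=.
  by apply: connect_trans c _; apply: connect1; rewrite /= !inE uS vS huv.
have RA_A a : a \in A -> a \notin S -> a \in RA.
  by move=> aA aS; rewrite inE aS; apply/existsP; exists a; rewrite aA aS connect0.
have RA_B b : b \in B -> b \notin RA.
  move=> bB; apply/negP; rewrite inE => /andP[bS /existsP[a /and3P[aA aS c]]].
  by move/negP: (sepS a b aA aS bB bS); apply.
clearbody RA; have xS := RA_S x xRA.
have card1 : #|x |: S| = #|S|.+1 by rewrite cardsU1 xS.
have card2 : #|y |: S| = #|S|.+1 by rewrite cardsU1 yS.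
(* Adding [x] to [S] also blocks the deleted edge, so [x |: S] separates in [e]. *)
have cardA : #|A| = #|S|.+1.
  apply/eqP; rewrite eqn_leq ltS andbT -card1; apply: minA => a b aA aS bB bS.
  apply/negP => c; move: aS bS; rewrite !inE !negb_or => /andP[ax aS] /andP[bx bS].
  move/negP: (sepS a b aA aS bB bS); apply; apply: connect_mono c => u v /=.
  rewrite !inE !negb_or => /and3P[euv /andP[ux uS] /andP[vx vS]].
  rewrite uS vS !andbT; case: (eH _ _ euv) => // -[[Eu Ev]|[Eu Ev]].
    by rewrite Eu eqxx in ux.
  by rewrite Ev eqxx in vx.
(* A set that separates [A] from [x |: S] in [H] separates [A] from [B] in [e]: a walk avoiding it
   never reaches [S] or [x], hence stays in [RA], which contains no vertex of [B]. *)
have [Q [hQ dQ]] : exists Q, (forall a, a \in A -> hits H (x |: S) a (Q a)) /\ disj_paths A Q.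
  apply: IH => Z sepZ; apply: minA => a b aA aZ bB bZ; apply/negP => c.
  have key (P := fun w => connect (ind H (~: Z)) a w /\ w \in RA) : P b.
    apply: (connect_inv (x := a) _ c) => [u v [cu uR] /and3P[euv]|].
      rewrite !inE => uZ vZ; case: (eH _ _ euv) => [huv|[[Eu Ev]|[Eu Ev]]]; last by move: uR; rewrite Eu (negbTE yRA).
        have cv : connect (ind H (~: Z)) a v by apply: connect_trans cu (connect1 _); rewrite /= !inE uZ vZ huv.
        split=> //; apply: RA_cl uR huv _; apply/negP => vS.
        by move/negP: (sepZ a v aA aZ (setU1r _ vS) vZ); apply.
      by move: (sepZ a u aA aZ); rewrite Eu !inE eqxx -Eu => /(_ isT uZ); rewrite cu.
    split; first exact: connect0.
    by apply: RA_A => //; apply/negP => aS; move/negP: (sepZ a a aA aZ (setU1r _ aS) aZ); apply; apply: connect0.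
  by case: key => _; rewrite (negbTE (RA_B b bB)).
have [R [hR dR]] : exists R, (forall a, a \in y |: S -> hits H B a (R a)) /\ disj_paths (y |: S) R.
  apply: IH => Z sepZ; rewrite card2 -cardA; apply: minA => a b aA aZ bB bZ; apply/negP => c.
  have key (P := fun w => connect (ind H (~: Z)) w b /\ w \notin RA) : P a.
    have c' : connect (ind e (~: Z)) b a by apply: connect_symr c; apply: ind_sym.
    apply: (connect_inv (x := b) _ c') => [u v [cu uR] /and3P[euv]|]; last by split; rewrite ?RA_B.
    rewrite !inE => uZ vZ; case: (eH _ _ euv) => [huv|[[Eu Ev]|[Eu Ev]]]; first last.
    - by move: (sepZ u b); rewrite Eu !inE eqxx -Eu => /(_ isT uZ bB bZ); rewrite cu.
    - by move: uR; rewrite Eu xRA.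
    split; first by apply: connect_trans cu; apply: connect1; rewrite /= !inE uZ vZ Hs huv.
    apply/negP => vR; have uS : u \in S.
      by apply/negPn/negP => uS; move/negP: uR; apply; apply: RA_cl vR _ uS; rewrite Hs.
    by move/negP: (sepZ u b (setU1r _ uS) uZ bB bZ); apply.
  case: key => ca aR; have aS : a \in S by apply/negPn/negP => /(RA_A a aA); rewrite (negbTE aR).
  by move/negP: (sepZ a b (setU1r _ aS) aZ bB bZ); apply.
(* [ph] sends the end of a first half to the start of its continuation. The halves do not interfere,
   because the first ones lie in [RA] up to their ends and the second ones avoid [RA]. *)
pose ph p := if p == x then y else p.
pose l a := ph (last a (Q a)).
pose W a := Q a ++ (if last a (Q a) == x then y :: R y else R (last a (Q a))).
have phP p : p \in x |: S -> ph p \in y |: S.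
  by rewrite /ph !inE; case: eqP => [->|]; rewrite ?eqxx //= => _ ->; rewrite orbT.
have Qbel a v : a \in A -> v \in belast a (Q a) -> v \in RA.
  move=> aA; have [pQ _ _ bQ] := hQ a aA.
  apply: (path_stays (P := mem S) RA_cl pQ) => [u /bQ|Qn]; first by rewrite !inE negb_or => /andP[].
  apply: RA_A => //; have: a \in belast a (Q a) by case: (Q a) Qn => //= z q; rewrite inE eqxx.
  by move/bQ; rewrite !inE negb_or => /andP[].
have Rtail p v : p \in y |: S -> v \in R p -> v \notin S.
  move=> pP vR; apply/negP => vS; have [_ /= /andP[pR _] _ _] := hR p pP.
  have E : p = v by apply: (dR p v v) => //; [exact: setU1r | rewrite inE vR orbT | exact: mem_head].
  by move: pR; rewrite {1}E vR.
have Rout p v : p \in y |: S -> v \in p :: R p -> v \notin RA.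
  move=> pP; have [pR _ lR _] := hR p pP.
  by apply: (path_avoids (P := mem S) RA_cl pR _ (RA_B _ lR)) => u; apply: Rtail.
have lP a : a \in A -> l a \in y |: S.
  by move=> aA; apply: phP; case: (hQ a aA).
have RS p : p \in x |: S -> p != x -> p \in S by rewrite !inE => /orP[->|].
have mW a v : a \in A -> v \in a :: W a ->
    (v \in RA /\ v \in a :: Q a) \/ (v \notin RA /\ v \in l a :: R (l a)).
  move=> aA; have [_ _ lQ _] := hQ a aA; have lp := lP a aA.
  rewrite -cat_cons mem_cat => /orP[vQ|vR].
    case: (belast_last vQ) => [/(Qbel a v aA) ?|Ev]; first by left.
    have [vx|vx] := eqVneq v x; first by left; rewrite vx xRA -vx.
    by right; rewrite -Ev in lQ; rewrite /l -Ev /ph (negbTE vx) mem_head; split=> //;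
       apply: Rout (mem_head _ _); apply: setU1r; apply: RS.
  right; have vl : v \in l a :: R (l a).
    by move: vR; rewrite /l /ph; case: eqP => // _ h; rewrite inE h orbT.
  by split=> //; apply: Rout vl.
exists W; split=> [a aA|a a' v aA a'A vW vW']; last first.
  case: (mW a v aA vW) => [[vR vQ]|[vR vQ]]; case: (mW a' v a'A vW') => [[vR' vQ']|[vR' vQ']];
    [exact: dQ vQ vQ' | by rewrite vR in vR' | by rewrite vR' in vR | ].
  have El := dR _ _ v (lP a aA) (lP a' a'A) vQ vQ'.
  have El' : last a (Q a) = last a' (Q a').
    have [_ _ lQ _] := hQ a aA; have [_ _ lQ' _] := hQ a' a'A.
    move: El lQ lQ'; rewrite /l /ph; case: eqP => [->|_]; case: eqP => [->|_] //; rewrite !inE.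
      by move=> <-; rewrite (negbTE yS) orbF => _ /eqP.
    by move=> ->; rewrite (negbTE yS) orbF => /eqP.
  by apply: (dQ _ _ (last a (Q a)) aA a'A); [exact: mem_last | rewrite El' mem_last].
have [pQ uQ lQ bQ] := hQ a aA; have [pR uR lR bR] := hR _ (lP a aA).
have bel v : v \in belast a (Q a) -> v \notin B.
  by move/(Qbel a v aA); apply: contraL; apply: RA_B.
rewrite /hits /W -cat_cons cat_uniq cat_path uQ last_cat belast_cat.
rewrite /l /ph in pR uR lR bR; have := lP a aA; rewrite /l /ph => lp.
rewrite (path_sub_rel He pQ); case: eqP pR uR lR bR lp => [Ex|Nx] pR uR lR bR lp.
  rewrite /= Ex exy (path_sub_rel He pR) lR; split=> //.
    move: uR => /= ->; rewrite andbT.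
    suff: ~~ has (mem (a :: Q a)) (y :: R y) by []; apply/hasPn => v vR; apply/negP => vQ.
    by have := Rout y v lp vR; case: (belast_last vQ) => [/(Qbel a v aA) ->|->] //; rewrite Ex xRA.
  move=> v; rewrite mem_cat inE => /orP[/bel //|/orP[/eqP ->|/bR //]].
  by apply/negP => /RA_B; rewrite xRA.
rewrite (path_sub_rel He pR) lR; split=> //.
  move: uR => /= /andP[lnR ->]; rewrite andbT /=; apply/hasPn => v vR /=; apply/negP => vQ.
  case: (belast_last vQ) => [/(Qbel a v aA)|Ev]; last by move: lnR; rewrite -{1}Ev vR.
  by apply/negP/(Rout _ _ lp); rewrite inE vR orbT.
by move=> v; rewrite mem_cat => /orP[/bel|/bR].
Qed.

(** Only the case in which every vertex of [A] starts a path is needed, which avoids the choice of a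
    subfamily. Induction on the number of ordered edges. *)
Theorem menger e A B : symmetric e -> (forall Z, separates e A B Z -> #|A| <= #|Z|) ->
  exists Q, (forall a, a \in A -> hits e B a (Q a)) /\ disj_paths A Q.
Proof.
have [n] := ubnP #|[set p : T * T | e p.1 p.2]|; elim: n e A B => // n IH e A B ltn es minA.
case: (classic (exists x y, e x y)) => [[x [y exy]]|no]; last first.
  exists (fun=> [::]); split=> [a aA|a a' v _ _]; last by rewrite !inE => /eqP-> /eqP.
  have AB : A \subset B.
    apply/setIidPl/eqP; rewrite eqEcard subsetIl; apply: minA => u v uA uZ vB vZ.
    apply/negP => /connectP[[|w p] /=]; last by move=> /andP[/and3P[euw _ _] _] _; apply: no; exists u, w.
    by move=> _ Ev; move: uZ; rewrite inE uA -Ev vB.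
  by split=> //=; apply: (subsetP AB).
pose H (x y : T) : rel T := fun u v => [&& e u v, ~~ ((u == x) && (v == y)) & ~~ ((u == y) && (v == x))].
have Hs x' y' : symmetric (H x' y').
  by move=> u v; rewrite /H /= es; case: (e v u) => //=; rewrite andbC [(v == x') && _]andbC [(v == y') && _]andbC.
have He x' y' u v : H x' y' u v -> e u v by case/and3P.
have IHH x' y' : e x' y' -> forall A' B', (forall Z, separates (H x' y') A' B' Z -> #|A'| <= #|Z|) ->
     exists Q, (forall a, a \in A' -> hits (H x' y') B' a (Q a)) /\ disj_paths A' Q.
  move=> exy' A' B' m; apply: IH => //; rewrite -ltnS; apply: leq_trans ltn; rewrite ltnS.
  apply: proper_card; apply/properP; split; first by apply/subsetP => p; rewrite !inE => /He.
  by exists (x', y'); rewrite !inE //= /H !eqxx andbF.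
case: (classic (exists S, separates (H x y) A B S /\ #|S| < #|A|)) => [[S [sepS ltS]]|noS]; last first.
  have [|Q [hQ dQ]] := IHH x y exy A B.
    by move=> Z sZ; rewrite leqNgt; apply/negP => lt; apply: noS; exists Z.
  exists Q; split=> // a /hQ[p1 p2 p3 p4]; split=> //; exact: path_sub_rel (@He x y) p1.
pose RA := [set w | (w \notin S) && [exists a, [&& a \in A, a \notin S & connect (ind (H x y) (~: S)) a w]]].
(* [S] is too small to separate in [e], so some edge leaves [RA] without entering [S]. It is not an
   edge of [H x y], hence it is the deleted edge, in one of its two directions. *)
have : exists u v, [/\ e u v, u \in RA, v \notin RA & v \notin S].
  apply: NNPP => nuv; suff: separates e A B S by move/minA; rewrite leqNgt ltS.
  move=> a b aA aS bB bS; apply/negP => c.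
  have: b \in RA.
    apply: (connect_inv (x := a) (P := fun w => w \in RA) _ c) => [u v uR /and3P[euv uS vS]|].
      by apply/negPn/negP => vR; apply: nuv; exists u, v; split=> //; rewrite inE in vS.
    by rewrite inE aS; apply/existsP; exists a; rewrite aA aS connect0.
  rewrite inE => /andP[_ /existsP[a' /and3P[a'A a'S c']]].
  by move/negP: (sepS a' b a'A a'S bB bS); apply.
move=> [u [v [euv uR vR vS]]].
have HE : H x y =2 H u v \/ H x y u v.
  have [h|/negP h] := boolP (H x y u v); [by right | left => s t].
  have : (u == x) && (v == y) || (u == y) && (v == x).
    by apply/negPn/negP => h'; apply: h; rewrite /H /= euv -negb_or.
  case/orP => /andP[/eqP-> /eqP->]; rewrite /H //=.
  by case: (e s t) => //=; rewrite andbC.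
case: HE => [HE|huv]; last first.
  move: vR; rewrite inE vS /= => /negP; case; apply/existsP.
  move: uR; rewrite inE => /andP[uS /existsP[a /and3P[aA aS c]]]; exists a; rewrite aA aS /=.
  by apply: connect_trans c (connect1 _); rewrite /ind /= !inE uS vS huv.
have IE w w' : ind (H x y) (~: S) w w' = ind (H u v) (~: S) w w' by rewrite /ind /= -[H u v w w']HE.
have RE w : (w \in RA) = (w \in [set w | (w \notin S) && [exists a, [&& a \in A, a \notin S & connect (ind (H u v) (~: S)) a w]]]).
  by rewrite !inE; congr (_ && _); apply: eq_existsb => a; rewrite (eq_connect IE).
apply: (@menger_wlog e u v S A B) => //; rewrite -?RE //; last exact: (IHH u v euv).
by move=> a b aA aS bB bS; rewrite -(eq_connect IE); apply: sepS.
Qed.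
End Basics.
Arguments ind {T} e D x y /.

(** * Counting and linkages in very dense graphs *)

Definition cdec (P : Prop) : bool := if excluded_middle_informative P then true else false.

Lemma cdecP (P : Prop) : reflect P (cdec P).
Proof. by rewrite /cdec; case: excluded_middle_informative => h; constructor. Qed.

Lemma fchoice (A B : Type) (b0 : B) (P : A -> Prop) (R : A -> B -> Prop) :
  (forall a, P a -> exists b, R a b) -> exists f, forall a, P a -> R a (f a).
Proof.
move=> h; have h' a : exists b, P a -> R a b.
  by case: (classic (P a)) => [/h[b ?]|np]; [exists b | exists b0].
exists (fun a => proj1_sig (constructive_indefinite_description _ (h' a))) => a.
exact: proj2_sig (constructive_indefinite_description _ (h' a)).
Qed.

Section Counting.
Variables (T I : finType).
Implicit Types (A B C U : {set T}) (P Q : {set I}).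

Lemma cardsI_ge A B U : A \subset U -> B \subset U -> #|A| + #|B| <= #|U| + #|A :&: B|.
Proof.
move=> AU BU; rewrite -cardsUI leq_add2r; apply: subset_leq_card.
by rewrite subUset AU.
Qed.

Lemma cardsU_le A B : #|A :|: B| <= #|A| + #|B|.
Proof. by rewrite cardsU leq_subr. Qed.

Lemma cardsD_ge A B : #|A| <= #|A :\: B| + #|B|.
Proof. by rewrite -{1}(cardsID B A) addnC leq_add2l subset_leq_card ?subsetIr. Qed.

Lemma card3_le (A B C F : {set T}) : A \subset F -> B \subset F -> C \subset F ->
  [disjoint A & B] -> [disjoint B & C] -> [disjoint A & C] -> #|A| + #|B| + #|C| <= #|F|.
Proof.
move=> AF BF CF /disjoint_setI0 AB /disjoint_setI0 BC /disjoint_setI0 AC.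
have := cardsUI A B; have := cardsUI (A :|: B) C; rewrite setIUl AB BC AC setU0 cards0.
have : #|A :|: B :|: C| <= #|F| by rewrite subset_leq_card // !subUset AF BF CF.
nlia.
Qed.

Lemma card_bigcup_le P (F : I -> {set T}) : #|\bigcup_(i in P) F i| <= \sum_(i in P) #|F i|.
Proof.
elim/big_rec2: _ => [|i n U _ IH]; first by rewrite cards0.
by apply: leq_trans (cardsU_le _ _) _; rewrite leq_add2l.
Qed.

Lemma card_bigcup_disj P (F : I -> {set T}) :
  (forall i j v, i \in P -> j \in P -> v \in F i -> v \in F j -> i = j) ->
  #|\bigcup_(i in P) F i| = \sum_(i in P) #|F i|.
Proof.
have [n] := ubnP #|P|; elim: n P => // n IH P ltn dF.
case: (set_0Vmem P) => [->|[i iP]]; first by rewrite !big_set0 cards0.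
rewrite !(big_setD1 i iP) /= cardsU -IH; first last.
- by move=> j k v; rewrite !inE => /andP[_ jP] /andP[_ kP]; apply: dF.
- by move: ltn; rewrite (cardsD1 i P) iP; nlia.
suff -> : F i :&: \bigcup_(j in P :\ i) F j = set0 by rewrite cards0 subn0.
apply/setP => v; rewrite !inE; apply/negP => /andP[v1 /bigcupP[j]]; rewrite !inE => /andP[ji jP] v2.
by move/eqP: ji; apply; apply: dF v2 v1.
Qed.

Lemma greedy_sdr (x0 : T) P (S : I -> {set T}) : (forall i, i \in P -> #|P| <= #|S i|) ->
  exists f : I -> T, (forall i, i \in P -> f i \in S i) /\ {in P &, injective f}.
Proof.
have [n] := ubnP #|P|; elim: n P => // n IH P ltn big.
case: (set_0Vmem P) => [->|[i iP]]; first by exists (fun=> x0); split=> [j|j k]; rewrite inE.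
have cP : #|P| = #|P :\ i|.+1 by rewrite (cardsD1 i) iP.
have [|j|f [fS fi]] := IH (P :\ i); first by nlia.
  by rewrite inE => /andP[_ /big]; nlia.
have : 0 < #|S i :\: f @: (P :\ i)|.
  by have := cardsD_ge (S i) (f @: (P :\ i)); have : #|f @: (P :\ i)| <= #|P :\ i| := leq_imset_card _ _; have := big i iP; nlia.
case/card_gt0P=> z; rewrite inE => /andP[zf zS].
exists (fun j => if j == i then z else f j); split=> [j jP|j k jP kP].
  by case: eqVneq => [->//|ji]; apply: fS; rewrite !inE ji.
case: eqVneq => [->|ji]; case: eqVneq => [->|ki] // E.
- by case/negP: zf; rewrite E imset_f // !inE ki.
- by case/negP: zf; rewrite -E imset_f // !inE ji.
- by apply: fi; rewrite ?inE ?ji ?ki.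
Qed.

(** Applied with [g i] the number of neighbours of a vertex among the two terminals of pair [i],
    each index of [Q] lowering the maximum by one. *)
Lemma sum_defect P Q (g : I -> nat) (c : nat) : Q \subset P -> (forall i, i \in P -> g i + (i \in Q) <= c) ->
  \sum_(i in P) g i + #|Q| <= c * #|P|.
Proof.
move=> QP h; have -> : #|Q| = \sum_(i in P) (i \in Q).
  rewrite -sum1_card big_mkcond [RHS]big_mkcond; apply: eq_bigr => i _.
  by case: (boolP (i \in Q)) => [/(subsetP QP) ->|]; case: (i \in P).
by rewrite -big_split mulnC -sum_nat_const; apply: leq_sum.
Qed.

End Counting.

Section Link.
Variables (T I : finType).
Implicit Types (e : rel T) (L D : {set T}) (P : {set I}) (w : I -> bool -> T).

Definition nb e L x : {set T} := [set y in L | e x y].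

Lemma in_nb e L x y : (y \in nb e L x) = (y \in L) && e x y.
Proof. by rewrite inE. Qed.

Definition terms P w : {set T} := [set w p.1 p.2 | p in setX P [set: bool]].

Definition distinct P w := forall i j b c, i \in P -> j \in P -> w i b = w j c -> i = j /\ b = c.

(** Pair [i] consists of [w i true] and [w i false]. Disjoint connected sets stand in for paths,
    since they can be united, enlarged and pulled back through contractions without splicing
    lists. *)
Definition linkage e L P w (D : I -> {set T}) :=
  [/\ forall i, i \in P -> D i \subset L,
      forall i b, i \in P -> w i b \in D i,
      forall i, i \in P -> connect (ind e (D i)) (w i true) (w i false) &
      forall i j, i \in P -> j \in P -> i != j -> [disjoint D i & D j]].

Lemma termsP P w v : reflect (exists i b, i \in P /\ v = w i b) (v \in terms P w).
Proof.
apply: (iffP imsetP) => [[[i b]]|[i [b [iP ->]]]]; first by rewrite !inE andbT /= => iP ->; exists i, b.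
by exists (i, b); rewrite ?inE //= iP.
Qed.

Lemma terms_in P w i b : i \in P -> w i b \in terms P w.
Proof. by move=> iP; apply/termsP; exists i, b. Qed.

Lemma card_terms P w : distinct P w -> #|terms P w| = 2 * #|P|.
Proof.
move=> dw; rewrite card_in_imset ?cardsX ?cardsT ?card_bool 1?mulnC //.
move=> [i b] [j c]; rewrite !inE /= !andbT => iP jP E.
by have [-> ->] := dw _ _ _ _ iP jP E.
Qed.

Lemma card_terms_cap P w (U : {set T}) :
  #|terms P w :&: U| <= \sum_(i in P) ((w i true \in U) + (w i false \in U)).
Proof.
apply: leq_trans (_ : #|\bigcup_(i in P) ([set w i true; w i false] :&: U)| <= _).
  apply: subset_leq_card; apply/subsetP => v; rewrite inE => /andP[/termsP[i [b [iP ->]]] vU].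
  by apply/bigcupP; exists i => //; rewrite !inE vU andbT; case: b {vU}; rewrite eqxx ?orbT.
apply: leq_trans (card_bigcup_le _ _) _; apply: leq_sum => i _.
have sb : [set w i true; w i false] :&: U \subset
   (if w i true \in U then [set w i true] else set0) :|: (if w i false \in U then [set w i false] else set0).
  apply/subsetP => v; rewrite !inE => /andP[/orP[]/eqP-> ->]; by rewrite inE eqxx ?orbT.
apply: leq_trans (subset_leq_card sb) _; apply: leq_trans (cardsU_le _ _) _.
by case: ifP; case: ifP; rewrite ?cards1 ?cards0.
Qed.

(* [Q] consists of the pairs left unmatched by some maximum matching of pairs to common neighbours with the
   given image; a vertex outside the image misses an end of each of them, which makes the rest very dense. *)
Lemma dense_link e L P w d : symmetric e -> irreflexive e ->
  (forall i b, i \in P -> w i b \in L) -> distinct P w ->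
  (forall i, i \in P -> ~~ e (w i true) (w i false)) ->
  (forall x, x \in L -> d <= #|nb e L x|) ->
  2 * #|L| + 5 * #|P| <= 4 * d + 7 -> 3 * #|P| <= #|L| ->
  exists Dk, linkage e L P w Dk.
Proof.
move=> es ei wL dw nadj deg num1 num2.
case: (set_0Vmem P) => [P0|[i0 i0P]].
  by exists (fun=> set0); rewrite P0; split=> i; rewrite ?inE // => b; rewrite inE.
set p := #|P| in num1 num2 *; have p1 : 0 < p by apply/card_gt0P; exists i0.
set n := #|L| in num1 num2 *.
pose x0 := w i0 true.
have cT : #|terms P w| = 2 * p := card_terms dw.
have TL : terms P w \subset L by apply/subsetP => v /termsP[i [b [iP ->]]]; apply: wL.
pose N := L :\: terms P w.
have cN : #|N| + 2 * p = n by have := cardsID (terms P w) L; rewrite (setIidPr TL) cT /N /n; nlia.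
have nadj' i b c : i \in P -> ~~ e (w i b) (w i c).
  by move=> iP; case: b c => -[]; rewrite ?ei // ?(nadj i iP) // es (nadj i iP).
have pairT i : i \in P -> #|terms P w :\: [set w i true; w i false]| + 2 = 2 * p.
  move=> iP; rewrite -cT -[in RHS](cardsID [set w i true; w i false]) addnC; congr (_ + _).
  rewrite (setIidPr _); last by apply/subsetP => v; rewrite !inE => /orP[]/eqP->; apply: terms_in.
  by rewrite cards2; case: eqP => // /(dw _ _ _ _ iP iP)[].
have nbN i b (Z : {set T}) : i \in P -> d <= #|nb e (N :\: Z) (w i b)| + #|Z| + (2 * p - 2).
  move=> iP; apply: leq_trans (deg _ (wL i b iP)) _.
  have sb : nb e L (w i b) \subset nb e (N :\: Z) (w i b) :|: Z :|: (terms P w :\: [set w i true; w i false]).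
    apply/subsetP => v; rewrite !inE => /andP[vL ev]; rewrite vL ev !andbT.
    case: (v \in Z); rewrite ?orbT //= orbF; case: (v \in terms P w) => //=.
    by rewrite andbT negb_or; apply/andP; split; apply/eqP => E; move: ev; rewrite E (negbTE (nadj' _ _ _ iP)).
  apply: leq_trans (subset_leq_card sb) _; apply: leq_trans (cardsU_le _ _) _; apply: leq_add.
    exact: cardsU_le.
  by have := pairT i iP; nlia.
pose C i := nb e N (w i true) :&: nb e N (w i false).
have cC i : i \in P -> 2 * d + 4 <= #|C i| + n + 2 * p.
  move=> iP; have := nbN i true set0 iP; have := nbN i false set0 iP; rewrite setD0 cards0.
  have := @cardsI_ge _ (nb e N (w i true)) (nb e N (w i false)) N.
  rewrite -/(C i) => h; have {h} := h _ _; case: (_ \subset _) / (idP) => //; last by case; apply/subsetP => v; rewrite inE => /andP[].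
  case: (nb e N (w i false) \subset _) / (idP) => // [_ _ h|[]]; last by apply/subsetP => v; rewrite inE => /andP[].
  by have := h isT isT; move: cN p1; nlia.
have CE i z : (z \in C i) = [&& z \in N, e (w i true) z & e (w i false) z].
  by rewrite !inE; case: (z \in L); case: (z \in terms P w); rewrite ?andbF.
clearbody C.
(* A partial matching of pairs to common neighbours: the matched indices together with a function
   that is meaningful on them only. *)
pose mat (M : {set I} * {ffun I -> T}) := [&& M.1 \subset P, [forall i in M.1, M.2 i \in C i] & #|M.2 @: M.1| == #|M.1|].
have matP (M : {set I} * {ffun I -> T}) : mat M -> [/\ M.1 \subset P, (forall i, i \in M.1 -> M.2 i \in C i) & {in M.1 &, injective M.2}].
  by case/and3P=> a /forall_inP b /imset_injP c.
have matI (A : {set I}) (f : I -> T) : A \subset P -> (forall i, i \in A -> f i \in C i) -> {in A &, injective f} -> mat (A, finfun f).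
  move=> a b c; apply/and3P; split=> //=; first by apply/forall_inP => i iA; rewrite ffunE b.
  by apply/imset_injP => i j iA jA; rewrite !ffunE; apply: c.
have [[I0 m] [mM maxM]] : exists M, mat M /\ forall M', mat M' -> #|M'.1| <= #|M.1|.
  apply: (@ex_max _ (fun M => mat M) (fun M => #|M.1|) #|P|).
    exists (set0, [ffun=> x0]); apply/and3P; split; rewrite ?sub0set //=; first by apply/forall_inP => i; rewrite inE.
    by rewrite imset0 !cards0.
  by move=> M /matP[h _ _]; apply: subset_leq_card.
have [/= I0P mC mi] := matP _ mM.
pose r := p - #|I0|.
have rE : #|I0| + r = p by rewrite /r subnKC // subset_leq_card.
pose Im := m @: I0.
have cIm : #|Im| + r = p by rewrite /Im card_in_imset.
pose Q := [set i in P | [exists M : {set I} * {ffun I -> T}, [&& mat M, M.2 @: M.1 == Im & i \notin M.1]]].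
have QP : Q \subset P by apply/subsetP => i; rewrite inE => /andP[].
(* Some maximum matching with image [Im] misses [i], so [C i] lies in [Im]. Letting [i] take over
   any vertex of [C i] frees the index that held it, which therefore belongs to [Q] as well; the [r]
   missed indices come on top. *)
have QC i : i \in Q -> C i \subset Im /\ #|C i| + r <= #|Q|.
  rewrite inE => /andP[iP /existsP[[A f] /and3P[/= mf /eqP EIm iA]]].
  have [/= AP fC fi] := matP _ mf.
  have cA : #|A| = #|I0| by rewrite -(card_in_imset fi) EIm card_in_imset.
  have sub : C i \subset Im.
    apply/subsetP => z zC; apply/negPn/negP => zI.
    have := maxM _ (matI (i |: A) (fun j => if j == i then z else f j) _ _ _).
    rewrite /= cardsU1 iA /= -cA add1n ltnn => h; apply: notF; apply: h.
    - by rewrite subUset sub1set iP.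
    - by move=> j; rewrite !inE; case: eqVneq => [->|_] //= /fC.
    - move=> j k; rewrite !inE; case: eqVneq => [->|ji]; case: eqVneq => [->|ki] //= jA kA E.
      + by case/negP: zI; rewrite E -EIm imset_f.
      + by case/negP: zI; rewrite -E -EIm imset_f.
      + exact: fi.
  split=> //.
  have miss j : j \in P -> j \notin A -> j \in Q.
    by move=> jP jA; rewrite inE jP; apply/existsP; exists (A, f); rewrite mf jA /= EIm eqxx.
  have sub2 : C i \subset f @: (A :&: Q).
    apply/subsetP => z zC; have := subsetP sub z zC; rewrite -EIm => /imsetP[j jA Ez].
    rewrite Ez imset_f // inE jA inE (subsetP AP) //=; apply/existsP.
    have zA k : k \in A -> z = f k -> k = j by move=> kA E; apply: fi; rewrite -?Ez.
    exists (i |: (A :\ j), [ffun k => if k == i then z else f k]); apply/and3P; split=> /=.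
    - apply: matI => [|k|k l].
      + by rewrite subUset sub1set iP (subset_trans (subsetDl _ _) AP).
      + by rewrite !inE; case: eqVneq => [->|_] //= /andP[_ /fC].
      + rewrite !inE; case: (eqVneq k i) => [->|ki]; case: (eqVneq l i) => [->|li] //=.
        * by move=> _ /andP[lj lA] /(zA _ lA) E; rewrite E eqxx in lj.
        * by move=> /andP[lj lA] _ /esym /(zA _ lA) E; rewrite E eqxx in lj.
        * by move=> /andP[_ kA] /andP[_ lA]; apply: fi.
    - apply/eqP/setP => v; apply/imsetP/idP => [[k + ->]|].
        rewrite !inE ffunE; case: eqVneq => [_ _|_ /= /andP[_ kA]]; first by rewrite (subsetP sub).
        by rewrite -EIm imset_f.
      rewrite -EIm => /imsetP[k kA ->]; have [kj|kj] := eqVneq k j.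
        by exists i; rewrite ?inE ?eqxx // ffunE eqxx Ez kj.
      exists k; rewrite ?inE ?kj ?kA ?orbT // ffunE; case: eqP => // ki.
      by rewrite -ki kA in iA.
    - by rewrite !inE eqxx /= orbF; apply: contraNneq iA => <-.
  have := leq_trans (subset_leq_card sub2) (leq_imset_card _ _).
  have : #|P :\: A| <= #|Q :\: A|.
    by apply: subset_leq_card; apply/subsetP => k; rewrite !in_setD => /andP[kA kP]; rewrite kA (miss k).
  have := cardsID A P; have := cardsID A Q; rewrite (setIidPr AP) setIC -/p; nlia.
have unQ i : i \in P -> i \notin I0 -> i \in Q.
  by move=> iP iI; rewrite inE iP; apply/existsP; exists (I0, m); rewrite mM iI /= eqxx.
clearbody Q; pose F0 := N :\: Im.
have ImN : Im \subset N.
  by apply/subsetP => z /imsetP[i /mC + ->]; rewrite CE => /and3P[].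
have cF0 : #|F0| + 3 * p = n + r.
  by have := cardsID Im N; rewrite (setIidPr ImN) -/F0; move: cN cIm; nlia.
case: (set_0Vmem (P :\: I0)) => [P0|[i1]].
  have I0E : I0 = P by apply/eqP; rewrite eqEsubset I0P -setD_eq0 P0 eqxx.
  exists (fun i => [set w i true; w i false; m i]).
  have mN i : i \in P -> m i \in N by move=> iP; apply: (subsetP ImN); rewrite imset_f ?I0E.
  split=> [i iP|i b iP|i iP|i j iP jP ij].
  - by apply/subsetP => v; rewrite !inE => /orP[/orP[]|] /eqP->; rewrite ?wL //; have := mN i iP; rewrite inE => /andP[].
  - by case: b; rewrite !inE eqxx ?orbT.
  - have := mC i; rewrite I0E => /(_ iP); rewrite CE => /and3P[_ e1 e2].
    apply: (@connect_trans _ _ (m i)); apply: connect1; rewrite /= !inE !eqxx ?orbT /= ?e1 //.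
    by rewrite es e2.
  - rewrite -setI_eq0; apply/eqP/setP => v; rewrite !inE; apply/negP => /andP[].
    have mT k l b : k \in P -> l \in P -> m k <> w l b.
      by move=> kP lP E; have := mN k kP; rewrite inE E terms_in.
    case/orP=> [/orP[]|] /eqP-> => /orP[/orP[]|] /eqP E; try by [case: (dw _ _ _ _ iP jP E) => /eqP; rewrite (negbTE ij)].
    + by apply: (mT j i true).
    + by apply: (mT j i false).
    + by apply: (mT i j true).
    + by apply: (mT i j false).
    + by move/eqP: ij; apply; apply: mi => //; rewrite I0E.
rewrite inE => /andP[i1I i1P].
have r1 : 0 < r.
  by rewrite /r subn_gt0 -/p; apply: proper_card; apply/properP; split=> //; exists i1.
have cQ : 2 * d + 4 + r <= #|Q| + n + 2 * p.
  by have [_ ?] := QC i1 (unQ i1 i1P i1I); have := cC i1 i1P; nlia.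
have F0T y : y \in F0 -> #|nb e (terms P w) y| + #|Q| <= 2 * p.
  move=> yF; apply: leq_trans (_ : \sum_(i in P) ((w i true \in [set z | e y z]) + (w i false \in [set z | e y z])) + #|Q| <= _).
    rewrite leq_add2r; apply: leq_trans (card_terms_cap _ _ _); apply: subset_leq_card.
    by apply/subsetP => z; rewrite !inE.
  apply: sum_defect => // i iP; case: (boolP (i \in Q)) => [/QC[sC _]|_]; rewrite !inE; last by case: (e y _); case: (e y _).
  have : y \notin C i by apply/negP => /(subsetP sC); move: yF; rewrite inE => /andP[/negbTE ->].
  have yN : y \in N by move: yF; rewrite inE => /andP[].
  by rewrite CE es [e _ y]es yN /=; case: (e y _); case: (e y _).
have degF y : y \in F0 -> d <= #|nb e F0 y| + #|nb e (terms P w) y| + (p - r).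
  move=> yF; have yL : y \in L by move: yF; rewrite !inE => /andP[_ /andP[]].
  apply: leq_trans (deg _ yL) _.
  have sb : nb e L y \subset nb e F0 y :|: nb e (terms P w) y :|: Im.
    apply/subsetP => v; rewrite !inE => /andP[vL ev]; rewrite vL ev !andbT.
    by case: (v \in Im); rewrite ?orbT //= orbF; case: (v \in terms P w).
  apply: leq_trans (subset_leq_card sb) _; apply: leq_trans (cardsU_le _ _) _; apply: leq_add; first exact: cardsU_le.
  by move: cIm; nlia.
have F0n : 0 < #|F0| by nlia.
have [y0 y0F] : exists y, y \in F0 by apply/card_gt0P.
have irr (L' : {set T}) y : y \in L' -> #|nb e L' y| < #|L'|.
  move=> yL; apply: proper_card; apply/properP; split; first by apply/subsetP => v; rewrite inE => /andP[].
  by exists y; rewrite ?inE ?ei ?andbF.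
have dQ : d + 1 + #|Q| <= n.
  have := degF y0 y0F; have := F0T y0 y0F; have := irr _ _ y0F; nlia.
have nbF i b : i \in P -> 2 * r <= #|nb e F0 (w i b)|.
  by move=> iP; have := nbN i b Im iP; rewrite -/F0; move: cIm cQ dQ num1 p1; nlia.
(* The [r] unmatched pairs are linked inside [F0]: each terminal moves to a private neighbour
   [f (i, b)], and the two neighbours of a pair are adjacent or receive a private common neighbour
   [c i]. *)
pose PU := P :\: I0.
have cPU : #|PU| = r by rewrite /r /PU cardsD (setIidPr I0P).
have big q : q \in setX PU [set: bool] -> #|setX PU [set: bool]| <= #|nb e F0 (w q.1 q.2)|.
  by rewrite !inE /= andbT => /andP[_ iP]; rewrite cardsX cardsT card_bool cPU mulnC; apply: nbF.
have [f [fS fi]] := greedy_sdr x0 big.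
have {}fS i b : i \in PU -> f (i, b) \in nb e F0 (w i b) by move=> iP; apply: (fS (i, b)); rewrite !inE -in_setD iP.
have {}fi i b j c : i \in PU -> j \in PU -> f (i, b) = f (j, c) -> i = j /\ b = c.
  by move=> iP jP E; have := fi (i, b) (j, c); rewrite !inE -!in_setD iP jP => /(_ isT isT E)[].
pose FS := [set f q | q in setX PU [set: bool]].
pose S i := (nb e F0 (f (i, true)) :&: nb e F0 (f (i, false))) :\: FS.
pose PN := [set i in PU | ~~ e (f (i, true)) (f (i, false))].
have fF i b : i \in PU -> f (i, b) \in F0 by move/(fS i b); rewrite inE => /andP[].
have PUP i : i \in PU -> i \in P by rewrite inE => /andP[].
have cS i : i \in PN -> #|PN| <= #|S i|.
  rewrite inE => /andP[iU nad]; apply: (@leq_trans r).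
    by rewrite -cPU; apply: subset_leq_card; apply/subsetP => j; rewrite inE => /andP[].
  set y := f (i, true) in nad *; set y' := f (i, false) in nad *.
  have yF : y \in F0 by apply: fF. have yF' : y' \in F0 by apply: fF.
  have yy : y != y' by apply/eqP => /(fi _ _ _ _ iU iU)[].
  have c2 : #|F0 :\: [set y; y']| + 2 = #|F0|.
    rewrite -(cardsID [set y; y'] F0) addnC (setIidPr _) ?cards2 ?yy //.
    by apply/subsetP => v; rewrite !inE => /orP[]/eqP->; rewrite -?in_setD -/N -?in_setD.
  have := @cardsI_ge _ (nb e F0 y) (nb e F0 y') (F0 :\: [set y; y']).
  have sb1 : nb e F0 y \subset F0 :\: [set y; y'].
    apply/subsetP => v; rewrite inE => /andP[vF ev]; rewrite inE vF andbT !inE negb_or.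
    by apply/andP; split; apply: contraTneq ev => ->; rewrite ?ei.
  have sb2 : nb e F0 y' \subset F0 :\: [set y; y'].
    apply/subsetP => v; rewrite inE => /andP[vF ev]; rewrite inE vF andbT !inE negb_or.
    by apply/andP; split; apply: contraTneq ev => ->; rewrite ?ei // es.
  move=> /(_ sb1 sb2) h1.
  have cFS : #|FS :\: [set y; y']| + 2 = 2 * r.
    rewrite -cPU -[in RHS](card_terms (w := fun i b => f (i, b))); last by move=> *; apply: fi.
    have -> : terms PU (fun i b => f (i, b)) = FS.
      by apply/setP => v; apply/termsP/imsetP => [[j [b [jP ->]]]|[[j b]]]; [exists (j, b); rewrite // !inE -in_setD jP | rewrite !inE -in_setD andbT => jP ->; exists j, b].
    rewrite -[in RHS](cardsID [set y; y'] FS) addnC (setIidPr _) ?cards2 ?yy //.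
    by apply/subsetP => v; rewrite !inE => /orP[]/eqP->; apply: imset_f; rewrite !inE -in_setD iU.
  have h2 : #|nb e F0 y :&: nb e F0 y'| <= #|S i| + #|FS :\: [set y; y']|.
    apply: leq_trans (cardsU_le _ _); apply: subset_leq_card; apply/subsetP => v h.
    have [h3 _] := setIP h; have := subsetP sb1 v h3; rewrite in_setD => /andP[h5 _].
    by rewrite in_setU /S !in_setD h h5 andbT; case: (v \in FS).
  have := degF _ yF; have := degF _ yF'; have := F0T _ yF; have := F0T _ yF'.
  move: h1 h2 cFS c2 cQ cF0 num1 p1 cIm r1; clear; nlia.
have [c [cSi ci]] := greedy_sdr x0 cS.
have cF i : i \in PN -> c i \in F0 by move/cSi; rewrite /S !inE => /andP[_ /andP[/andP[]]].
have cFS i : i \in PN -> c i \notin FS by move/cSi; rewrite /S inE => /andP[].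
have FSf i b : i \in PU -> f (i, b) \in FS by move=> iU; apply: imset_f; rewrite !inE -in_setD iU.
pose M i := if i \in I0 then [set m i] else [set f (i, true); f (i, false)] :|: (if i \in PN then [set c i] else set0).
have MN i : i \in P -> M i \subset N.
  move=> iP; rewrite /M; case: ifPn => iI; first by rewrite sub1set (subsetP ImN) ?imset_f.
  have iU : i \in PU by rewrite inE iI.
  have F0N : F0 \subset N by apply: subsetDl.
  apply/subsetP => v; rewrite in_setU => /orP[|]; first by rewrite in_set2 => /orP[]/eqP->; apply: (subsetP F0N); apply: fF.
  by case: ifP => iN; rewrite inE // => /eqP->; apply: (subsetP F0N); apply: cF.
have Mdis i j v : i \in P -> j \in P -> v \in M i -> v \in M j -> i = j.
  move=> iP jP; rewrite /M.
  have F0I u : u \in F0 -> u \notin Im by rewrite inE => /andP[].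
  have nI k u : k \in P -> k \notin I0 -> u \in [set f (k, true); f (k, false)] :|: (if k \in PN then [set c k] else set0) -> u \in F0 /\ ((exists b, u = f (k, b)) \/ (k \in PN /\ u = c k)).
    move=> kP kI; have kU : k \in PU by rewrite inE kI.
    rewrite in_setU => /orP[|]; first by rewrite in_set2 => /orP[]/eqP->; (split; [exact: fF | left]); [exists true | exists false].
    by case: ifP => kN; rewrite inE // => /eqP->; split; [exact: cF | right].
  case: (boolP (i \in I0)) => iI; case: (boolP (j \in I0)) => jI.
  - by rewrite !inE => /eqP-> /eqP; apply: mi.
  - by rewrite inE => /eqP-> /(nI _ _ jP jI)[/F0I]; rewrite imset_f.
  - by move=> h; rewrite inE => /eqP Ev; move: h; rewrite Ev => /(nI _ _ iP iI)[/F0I]; rewrite imset_f.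
  have iU : i \in PU by rewrite inE iI. have jU : j \in PU by rewrite inE jI.
  move=> /(nI _ _ iP iI)[_ [[b Eb]|[iN Ei]]] /(nI _ _ jP jI)[_ [[b' Eb']|[jN Ej]]].
  - by move: Eb'; rewrite Eb => /(fi _ _ _ _ iU jU)[].
  - by have := cFS j jN; rewrite -Ej Eb FSf.
  - by have := cFS i iN; rewrite -Ei Eb' FSf.
  - by apply: ci; rewrite // -Ei.
exists (fun i => [set w i true; w i false] :|: M i).
split=> [i iP|i b iP|i iP|i j iP jP ij].
- rewrite subUset (subset_trans (MN i iP)) ?subsetDl // andbT.
  by apply/subsetP => v; rewrite !inE => /orP[]/eqP->; apply: wL.
- by case: b; rewrite !inE eqxx ?orbT.
- have wD b : w i b \in [set w i true; w i false] :|: M i by case: b; rewrite !inE eqxx ?orbT.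
  set Di := _ :|: _ in wD *.
  have MD v : v \in M i -> v \in Di by move=> h; rewrite inE h orbT.
  have step u v : u \in Di -> v \in Di -> e u v -> connect (ind e Di) u v.
    by move=> h1 h2 h3; apply: connect1; rewrite /= h1 h2 h3.
  case: (boolP (i \in I0)) => iI.
    have mD : m i \in Di by apply: MD; rewrite /M iI inE.
    have := mC i iI; rewrite CE => /and3P[_ e1 e2].
    by apply: (connect_trans (step _ _ (wD true) mD e1)); apply: step; rewrite // es.
  have iU : i \in PU by rewrite inE iI.
  have fD b : f (i, b) \in Di by apply: MD; rewrite /M (negbTE iI); case: b; rewrite !inE eqxx ?orbT.
  have ef b : e (w i b) (f (i, b)) by have := fS i b iU; rewrite inE => /andP[].
  apply: connect_trans (step _ _ (wD true) (fD true) (ef true)) _.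
  apply: (@connect_trans _ _ (f (i, false))); last by apply: step; rewrite // es.
  case: (boolP (e (f (i, true)) (f (i, false)))) => ad; first exact: step.
  have iN : i \in PN by rewrite inE iU.
  have cD : c i \in Di by apply: MD; rewrite /M (negbTE iI) iN !inE eqxx !orbT.
  have := cSi i iN; rewrite /S inE => /andP[_]; rewrite inE => /andP[]; rewrite !inE => /andP[_ e1] /andP[_ e2].
  by apply: (connect_trans (step _ _ (fD true) cD e1)); apply: step; rewrite // es.
- rewrite -setI_eq0; apply/eqP/setP => v; rewrite !inE; apply/negP => /andP[].
  have mT k l b : k \in P -> l \in P -> w l b \in M k -> False.
    by move=> kP lP h; have := subsetP (MN k kP) _ h; rewrite inE terms_in.
  case/orP=> [/orP[/eqP->|/eqP->]|vM]; (case/orP=> [/orP[/eqP E|/eqP E]|vM']);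
    try by [case: (dw _ _ _ _ iP jP E) => /eqP; rewrite (negbTE ij)].
  + exact: mT vM'.
  + exact: mT vM'.
  + by apply: (mT i j true) => //; rewrite -E.
  + by apply: (mT i j false) => //; rewrite -E.
  + by move/eqP: ij; apply; apply: Mdis vM vM'.
Qed.

End Link.

(** * Linkages in the neighbourhood of a vertex of small degree *)

Section Seq.
Variable T : eqType.
Implicit Types (l : seq T) (a : pred T) (e : rel T).

(** Applied to the neighbours of a free vertex on a shortest path: two of them with more than one
    vertex in between would give a shortcut. So there are at most three, and three are
    consecutive. *)
Lemma window a l :
  (forall l1 x l2 y l3, l = l1 ++ x :: l2 ++ y :: l3 -> a x -> a y -> size l2 <= 1) ->
  count a l <= 3 /\ (count a l = 3 -> exists l1 x y z l2, [/\ l = l1 ++ [:: x, y, z & l2], a x, a y & a z]).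
Proof.
elim: l => [|h l IH] hw; first by split.
have [ah|nh] := boolP (a h); last first.
  have [l1 x l2 y l3 E|c3 e3] := IH; first by apply: (hw (h :: l1) x l2 y l3); rewrite E.
  rewrite /= (negbTE nh); split=> // /e3[l1 [x [y [z [l2 [-> ax ay az]]]]]].
  by exists (h :: l1), x, y, z, l2.
rewrite /= ah; case: l hw {IH} => [|u [|z l]] hw /=; rewrite ?addn0; [by split | by case: (a u) |].
have c0 : count a l = 0.
  apply/eqP; rewrite -leqn0 leqNgt -has_count; apply/negP => /hasP[y yl ay].
  case/splitPr: yl hw => p1 p2 hw.
  by have := hw [::] h [:: u, z & p1] y p2 (erefl _) ah ay.
rewrite c0; split; first by case: (a u); case: (a z).
case: (boolP (a u)) => au; case: (boolP (a z)) => az // _.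
by exists [::], h, u, z, l.
Qed.

Lemma sorted_mid e l1 x l2 : sorted e (l1 ++ x :: l2) = sorted e (rcons l1 x) && path e x l2.
Proof. by case: l1 => [|u l1] //=; rewrite cat_path rcons_path /= andbA. Qed.

Lemma ohead_mid l1 x l2 l3 : ohead (l1 ++ x :: l2) = ohead (l1 ++ x :: l3).
Proof. by case: l1. Qed.

End Seq.

Section KLemma.
Variables (T I : finType) (e : rel T) (K : {set T}) (P : {set I}) (w : I -> bool -> T) (d c0 : nat).
Hypotheses (es : symmetric e) (ei : irreflexive e).
Hypothesis wK : forall i b, i \in P -> w i b \in K.
Hypothesis dw : distinct P w.
Hypothesis nadj : forall i, i \in P -> ~~ e (w i true) (w i false).
Hypothesis deg : forall x, x \in K -> d <= #|nb e K x|.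
Hypothesis cK : #|K| <= 2 * d + c0.
Hypothesis num : 6 * #|P| + c0 <= d + 5.

Definition linkseq i (c : seq T) := [/\ uniq c, ohead c = Some (w i true) & last (w i true) c = w i false].

(** An unlinked pair is represented by the list of its two terminals. They are nonadjacent, so
    [sorted e (W i)] tells whether pair [i] is linked, and [tot] counts the occupied vertices in
    either case. *)
Definition conf (W : I -> seq T) :=
  (forall i, i \in P -> [/\ W i = [:: w i true; w i false] \/ sorted e (W i), linkseq i (W i) & {subset W i <= K}])
  /\ (forall i j v, i \in P -> j \in P -> v \in W i -> v \in W j -> i = j).

Definition free (W : I -> seq T) := [set v in K | [forall i in P, v \notin W i]].
Definition tot (W : I -> seq T) := \sum_(i in P) size (W i).
Definition lnk (W : I -> seq T) := \sum_(i in P) (sorted e (W i) : nat).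
Definition upd (W : I -> seq T) i c := fun j => if j == i then c else W j.

Lemma freeP W v : reflect (v \in K /\ forall i, i \in P -> v \notin W i) (v \in free W).
Proof.
rewrite inE; apply: (iffP andP) => [[vK /forall_inP h]|[vK h]]; split=> //; exact/forall_inP.
Qed.

Lemma sum_upd (f : seq T -> nat) W i c : i \in P ->
  \sum_(j in P) f (upd W i c j) + f (W i) = \sum_(j in P) f (W j) + f c.
Proof.
move=> iP; rewrite (bigD1 i) //= [in RHS](bigD1 i) //= /upd eqxx.
rewrite (eq_bigr (fun j => f (W j))) => [|j /andP[_ /negbTE ->]] //; nlia.
Qed.

Lemma upd_conf W i c : conf W -> i \in P -> sorted e c -> linkseq i c ->
  (forall v, v \in c -> v \in W i \/ v \in free W) -> conf (upd W i c).
Proof.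
move=> [cW dW] iP sc lc sub; split=> [j jP|j k v jP kP].
  rewrite /upd; case: eqVneq => [->|_]; last exact: cW.
  split; [by right | by [] | move=> v /sub[|/freeP[]//]].
  by have [_ _ sK] := cW i iP; apply: sK.
have cr j' : j' \in P -> v \in c -> v \in W j' -> j' = i.
  by move=> jP' /sub[h /dW/(_ h)->|/freeP[_ /(_ j' jP')/negbTE->]].
rewrite /upd; case: eqVneq => [->|ji]; case: eqVneq => [->|ki] //.
- by move=> h1 h2; rewrite (cr k).
- by move=> h1 h2; rewrite (cr j).
- exact: dW.
Qed.

Lemma tot_free W : conf W -> #|free W| + tot W = #|K|.
Proof.
move=> [cW dW]; rewrite -(cardsID (free W) K) (setIidPr _); last by apply/subsetP => v /freeP[].
congr (_ + _); have -> : K :\: free W = \bigcup_(i in P) [set v in W i].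
  apply/setP => v; apply/setDP/bigcupP => [[vK]|[i iP]].
    by rewrite inE vK => /forall_inPn[i iP]; rewrite negbK => vW; exists i; rewrite ?inE.
  rewrite inE => vW; have [_ _ sK] := cW i iP; split; first exact: sK.
  by apply/negP => /freeP[_ /(_ i iP)]; rewrite vW.
rewrite card_bigcup_disj => [|i j v iP jP]; last by rewrite !inE; apply: dW.
by apply: eq_bigr => i iP; have [_ [u _ _] _] := cW i iP; rewrite cardsE; apply/esym/card_uniqP.
Qed.

Lemma count_nb (W : I -> seq T) i v : #|nb e [set u in W i] v| <= count (e v) (W i).
Proof.
rewrite -size_filter; apply: leq_trans (card_size _); apply: subset_leq_card.
by apply/subsetP => u; rewrite !inE mem_filter andbC.
Qed.

Lemma deg_free (W : I -> seq T) v : v \in K ->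
  d <= #|nb e (free W) v| + \sum_(i in P) count (e v) (W i).
Proof.
move=> vK; apply: leq_trans (deg vK) _.
apply: leq_trans (_ : #|nb e (free W) v :|: \bigcup_(i in P) nb e [set u in W i] v| <= _).
  apply: subset_leq_card; apply/subsetP => u; rewrite [u \in nb e K v]inE => /andP[uK evu].
  rewrite in_setU; case: (boolP (u \in free W)) => uF; first by rewrite inE uF evu.
  apply/orP; right; apply/bigcupP; move: uF; rewrite inE uK => /forall_inPn[i iP]; rewrite negbK => uW.
  by exists i; rewrite // !inE uW.
apply: leq_trans (cardsU_le _ _) _; rewrite leq_add2l; apply: leq_trans (card_bigcup_le _ _) _.
by apply: leq_sum => i _; apply: count_nb.
Qed.

Lemma unlinked W i : conf W -> i \in P -> ~~ sorted e (W i) -> W i = [:: w i true; w i false].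
Proof. by move=> [cW _] iP ns; have [[->|h] _ _] := cW i iP; rewrite // h in ns. Qed.

Lemma linked_size W i : conf W -> i \in P -> sorted e (W i) -> 3 <= size (W i).
Proof.
move=> [cW _] iP so; have [_ [_ oh ls] _] := cW i iP; move: oh ls so.
case: (W i) => [|x [|y [|z c]]] //= [->]; first by move=> /(dw iP iP)[].
by move=> ->; rewrite (negbTE (nadj iP)).
Qed.

Lemma size_ge2 W i : conf W -> i \in P -> 2 <= size (W i).
Proof.
move=> cW iP; have [so|so] := boolP (sorted e (W i)); first by have := linked_size cW iP so; nlia.
by rewrite (unlinked cW iP so).
Qed.

Lemma link_conf W j x p : conf W -> j \in P -> ~~ sorted e (W j) ->
  x \in free W -> e (w j true) x -> path (ind e (free W)) x p -> e (last x p) (w j false) ->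
  exists W1 : I -> seq T, [/\ conf W1, lnk W1 = (lnk W).+1 & tot W1 <= tot W + (size p).+1].
Proof.
move=> cW jP ns xF ex pp ey.
have [p' [[pp' up' lp' sp'] szp]] : exists p', [/\ path e x p', uniq (x :: p'), last x p' = last x p & {subset x :: p' <= free W}] /\ size p' <= size p.
  have sF := path_ind_in pp xF.
  case: (shortenP pp) => p' pp' up' sub; exists p'; split; last by apply: uniq_leq_size (proj2 (andP up')) sub.
  split=> //; first exact: path_ind_sub pp'.
  by move=> u; rewrite inE => /predU1P[->//|/sub up]; apply: sF; rewrite inE up orbT.
have [cW1 dW1] := cW; have Wj := unlinked cW jP ns.
have nF b : w j b \notin free W.
  by apply/negP => /freeP[_ /(_ j jP)]; rewrite Wj; case: b; rewrite !inE eqxx ?orbT.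
have nP b : w j b \notin x :: p' by apply/negP => /sp'; rewrite (negbTE (nF b)).
pose c := w j true :: rcons (x :: p') (w j false).
have sc : sorted e c by rewrite /c /= ex rcons_path pp' lp' ey.
have lc : linkseq j c.
  split=> //; last by rewrite /c /= last_rcons.
  rewrite /c cons_uniq mem_rcons inE negb_or nP rcons_uniq nP up' !andbT.
  by apply/eqP => /(dw jP jP)[].
exists (upd W j c); split.
- apply: upd_conf => // v; rewrite /c inE mem_rcons inE Wj => /or3P[/eqP->|/eqP->|vp]; [left|left|by right; apply: sp'];
    by rewrite !inE eqxx ?orbT.
- have := sum_upd (fun c => sorted e c : nat) W c jP; rewrite sc (negbTE ns) /lnk; nlia.
- have := sum_upd size W c jP; rewrite Wj /tot /c /= size_rcons /=; nlia.
Qed.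

Lemma linked_all W : conf W -> (forall i, i \in P -> sorted e (W i)) -> linkage e K P w (fun i => [set v in W i]).
Proof.
move=> [cW dW] so; split=> [i iP|i b iP|i iP|i j iP jP ij].
- by have [_ _ sK] := cW i iP; apply/subsetP => v; rewrite inE => /sK.
- have [_ [_ oh ls] _] := cW i iP; move: oh ls; rewrite inE; case: (W i) => //= x c [->] ls.
  by case: b; rewrite ?mem_head // -ls mem_last.
- have [_ [_ oh ls] _] := cW i iP; move: oh ls (so i iP); case: (W i) => //= x c [->] ls pc.
  by rewrite -ls; apply: path_connect_in pc _ => v h; rewrite inE.
- rewrite -setI_eq0; apply/eqP/setP => v; rewrite !inE; apply/negP => /andP[v1 v2].
  by move/eqP: ij; apply; apply: dW v1 v2.
Qed.

Lemma seg_conf W i l1 x l2 y l3 v : conf W -> i \in P -> W i = l1 ++ x :: l2 ++ y :: l3 ->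
  sorted e (W i) -> v \in free W -> e v x -> e v y ->
  let c := l1 ++ x :: v :: y :: l3 in conf (upd W i c) /\ sorted e c.
Proof.
move=> cW iP E so vF vx vy c; have [cW1 _] := cW; have [_ [u oh ls] _] := cW1 i iP.
have [_ vW] := freeP W v vF; move: {vW}(vW i iP) => vW.
have sub z : z \in l1 ++ x :: y :: l3 -> z \in W i.
  rewrite E !mem_cat !inE mem_cat inE.
  by case: (z \in l1); case: (z == x); case: (z == y); case: (z \in l3); rewrite ?orbT.
have cE : c = (l1 ++ [:: x]) ++ v :: y :: l3 by rewrite -catA.
have sc : sorted e c.
  move: so; rewrite E /c !sorted_mid /= cat_path /= => /andP[-> /and3P[_ _ ->]].
  by rewrite es vx vy.
split=> //; apply: upd_conf => //; first split.
- rewrite cE -(cat1s v) uniq_catCA /= -catA /=; apply/andP; split; first by apply: contra vW => /sub.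
  apply: subseq_uniq u; rewrite E; apply: cat_subseq => //=; rewrite eqxx.
  exact: suffix_subseq.
- by rewrite /c (ohead_mid _ _ _ (l2 ++ y :: l3)) -E.
- by rewrite -ls E /c !last_cat /= last_cat.
move=> z; rewrite cE mem_cat [z \in v :: _]in_cons; have [->|zv] /= := eqVneq z v; first by right.
by move=> h; left; apply: sub; move: h; rewrite !mem_cat !inE -orbA.
Qed.

(* Link as many pairs as possible by short paths, then make the paths as short as possible, then make the part
   [F1] of the free vertices reachable from an unlinked terminal as large as possible.  A free vertex has at most
   three neighbours on a path, and the other free part [F2] cannot be adjacent to the same middle vertices as
   [F1], so one of the two parts keeps a large share of its degrees. *)
Theorem K_lemma : (exists D, linkage e K P w D) \/
  exists L : {set T}, [/\ L \subset K, L != set0 &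
    forall x, x \in L -> 2 * #|L| + 2 * d + 5 <= 4 * #|nb e L x| + c0 + 7 * #|P| /\ d <= #|nb e L x| + 3 * #|P|].
Proof.
set p := #|P|; have nump : 6 * p + c0 <= d + 5 := num; have cKd : #|K| <= 2 * d + c0 := cK.
(* The budget: all terminals, four further vertices for each linked pair, and the slack [c0]. It
   keeps the set of free vertices large. *)
pose ok W := conf W /\ tot W <= 4 * lnk W + 2 * p + c0.
have lnkp W : lnk W <= p.
  by rewrite /p -sum1_card; apply: leq_sum => i _; case: sorted.
have [W0 [okW0 maxW]] : exists W, ok W /\ forall W', ok W' -> lnk W' <= lnk W.
  apply: (@ex_max _ ok lnk p) => //; exists (fun i => [:: w i true; w i false]); split.
    split=> [i iP|i j v iP jP]; last by rewrite !inE => /orP[]/eqP-> /orP[]/eqP /(dw iP jP)[].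
    split; [by left | split=> //= |].
      by rewrite inE andbT; apply/eqP => /(dw iP iP)[].
    by move=> v; rewrite !inE => /orP[]/eqP->; apply: wK.
  by rewrite /tot /= sum_nat_const -/p; nlia.
have [al|/not_all_ex_not[i1 /(imply_to_and (i1 \in P))[i1P /negP so1]]] := classic (forall i, i \in P -> sorted e (W0 i)).
  by left; exists (fun i => [set v in W0 i]); apply: linked_all => //; case: okW0.
right; pose F1 W' := [set v in free W' | [exists z, [&& z \in free W', e (w i1 true) z & connect (ind e (free W')) z v]]].
pose B W W' := [/\ ok W', lnk W' = lnk W & ~~ sorted e (W' i1)].
have [W [[cW tW nso] minW maxF maxq]] : exists W, [/\ [/\ conf W, tot W <= 4 * lnk W + 2 * p + c0 & ~~ sorted e (W i1)],
   (forall W', B W W' -> tot W <= tot W'), (forall W', B W W' /\ tot W' = tot W -> #|F1 W'| <= #|F1 W|) &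
   (forall W', conf W' -> tot W' <= 4 * (lnk W).+1 + 2 * p + c0 -> lnk W' = (lnk W).+1 -> False)].
  have [W1 [A1 minW1]] : exists W', B W0 W' /\ forall W'', B W0 W'' -> tot W' <= tot W''.
    by apply: (@ex_min _ (B W0) tot); exists W0.
  have [W2 [[A2 t2] maxF]] : exists W', (B W0 W' /\ tot W' = tot W1) /\
      forall W'', B W0 W'' /\ tot W'' = tot W1 -> #|F1 W''| <= #|F1 W'|.
    by apply: (@ex_max _ (fun W' => B W0 W' /\ tot W' = tot W1) (fun W' => #|F1 W'|) #|T|); [exists W1 | move=> *; apply: max_card].
  have [[cW2 tW2] l2 ns2] := A2; exists W2; rewrite /B l2 t2; split=> //; first by split=> //; rewrite t2 l2 in tW2 *.
  move=> W' c1 c2 c3; have /maxW : ok W' by split; rewrite ?c3.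
  by rewrite c3 ltnn.
pose A := B W; have AW : A W by split.
set q := lnk W in AW minW maxF maxq tW *; set F := free W.
have qp : q < p.
  rewrite /q /lnk /p -sum1_card (bigD1 i1) //= (negbTE nso) [X in _ < X](bigD1 i1) //= add0n add1n ltnS.
  by apply: leq_sum => i _; case: sorted.
have nolink j x pp : j \in P -> ~~ sorted e (W j) -> x \in F -> e (w j true) x -> path (ind e F) x pp ->
   e (last x pp) (w j false) -> tot W + (size pp).+1 <= 4 * q.+1 + 2 * p + c0 -> False.
  move=> jP ns xF ex ppp el sz; have [W' [c1 c2 c3]] := link_conf cW jP ns xF ex ppp el.
  by apply: (maxq W' c1) => //; apply: leq_trans sz.
have cF : #|F| + tot W = #|K| := tot_free cW.
(* By minimality of [tot], a detour through one free vertex cannot shorten a path. If it replaces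
   exactly one vertex, the result is another optimal configuration, which [swap] exploits. *)
have seg i l1 x l2 y l3 v : i \in P -> W i = l1 ++ x :: l2 ++ y :: l3 -> sorted e (W i) ->
   v \in F -> e v x -> e v y -> size l2 <= 1 /\ (size l2 = 1 -> A (upd W i (l1 ++ x :: v :: y :: l3)) /\ tot (upd W i (l1 ++ x :: v :: y :: l3)) = tot W).
  move=> iP E so vF vx vy; have [c1 c2] := seg_conf cW iP E so vF vx vy.
  set c := l1 ++ _ in c1 c2 *; have := sum_upd (fun c => sorted e c : nat) W c iP.
  rewrite c2 so -/(lnk W) -/(lnk (upd W i c)) => /addIn l2E.
  have := sum_upd size W c iP; rewrite -/(tot W) -/(tot (upd W i c)) E /c !size_cat /= !size_cat /= => szE; rewrite -/c in szE.
  have ns : ~~ sorted e (upd W i c i1).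
    by rewrite /upd; case: eqVneq => // ii; rewrite ii so in nso.
  case: (leqP (size l2) 0) => sz0.
    by split=> [|sz1]; nlia.
  have AU : A (upd W i c) by split=> //; split=> //; rewrite l2E -/q; nlia.
  have := minW _ AU => le; split; first by nlia.
  by move=> sz1; split=> //; rewrite -/c; nlia.
have cnt3 i v : i \in P -> sorted e (W i) -> v \in F ->
   count (e v) (W i) <= 3 /\ (count (e v) (W i) = 3 -> exists l1 x y z l2, [/\ W i = l1 ++ [:: x, y, z & l2], e v x, e v y & e v z]).
  by move=> iP so vF; apply: window => l1 x l2 y l3 E vx vy; case: (seg _ _ _ _ _ _ _ iP E so vF vx vy).
have cnt1 i v : i \in P -> ~~ sorted e (W i) -> v \in F -> count (e v) (W i) <= 1.
  move=> iP ns vF; rewrite (unlinked cW iP ns) /= addn0.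
  case: (boolP (e v (w i true))) => // h1; case: (boolP (e v (w i false))) => // h2.
  by exfalso; apply: (nolink i v [::]) => //=; [rewrite es | nlia].
have cntS v : v \in F -> \sum_(i in P) count (e v) (W i) <= p + 2 * q.
  move=> vF; rewrite /p -sum1_card /q /lnk big_distrr -big_split /=; apply: leq_sum => i iP.
  by have [so|so] := boolP (sorted e (W i)); [case: (cnt3 i v iP so vF) | exact: cnt1].
have FK v : v \in F -> v \in K by case/freeP.
have degF v : v \in F -> d <= #|nb e F v| + \sum_(i in P) count (e v) (W i).
  by move=> vF; apply: deg_free; apply: FK.
have totge : 2 * p + q <= tot W.
  rewrite /p -sum1_card big_distrr /q /lnk -big_split /=; apply: leq_sum => i iP.
  by have [so|so] := boolP (sorted e (W i)); [exact: linked_size | exact: size_ge2].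
have W1E := unlinked cW i1P nso.
have hasnb b : exists z, z \in F /\ e (w i1 b) z.
  have h := deg_free W (wK b i1P); have h2 : \sum_(i in P) count (e (w i1 b)) (W i) + 2 <= tot W.
    rewrite /tot (bigD1 i1) //= [X in _ <= X](bigD1 i1) //= W1E /= addn0.
    have -> : e (w i1 b) (w i1 true) = false by case: b {h}; rewrite ?ei // es; apply/negbTE/nadj.
    have -> : e (w i1 b) (w i1 false) = false by case: b {h}; rewrite ?ei //; apply/negbTE/nadj.
    by rewrite addnC leq_add2l; apply: leq_sum => i _; apply: count_size.
  have : 0 < #|nb e (free W) (w i1 b)| by nlia.
  by case/card_gt0P => z; rewrite inE => /andP[zF ez]; exists z.
have F1F v : v \in F1 W -> v \in F by rewrite inE => /andP[].
have F1cl u v : u \in F1 W -> v \in F -> e u v -> v \in F1 W.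
  rewrite [u \in F1 W]inE => /andP[uF /existsP[z /and3P[zF ez c]]] vF euv.
  rewrite [v \in F1 W]inE vF; apply/existsP; exists z; rewrite zF ez /=; apply: connect_trans c (connect1 _).
  by rewrite /= uF vF euv.
have F1s v : v \in F -> e (w i1 true) v -> v \in F1 W.
  by move=> vF ev; rewrite [v \in F1 W]inE vF; apply/existsP; exists v; rewrite vF ev connect0.
(* Otherwise a shortest walk through [F] between the terminals of [i1] would link one more pair
   within the budget. *)
have nowalk v : v \in F1 W -> ~~ e v (w i1 false).
  rewrite [v \in F1 W]inE => /andP[vF /existsP[z /and3P[zF ez /connectP[pp ppp vE]]]]; apply/negP => evt.
  pose Wk c := if c is x :: p' then [/\ x \in F, e (w i1 true) x, path (ind e F) x p' & e (last x p') (w i1 false)] else False.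
  have [[|x pp'] [//= [xF ex pp'p elx] minp]] : exists c, Wk c /\ forall c', Wk c' -> size c <= size c'.
    by apply: (@ex_min _ Wk size); exists (z :: pp); split=> //; rewrite -vE.
  have minseg a b r p' : pp' = a ++ b ++ r -> path (ind e F) (last x a) p' -> last (last x a) p' = last x (a ++ b) -> size b <= size p'.
    move=> E pp1 lE; have /minp : Wk (x :: a ++ p' ++ r).
      split=> //; move: pp'p elx; rewrite E !cat_path !last_cat => /and3P[h0 h1 h2] h3.
        by rewrite h0 pp1 /= lE last_cat.
      by move: h3; rewrite lE last_cat.
    by rewrite /= E !size_cat; nlia.
  pose NF u := u |: nb e F u.
  have cNF u : u \in F -> d + 1 <= #|NF u| + (p + 2 * q).
    move=> uF; rewrite /NF cardsU1 inE ei andbF /=; have := degF u uF; have := cntS u uF; nlia.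
  have NFF u : u \in F -> NF u \subset F by move=> uF; rewrite subUset sub1set uF; apply/subsetP => y; rewrite inE => /andP[].
  have ppF : {subset x :: pp' <= F} := path_ind_in pp'p xF.
  (* Vertices at least three steps apart on a shortest walk have disjoint closed neighbourhoods,
     each of which fills a large part of [F]. *)
  have dis a b r : pp' = a ++ b ++ r -> 3 <= size b -> [disjoint NF (last x a) & NF (last x (a ++ b))].
    move=> E sb; have lF : last x a \in F.
      by apply: ppF; rewrite E -cat_cons mem_cat mem_last.
    have lF' : last x (a ++ b) \in F.
      by apply: ppF; rewrite E catA -cat_cons mem_cat mem_last.
    apply/pred0P => y /=; apply/negP => /andP[]; rewrite /NF !in_setU1 !in_nb => h1 h2.
    have [p' [p1 p2 p3]] : exists p', [/\ path (ind e F) (last x a) p', last (last x a) p' = last x (a ++ b) & size p' <= 2].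
      case/predU1P: h1 => [E1|/andP[yF e1]]; case/predU1P: h2 => [E2|/andP[yF' e2]].
      - by exists [::]; rewrite /= -E1 -E2.
      - by exists [:: last x (a ++ b)]; rewrite /= lF lF' -E1 es e2.
      - by exists [:: last x (a ++ b)]; rewrite /= lF lF' -E2 e1.
      - by exists [:: y; last x (a ++ b)]; rewrite /= lF lF' yF e1 es e2.
    by have := minseg a b r p' E p1 p2; nlia.
  apply: (nolink i1 x pp') => //.
  (* Three disjoint neighbourhoods do not fit into [F]. This suffices unless the budget is nearly
     exhausted; but then [F] is so small that even two do not fit, and the walk is shorter still. *)
  have s6 : size pp' <= 5.
    rewrite leqNgt; apply/negP; case E : pp' ppF dis => [|z1 [|z2 [|z3 [|z4 [|z5 [|z6 r]]]]]] // ppF dis _.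
    have := dis [::] [:: z1; z2; z3] [:: z4, z5, z6 & r] erefl isT => /= d1.
    have := dis [:: z1; z2; z3] [:: z4; z5; z6] r erefl isT => /= d2.
    have := dis [::] [:: z1; z2; z3; z4; z5; z6] r erefl isT => /= d3.
    have x3 : z3 \in F by apply: ppF; rewrite !inE eqxx !orbT.
    have x6 : z6 \in F by apply: ppF; rewrite !inE eqxx !orbT.
    have := card3_le (NFF x xF) (NFF z3 x3) (NFF z6 x6) d1 d2 d3.
    have := cNF x xF; have := cNF z3 x3; have := cNF z6 x6; move: cKd cF totge nump qp; nlia.
  case: (leqP (4 * q + 2 * p + c0) (tot W).+1) => tt; last by nlia.
  suff : size pp' <= 2 by nlia.
  rewrite leqNgt; apply/negP; case E : pp' ppF dis => [|z1 [|z2 [|z3 r]]] // ppF dis _.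
  have := dis [::] [:: z1; z2; z3] r erefl isT => /= d1.
  have x3 : z3 \in F by apply: ppF; rewrite !inE eqxx !orbT.
  have := card3_le (NFF x xF) (NFF z3 x3) (sub0set F) d1; rewrite cards0.
  rewrite -!setI_eq0 !setI0 eqxx => /(_ isT isT).
  have := cNF x xF; have := cNF z3 x3; move: cKd cF tt qp; nlia.
pose F2 := F :\: F1 W.
have F1n : exists v, v \in F1 W by have [z [zF ez]] := hasnb true; exists z; apply: F1s.
have F2n : exists v, v \in F2.
  have [z [zF ez]] := hasnb false; exists z; rewrite inE zF andbT.
  by apply/negP => /nowalk; rewrite es ez.
(* Exchanging [y] for [u] keeps the configuration optimal, takes nothing from [F1] because [u] is
   not in it, and frees [y]. An edge from [F1] to [y] would thus enlarge [F1]. *)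
have swap i l1 x y z l2 u v : i \in P -> W i = l1 ++ [:: x, y, z & l2] -> sorted e (W i) -> u \in F2 ->
   e u x -> e u z -> v \in F1 W -> ~~ e v y.
  move=> iP E so; rewrite inE => /andP[uF1 uF] ux uz vF1; apply/negP => evy.
  have [_ /(_ erefl)[AU tU]] := seg i l1 x [:: y] z l2 u iP E so uF ux uz.
  set c := l1 ++ _ in AU tU; have := maxF _ (conj AU tU); rewrite leqNgt => /negP; apply.
  have [cW1 dW1] := cW; have [_ [ui _ _] sK] := cW1 i iP.
  have yi : y \in W i by rewrite E !(mem_cat, inE) eqxx !orbT.
  have cS k : k \in c -> k != u -> k \in W i /\ k != y.
    move=> kc ku; move: ui kc; rewrite E /c !mem_cat !inE (negbTE ku) orFb => uu kc; split.
      by case/or4P: kc => [->|->|->|->]; rewrite ?orbT.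
    apply: contraTneq kc => ->; move: uu.
    rewrite cat_uniq /= !inE !negb_or => /and5P[_ /and4P[_ yl1 _ _] /and3P[xy _ _] /andP[yz yl] _].
    by rewrite (negbTE yl1) (negbTE yl) (negbTE yz) eq_sym (negbTE xy).
  have F1' k : k \in F1 W -> k \in free (upd W i c).
    move=> kF1; have [kK kW] := freeP W k (F1F k kF1); apply/freeP; split=> // j jP; rewrite /upd.
    case: eqVneq => [_|_]; last exact: kW.
    apply/negP => /cS[|]; last by rewrite (negbTE (kW i iP)).
    by apply: contraNneq uF1 => <-.
  have yF' : y \in free (upd W i c).
    apply/freeP; split; first exact: sK.
    move=> j jP; rewrite /upd; case: eqVneq => [_|ji]; last by apply/negP => /(dW1 _ _ _ jP iP)/(_ yi) /eqP; rewrite (negbTE ji).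
    apply/negP => /cS[|_]; last by rewrite eqxx.
    by apply/eqP => Ey; have [_ /(_ i iP)] := freeP W u uF; rewrite -Ey yi.
  have sub k : k \in F1 W -> k \in F1 (upd W i c).
    move=> kF1; have := kF1; rewrite [k \in F1 W]inE => /andP[_ /existsP[z' /and3P[zF ez cz]]].
    rewrite [k \in F1 _]inE F1' //; apply/existsP; exists z'; rewrite ez F1' ?F1s //=.
    suff [] : k \in F1 W /\ connect (ind e (free (upd W i c))) z' k by [].
    apply: (connect_inv (P := fun k => k \in F1 W /\ connect (ind e (free (upd W i c))) z' k) _ cz).
      move=> a b [aF1 ca] /and3P[eab _ bF]; have bF1 := F1cl a b aF1 bF eab; split=> //.
      by apply: connect_trans ca (connect1 _); rewrite /= eab !F1'.
    by split; [apply: F1s | apply: connect0].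
  apply: proper_card; apply/properP; split; first by apply/subsetP.
  exists y; last by apply/negP => /F1F /freeP[_ /(_ i iP)]; rewrite yi.
  have := sub v vF1; rewrite [v \in _]inE => /andP[vf /existsP[z' /and3P[zF ez cz]]].
  rewrite [y \in F1 _]inE yF'; apply/existsP; exists z'; rewrite zF ez /=.
  by apply: connect_trans cz (connect1 _); rewrite /= vf yF' evy.
have F2F u : u \in F2 -> u \in F by rewrite inE => /andP[].
(* The extreme case is three neighbours for both. The triples are consecutive and the middle of the
   triple of [u] is not in the triple of [v], which forces at least five vertices on the path. *)
have pairS i v u : i \in P -> sorted e (W i) -> v \in F1 W -> u \in F2 ->
    2 * (count (e v) (W i) + count (e u) (W i)) <= size (W i) + 7.
  move=> iP so vF1 uF2; have [cv wv] := cnt3 i v iP so (F1F v vF1); have [cu wu] := cnt3 i u iP so (F2F u uF2).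
  have sz3 := linked_size cW iP so.
  case: (ltnP 5 (count (e v) (W i) + count (e u) (W i))) => [s6|]; last by nlia.
  have {wu}[l1 [x [y [z [l2 [E ux uy uz]]]]]] : exists l1 x y z l2, [/\ W i = l1 ++ [:: x, y, z & l2], e u x, e u y & e u z] by apply: wu; nlia.
  have {wv}[m1 [x' [y' [z' [m2 [E' vx vy vz]]]]]] : exists l1 x y z l2, [/\ W i = l1 ++ [:: x, y, z & l2], e v x, e v y & e v z] by apply: wv; nlia.
  have nvy := swap i l1 x y z l2 u v iP E so uF2 ux uz vF1.
  have ny : nth v (W i) (size l1).+1 = y by rewrite E nth_cat ltnNge leqnSn /= subSn // subnn.
  have hv j : size m1 <= j <= (size m1).+2 -> e v (nth v (W i) j).
    move=> /andP[j1 j2]; rewrite E' nth_cat ltnNge j1 /=; have : j - size m1 <= 2 by nlia.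
    by case: (j - size m1) => [|[|[|]]].
  have : ~~ (size m1 <= (size l1).+1 <= (size m1).+2) by apply: contra nvy => /hv; rewrite ny.
  have : size (W i) = size l1 + (size l2).+3 by rewrite E size_cat.
  have : size (W i) = size m1 + (size m2).+3 by rewrite E' size_cat.
  by nlia.
have pairN i v u : i \in P -> ~~ sorted e (W i) -> v \in F1 W -> u \in F2 ->
    2 * (count (e v) (W i) + count (e u) (W i)) <= size (W i) + 2.
  move=> iP ns vF1 uF2; have := cnt1 i v iP ns (F1F v vF1); have := cnt1 i u iP ns (F2F u uF2).
  by have := size_ge2 cW iP; nlia.
have pair v u : v \in F1 W -> u \in F2 ->
   2 * (\sum_(i in P) count (e v) (W i) + \sum_(i in P) count (e u) (W i)) <= tot W + 2 * p + 5 * q.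
  move=> vF1 uF2; rewrite -big_split /= big_distrr /tot /p -sum1_card /q /lnk !big_distrr -!big_split /=.
  apply: leq_sum => i iP; have [so|so] := boolP (sorted e (W i)).
    by have := pairS i v u iP so vF1 uF2; nlia.
  by have := pairN i v u iP so vF1 uF2; nlia.
have nb1 v : v \in F1 W -> nb e F v \subset nb e (F1 W) v.
  move=> vF1; apply/subsetP => u; rewrite [u \in nb e F v]inE => /andP[uF evu].
  by rewrite [u \in nb _ _ _]inE (F1cl v u vF1 uF evu).
have nb2 u : u \in F2 -> nb e F u \subset nb e F2 u.
  rewrite [u \in F2]in_setD => /andP[uF1 uF]; apply/subsetP => v; rewrite [v \in nb e F u]inE => /andP[vF euv].
  rewrite [v \in nb _ _ _]inE in_setD vF euv !andbT; apply: contra uF1 => vF1; apply: F1cl vF1 uF _.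
  by rewrite es.
have cF12 : #|F1 W| + #|F2| = #|F|.
  by rewrite -(cardsID (F1 W) F) (setIidPr _) //; apply/subsetP.
have dg1 v : v \in F1 W -> d <= #|nb e (F1 W) v| + \sum_(i in P) count (e v) (W i).
  by move=> vF1; apply: leq_trans (degF v (F1F v vF1)) _; rewrite leq_add2r subset_leq_card ?nb1.
have dg2 v : v \in F2 -> d <= #|nb e F2 v| + \sum_(i in P) count (e v) (W i).
  by move=> vF2; apply: leq_trans (degF v (F2F v vF2)) _; rewrite leq_add2r subset_leq_card ?nb2.
pose good (L : {set T}) v := 2 * #|L| + 2 * d + 5 <= 4 * #|nb e L v| + c0 + 7 * p.
have sub1 : F1 W \subset K by apply/subsetP => v /F1F/FK.
have sub2 : F2 \subset K by apply/subsetP => v /F2F/FK.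
have [g1|/not_all_ex_not[v /(imply_to_and (v \in F1 W))[vF1 bv]]] := classic (forall v, v \in F1 W -> good (F1 W) v).
  exists (F1 W); split=> //; first by apply/set0Pn.
  by move=> v vF1; split; [apply: g1 | have := dg1 v vF1; have := cntS v (F1F v vF1); nlia].
have [g2|/not_all_ex_not[u /(imply_to_and (u \in F2))[uF2 bu]]] := classic (forall v, v \in F2 -> good F2 v).
  exists F2; split=> //; first by apply/set0Pn.
  by move=> u uF2; split; [apply: g2 | have := dg2 u uF2; have := cntS u (F2F u uF2); nlia].
(* If a vertex of each part fails, the sum of the two degree estimates contradicts the bound on
   [#|K|]. *)
exfalso; move/negP: bv; move/negP: bu; rewrite /good.
have := dg1 v vF1; have := dg2 u uF2; have := pair v u vF1 uF2.
move: cF12 cF cKd qp; nlia.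
Qed.
End KLemma.

(** * Linked sets, separations and contractions *)

Section Linked.
Variables (T I : finType).
Implicit Types (e : rel T) (A B F S V X Z U : {set T}) (P : {set I}) (w : I -> bool -> T).

Definition off e X : rel T := fun x y => e x y && ~~ ((x \in X) && (y \in X)).

(** Because of [off], linkedness depends only on the edges not inside [X]. Since a set meets [X] in
    its own terminals only, linkages on the two sides of a separation can be glued along the
    separator. *)
Definition linked V e X := forall P w, (forall i b, i \in P -> w i b \in X) -> distinct P w ->
  exists D, linkage (off e X) V P w D /\
    forall i v, i \in P -> v \in D i -> v \in X -> exists b, v = w i b.

Definition sepn V e A B := A :|: B = V /\
  forall x y, x \in A -> x \notin B -> y \in B -> y \notin A -> ~~ e x y.

Definition addclq e Z : rel T := fun x y => e x y || [&& x \in Z, y \in Z & x != y].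

(* Ordered pairs, so that every edge is counted twice. *)
Definition R V e S := #|[set p : T * T | [&& p.1 \in V, p.2 \in V, e p.1 p.2 & (p.1 \in S) || (p.2 \in S)]]|.

(** The condition of Thomas and Wollan, with factors 2 because [R] counts ordered pairs. The second
    clause prevents the density from sitting behind a separator too small to be reached by disjoint
    paths from all of [X]. *)
Definition massed (lam : nat) V e X :=
  2 * lam * #|V :\: X| < R V e (V :\: X) /\
  forall A B, sepn V e A B -> X \subset A -> #|A :&: B| < #|X| -> R V e (B :\: A) <= 2 * lam * #|B :\: A|.

Lemma off_sym e X : symmetric e -> symmetric (off e X).
Proof. by move=> es x y; rewrite /off es [(x \in X) && _]andbC. Qed.

Lemma addclq_sym e Z : symmetric e -> symmetric (addclq e Z).
Proof. by move=> es x y; rewrite /addclq es eq_sym andbCA. Qed.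

Lemma addclq_irr e Z : irreflexive e -> irreflexive (addclq e Z).
Proof. by move=> ei x; rewrite /addclq ei eqxx !andbF. Qed.

Lemma R_sub V V' e e' S S' :
  (forall x y, x \in V -> y \in V -> e x y -> (x \in S) || (y \in S) ->
     [/\ x \in V', y \in V', e' x y & (x \in S') || (y \in S')]) -> R V e S <= R V' e' S'.
Proof.
move=> h; apply: subset_leq_card; apply/subsetP => -[x y]; rewrite !inE /= => /and4P[xV yV exy xyS].
by have [-> -> -> ->] := h x y xV yV exy xyS.
Qed.

Lemma linkedW V V' e X : V \subset V' -> linked V e X -> linked V' e X.
Proof.
move=> VV l P w wX dw; have [D [[D1 D2 D3 D4] D5]] := l P w wX dw; exists D; split=> //.
by split=> // i iP; apply: subset_trans (D1 i iP) VV.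
Qed.

(** If the terminals of a pair fall apart once the clique edges are removed, each of them still
    reaches [A :&: B] inside its old set. One new pair joining these two vertices through [B]
    replaces all clique edges of that set at once, so every index causes at most one new pair. *)
Lemma link_lift V e X A B : symmetric e -> sepn V e A B -> X \subset A ->
  linked A (addclq e (A :&: B)) X -> linked B e (A :&: B) -> linked V e X.
Proof.
set Z := A :&: B; move=> es [VE nc] XA lA lB P w wX dw.
have [D' [[D1 D2 D3 D4] D5]] := lA P w wX dw.
have dis i j v : i \in P -> j \in P -> v \in D' i -> v \in D' j -> i = j.
  move=> iP jP vi vj; apply/eqP/negPn/negP => ij; have /disjoint_setI0/setP/(_ v) := D4 i j iP jP ij.
  by rewrite !inE vi vj.
pose c i x y := connect (ind (off e X) (D' i)) x y.
have cs i x y : c i x y -> c i y x by apply: connect_symr; apply/ind_sym/off_sym.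
have leave i b : i \in P -> ~~ c i (w i true) (w i false) -> exists z, [/\ z \in D' i, z \in Z & c i (w i b) z].
  move=> iP nc'; have nb : ~~ c i (w i b) (w i (~~ b)) by case: b => //=; apply: contra nc' => /cs.
  have cb : connect (ind (off (addclq e Z) X) (D' i)) (w i b) (w i (~~ b)).
    by case: b {nb} => /=; [|apply: connect_symr; [exact/ind_sym/off_sym/addclq_sym|]]; apply: D3.
  apply: NNPP => nz; move/negP: nb; apply.
  apply: (connect_inv (P := fun v => c i (w i b) v) _ cb); last exact: connect0.
  move=> x y cx /and3P[/andP[exy nX] xD yD].
  apply: (connect_trans cx (connect1 _)); rewrite /= /off xD yD nX !andbT.
  case/orP: exy => // /and3P[xZ yZ _]; by case: nz; exists x.
pose P' := [set i in P | ~~ c i (w i true) (w i false)].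
have [w' hw'] : exists w' : I * bool -> T, forall q, q.1 \in P' -> [/\ w' q \in D' q.1, w' q \in Z & c q.1 (w q.1 q.2) (w' q)].
  case: (set_0Vmem P') => [P0|[i0 _]]; first by exists (fun q => w q.1 q.2) => q; rewrite P0 inE.
  have ex q : q.1 \in P' -> exists z, [/\ z \in D' q.1, z \in Z & c q.1 (w q.1 q.2) z].
    by case: q => k b; rewrite inE => /andP[kP nck]; apply: leave.
  by have [f hf] := fchoice (w i0 true) ex; exists f.
have P'P i : i \in P' -> i \in P by rewrite inE => /andP[].
have [||E [[E1 E2 E3 E4] E5]] := lB P' (fun i b => w' (i, b)).
- by move=> i b iP; have [] := hw' (i, b) iP.
- move=> i j b b' iP jP E; have [/= h1 _ c1] := hw' (i, b) iP; have [/= h2 _ c2] := hw' (j, b') jP.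
  have ij : i = j by apply: (dis i j (w' (i, b)) (P'P i iP) (P'P j jP) h1); rewrite E.
  split=> //; subst j; apply/eqP/negPn/negP => bb.
  have := iP; rewrite inE => /andP[_ /negP]; apply.
  have c3 : c i (w i b) (w i b') by apply: connect_trans c1 _; rewrite E; apply: cs.
  by case: b b' bb c3 {E c1 c2 h1 h2} => -[] // _ /cs.
have EZ i v : i \in P' -> v \in E i -> v \in A -> v \in D' i.
  move=> iP vE vA; have vZ : v \in Z by rewrite inE vA (subsetP (E1 i iP)).
  by have [b ->] := E5 i v iP vE vZ; have [] := hw' (i, b) iP.
exists (fun i => D' i :|: (if i \in P' then E i else set0)); split; first split.
- move=> i iP; rewrite subUset -VE (subset_trans (D1 i iP)) ?subsetUl //=.
  by case: ifP => [/E1/subset_trans->|_]; rewrite ?subsetUr ?sub0set.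
- by move=> i b iP; rewrite inE D2.
- move=> i iP; case: ifPn => iP'; last first.
    by move: iP'; rewrite inE iP /= negbK setU0.
  have sub (r r' : rel T) (D0 D1' : {set T}) x y : D0 \subset D1' -> (forall a b, a \in D0 -> b \in D0 -> r a b -> r' a b) ->
      connect (ind r D0) x y -> connect (ind r' D1') x y.
    move=> sD h; apply: connect_mono => a b /and3P[rab aD bD].
    by rewrite /= h // !(subsetP sD).
  have [_ _ cT] := hw' (i, true) iP'; have [_ _ cF] := hw' (i, false) iP'.
  apply: connect_trans (sub _ _ _ _ _ _ (subsetUl _ _) _ cT) _ => //.
  apply: (@connect_trans _ _ (w' (i, false))); last by apply: sub (cs _ _ _ cF); rewrite ?subsetUl.
  apply: sub (subsetUr _ _) _ (E3 i iP') => a b aE bE; rewrite /off => /andP[-> ] /=; apply: contra => /andP[aX bX].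
  by rewrite !inE !(subsetP XA) // !(subsetP (E1 i iP')).
- move=> i j iP jP ij; rewrite -setI_eq0; apply/eqP/setP => v; rewrite inE in_set0; apply/negP => /andP[].
  have D'E k l : k \in P -> l \in P' -> v \in D' k -> v \in E l -> k = l.
    by move=> kP lP vk vl; apply: (dis k l v kP (P'P l lP) vk); apply: EZ => //; apply: (subsetP (D1 k kP)).
  rewrite !in_setU => /orP[vi|vi] /orP[vj|vj]; move/eqP: ij; apply.
  + exact: dis vi vj.
  + by move: vj; case: ifP => [jP'|_]; rewrite ?in_set0 // => vj; apply: D'E vj.
  + by move: vi; case: ifP => [iP'|_]; rewrite ?in_set0 // => vi; apply/esym; apply: D'E vi.
  + move: vi vj; case: ifP => [iP'|_]; rewrite ?in_set0 // => vi; case: ifP => [jP'|_]; rewrite ?in_set0 // => vj.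
    apply/eqP/negPn/negP => ij.
    by have /disjoint_setI0/setP/(_ v) := E4 i j iP' jP' ij; rewrite !inE vi vj.
- move=> i v iP; rewrite in_setU => /orP[vD|]; first exact: D5.
  by case: ifP => [iP'|_]; rewrite ?in_set0 // => vE vX; apply: D5 => //; apply: EZ => //; apply: (subsetP XA).
Qed.

(** Contraction of [u] onto [v] without a change of type: [v] inherits the neighbours of [u], and
    [u] is dropped by passing to the vertex set [V :\ u]. *)
Definition contract e u v : rel T := fun x y =>
  [|| e x y, [&& x == v, e u y & y != v] | [&& y == v, e u x & x != v]].

Lemma contract_sym e u v : symmetric e -> symmetric (contract e u v).
Proof. by move=> es x y; rewrite /contract es [X in _ || X]orbC. Qed.

Lemma contract_irr e u v : irreflexive e -> irreflexive (contract e u v).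
Proof. by move=> ei x; rewrite /contract ei; case: eqVneq => //= _; rewrite !andbF. Qed.

(** A set through [v] is pulled back by adding [u], through which every inherited edge at [v] can be
    rerouted. *)
Lemma link_contract V e X u v : symmetric e -> u \in V -> u \notin X -> e u v -> v != u ->
  linked (V :\ u) (contract e u v) X -> linked V e X.
Proof.
move=> es uV uX euv vu lk P w wX dw; have [D [[D1 D2 D3 D4] D5]] := lk P w wX dw.
have Du i : i \in P -> u \notin D i by move=> iP; apply/negP => /(subsetP (D1 i iP)); rewrite !inE eqxx.
exists (fun i => if v \in D i then u |: D i else D i); split; first split.
- move=> i iP; have sV := subset_trans (D1 i iP) (subsetDl _ _).
  by case: ifP => // _; rewrite subUset sub1set uV.
- by move=> i b iP; case: ifP => // _; rewrite ?inE D2 ?orbT.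
- move=> i iP; case: ifPn => vD; last first.
    apply: connect_mono (D3 i iP) => x y /and3P[/andP[/or3P[exy|/andP[/eqP-> _]|/andP[/eqP-> _]] nX] xD yD];
    by [rewrite /= /off exy xD yD nX | rewrite (negbTE vD) in xD | rewrite (negbTE vD) in yD].
  move: (D3 i iP); move: (w i true) (w i false); apply: connect_sub => x y /and3P[/andP[exy nX] xD yD].
  have st a b : a \in u |: D i -> b \in u |: D i -> e a b -> (a == u) || (b == u) -> connect (ind (off e X) (u |: D i)) a b.
    move=> aD bD eab h; apply: connect1; rewrite /= aD bD /off eab /= andbT.
    by case/orP: h => /eqP->; rewrite (negbTE uX) ?andbF.
  have uD : u \in u |: D i by rewrite setU11.
  case/or3P: exy => [exy|/and3P[/eqP-> euy _]|/and3P[/eqP-> eux _]].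
  + by apply: connect1; rewrite /= /off exy nX !inE xD yD !orbT.
  + by apply: (@connect_trans _ _ u); apply: st; rewrite ?uD ?eqxx ?orbT // ?in_setU1 ?vD ?yD ?orbT // es.
  + by apply: (@connect_trans _ _ u); apply: st; rewrite ?uD ?eqxx ?orbT // ?in_setU1 ?vD ?xD ?orbT // es.
- move=> i j iP jP ij; rewrite -setI_eq0; apply/eqP/setP => x; rewrite inE in_set0; apply/negP => /andP[].
  have dd y : y \in D i -> y \in D j -> False.
    by move=> yi yj; have /disjoint_setI0/setP/(_ y) := D4 i j iP jP ij; rewrite !inE yi yj.
  case: ifP => vi; case: ifP => vj; rewrite ?in_setU1.
  + by case: (dd v).
  + by case/predU1P=> [->|xi xj]; [rewrite (negbTE (Du j jP)) | exact: (dd x)].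
  + by move=> xi /predU1P[E|xj]; [rewrite E (negbTE (Du i iP)) in xi | exact: (dd x)].
  + exact: dd.
- move=> i x iP; case: ifP => _; last exact: D5.
  by rewrite in_setU1 => /predU1P[->|]; [rewrite (negbTE uX) | exact: D5].
Qed.

Definition nopair e P w : rel T := fun x y =>
  e x y && ~~ [exists i in P, ((x == w i true) && (y == w i false)) || ((x == w i false) && (y == w i true))].

Lemma nopair_sym e P w : symmetric e -> symmetric (nopair e P w).
Proof.
move=> es x y; rewrite /nopair es; congr (_ && ~~ _); apply: eq_existsb => i; congr (_ && _).
by rewrite orbC; congr (_ || _); rewrite andbC.
Qed.

(* Unlike [linked], this allows [Z] to be all of [B]; the set [U] collects the vertices to be avoided. *)
Definition flex (m : nat) B Z e := forall P w U, (forall i b, i \in P -> w i b \in Z) -> distinct P w ->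
  U \subset Z -> [disjoint terms P w & U] -> 2 * #|P| + #|U| <= m ->
  exists D, linkage (nopair e P w) B P w D /\ forall i, i \in P -> [disjoint D i & U].

Lemma linked_flex m B Z e : linked B e Z -> flex m B Z e.
Proof.
move=> lk P w U wZ dw UZ dU _; have [D [[D1 D2 D3 D4] D5]] := lk P w wZ dw.
exists D; split=> [|i iP]; last first.
  apply/pred0P => v /=; apply/negP => /andP[vD vU]; have [b vE] := D5 i v iP vD (subsetP UZ v vU).
  by move/pred0P/(_ v): dU => /=; rewrite vU vE terms_in.
split=> // i iP; apply: connect_mono (D3 i iP) => x y /and3P[/andP[exy nZ] xD yD].
rewrite /= /nopair exy xD yD !andbT /=; apply: contra nZ => /existsP[j /andP[jP]].
by case/orP=> /andP[/eqP-> /eqP->]; rewrite !wZ.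
Qed.

Lemma path_off e S x l : path e x l -> (forall v, v \in l -> v \notin S) -> path (off e S) x l.
Proof.
elim: l x => //= z l IH x /andP[exz pz] lS; rewrite /off exz (negbTE (lS z (mem_head _ _))) andbF /=.
by apply: IH => // v vl; apply: lS; rewrite inE vl orbT.
Qed.

(* [e1] may contain additional edges inside [F]; they are harmless because the vertices of [F] in [B] are either
   avoided or ends of the path using them, and [nopair] excludes the edge between the two ends. *)
Lemma link_via m e e1 A B S F : symmetric e -> S \subset A -> #|S| <= m -> flex m B (A :&: B) e1 ->
  (forall x y, e1 x y -> e x y \/ (x \in F) && (y \in F)) -> F :&: B \subset S ->
  (forall Y, separates (ind e A) S (A :&: B) Y -> #|S| <= #|Y|) -> linked (A :|: B) e S.
Proof.
set Z := A :&: B; move=> es SA Sm fx e1e FS mg P w wS dw.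
have [Q [hQ dQ]] := menger (ind_sym A es) mg.
pose q x := last x (Q x).
have QA x : x \in S -> {subset x :: Q x <= A}.
  by move=> xS; have [pQ _ _ _] := hQ x xS; apply: path_ind_in pQ _; apply: (subsetP SA).
have qZ x : x \in S -> q x \in Z by move=> xS; have [] := hQ x xS.
have qi x y : x \in S -> y \in S -> q x = q y -> x = y.
  by move=> xS yS E; apply: (dQ x y (q x)) => //; [|rewrite E]; exact: mem_last.
have QZ x v : x \in S -> v \in x :: Q x -> v \in B -> v = q x.
  move=> xS vQ vB; have [_ _ _ bQ] := hQ x xS; case: (belast_last vQ) => // /bQ.
  by rewrite inE vB (QA x).
have QS x v : x \in S -> v \in x :: Q x -> v \in S -> v = x.
  by move=> xS vQ vS; apply/esym; apply: (dQ x v v) => //; rewrite mem_head.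
(* The linkage in [B] must avoid the ends of the paths that start at vertices of [S] other than
   terminals. *)
pose U := [set q x | x in S :\: terms P w].
have TS : terms P w \subset S by apply/subsetP => v /termsP[i [b [iP ->]]]; apply: wS.
have [|||||D [[D1 D2 D3 D4] D5]] := fx P (fun i b => q (w i b)) U.
- by move=> i b iP; apply: qZ; apply: wS.
- by move=> i j b c iP jP /(qi _ _ (wS i b iP) (wS j c jP)) /(dw _ _ _ _ iP jP).
- by apply/subsetP => v /imsetP[x]; rewrite inE => /andP[_ xS] ->; apply: qZ.
- apply/pred0P => v /=; apply/negP => /andP[/termsP[i [b [iP ->]]] /imsetP[x]]; rewrite inE => /andP[xT xS].
  by move/(qi _ _ (wS i b iP) xS) => E; rewrite -E terms_in in xT.
- apply: leq_trans Sm; rewrite -(card_terms dw) -(cardsID (terms P w) S) (setIidPr TS) leq_add2l.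
  exact: leq_imset_card.
have QU x i : x \in S -> i \in P -> q x \in D i -> exists b, x = w i b.
  move=> xS iP qD; have [/termsP[j [b [jP xE]]]|xT] := boolP (x \in terms P w).
    suff ij : i = j by exists b; rewrite ij.
    apply/eqP/negPn/negP => ij; have /disjoint_setI0/setP/(_ (q x)) := D4 i j iP jP ij.
    by rewrite !inE qD xE D2.
  have /pred0P/(_ (q x)) := D5 i iP; rewrite /= qD /= => /negP[]; apply: imset_f; rewrite inE xT.
  by [].
have DS i v : i \in P -> v \in D i -> v \in S -> exists b, v = w i b /\ q v = v.
  move=> iP vD vS; have vB := subsetP (D1 i iP) v vD.
  have qv : v = q v by apply: QZ; rewrite ?mem_head.
  by have [|b E] := QU v i vS iP; [rewrite -qv | exists b].
pose LQ i := [set v in w i true :: Q (w i true)] :|: [set v in w i false :: Q (w i false)].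
have LQP i v : i \in P -> reflect (exists b, v \in w i b :: Q (w i b)) (v \in LQ i).
  move=> iP; rewrite in_setU in_set [v \in [set _ in _]]in_set; apply: (iffP orP) => [[h|h]|[[] h]]; by [exists true | exists false | left | right].
exists (fun i => D i :|: LQ i); split; first split.
- move=> i iP; apply/subsetP => v; rewrite in_setU => /orP[/(subsetP (D1 i iP)) vB|/LQP[]// b /(QA _ (wS i b iP)) vA];
  by rewrite inE ?vB ?vA ?orbT.
- by move=> i b iP; rewrite in_setU; apply/orP; right; apply/LQP => //; exists b; rewrite mem_head.
- move=> i iP; set E := _ :|: _.
  have leg b : connect (ind (off e S) E) (w i b) (q (w i b)).
    have [pQ _ _ _] := hQ _ (wS i b iP); apply/connectP; exists (Q (w i b)) => //.
    have uQ : uniq (w i b :: Q (w i b)) by have [] := hQ _ (wS i b iP).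
    have sS v : v \in w i b :: Q (w i b) -> v \in S -> v = w i b by apply: QS; apply: wS.
    have sE : {subset w i b :: Q (w i b) <= E}.
      by move=> v vQ; rewrite in_setU; apply/orP; right; apply/LQP => //; exists b.
    apply: path_ind => //; apply: path_off (path_ind_sub pQ) _ => v vQ; apply/negP => vS.
    have vE : v = w i b by apply: sS; rewrite // inE vQ orbT.
    by move: uQ; rewrite /= -{1}vE vQ.
  apply: connect_trans (leg true) _; apply: connect_trans (connect_symr (ind_sym _ (off_sym _ es)) (leg false)).
  move: (D3 i iP); move: (q (w i true)) (q (w i false)); apply: connect_sub => x y /and3P[/andP[exy np] xD yD].
  have [<-|nxy] := eqVneq x y; first exact: connect0.
  (* An edge of [D i] inside [S] could only join the two terminals of pair [i], with both of their
     paths trivial, and this edge is removed by [nopair]. *)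
  have key : ~~ ((x \in S) && (y \in S)).
    apply/andP => -[xS yS]; have [b [Ex qx]] := DS i x iP xD xS; have [c [Ey qy]] := DS i y iP yD yS.
    case/negP: np; apply/existsP; exists i; rewrite iP /=.
    have -> : q (w i true) = w i true by case: b c Ex Ey nxy => -[] Ex Ey; rewrite ?Ex ?Ey ?eqxx // -?Ex -?Ey.
    have -> : q (w i false) = w i false by case: b c Ex Ey nxy => -[] Ex Ey; rewrite ?Ex ?Ey ?eqxx // -?Ex -?Ey.
    by case: b c Ex Ey nxy => -[] -> -> ; rewrite !eqxx ?orbT.
  apply: connect1; rewrite /= /off key !in_setU xD yD !andbT.
  case: (e1e x y exy) => [->//|/andP[xF yF]]; case/negP: key.
  by rewrite !(subsetP FS) // inE ?xF ?yF (subsetP (D1 i iP)).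
- move=> i j iP jP ij; rewrite -setI_eq0; apply/eqP/setP => v; rewrite inE in_set0; apply/negP => /andP[].
  have DQ k l : k \in P -> l \in P -> v \in D k -> v \in LQ l -> k = l.
    move=> kP lP vD /(LQP _ _ lP)[b vQ].
    have vq := QZ _ _ (wS l b lP) vQ (subsetP (D1 k kP) v vD).
    have [|c /(dw _ _ _ _ lP kP)[]] := QU (w l b) k (wS l b lP) kP; by rewrite -?vq.
  rewrite [v \in D i :|: _]in_setU [v \in D j :|: _]in_setU => /orP[vi|vi] /orP[vj|vj]; move/eqP: ij; apply.
  + by have [//|ij] := eqVneq i j; have /disjoint_setI0/setP/(_ v) := D4 i j iP jP ij; rewrite !inE vi vj.
  + exact: (DQ i j iP jP vi vj).
  + exact/esym/(DQ j i jP iP vj vi).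
  + move/(LQP _ _ iP): vi => [b vb]; move/(LQP _ _ jP): vj => [c vc].
    by have /(dw _ _ _ _ iP jP)[] := dQ _ _ _ (wS i b iP) (wS j c jP) vb vc.
- move=> i v iP; rewrite in_setU => /orP[vD|/(LQP _ _ iP)[b vQ]] vS; last by exists b; apply: QS vQ vS; apply: wS.
  by have [b []] := DS i v iP vD vS; exists b.
Qed.
End Linked.

(** * Rigid separations *)

Section TW.
Variables (T I : finType).
Implicit Types (e : rel T) (A B F S V X Z U L : {set T}) (P : {set I}) (w : I -> bool -> T).
Local Notation linked := (@linked T I).
Local Notation flex := (@flex T I).

(** Seen from [A], the side [B] of a rigid separation is as good as a clique on [A :&: B], so the
    problem reduces to a smaller graph. *)
Definition rigid V e X A B :=
  [/\ sepn V e A B, X \subset A, #|A :&: B| < #|X|, linked B e (A :&: B) & B :\: A != set0].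

(** Consider a minimum separator [S] of [X] from [A :&: B] within [A]. If it is as large as [X],
    Menger paths carry [X] to [A :&: B], where [flex] links their ends. Otherwise everything beyond
    [S] is linked to [S] by the same argument, and [S] is the separator of a rigid separation; the
    alternative in the hypotheses makes its far side nonempty. *)
Lemma link_sep m V e e1 X A B : symmetric e -> sepn V e A B -> X \subset A -> #|X| <= m ->
  flex m B (A :&: B) e1 ->
  (forall x y, e1 x y -> e x y \/ (x \in X) && (y \in X)) ->
  B :\: A != set0 \/ #|X| <= #|A :&: B| ->
  linked V e X \/ exists A' B', rigid V e X A' B'.
Proof.
set Z := A :&: B; move=> es [VE nc] XA Xm fx e1e big.
have [S0 [sep0 min0]] : exists S, separates (ind e A) X Z S /\ forall S', separates (ind e A) X Z S' -> #|S| <= #|S'|.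
  by apply: (@ex_min _ (separates (ind e A) X Z) (fun S => #|S|)); exists X => a b aX /negP; case.
case: (leqP #|X| #|S0|) => [geX|ltX].
  left; rewrite -VE; apply: (link_via es XA Xm fx e1e) => [|Y /min0]; first exact: subsetIl.
  exact: leq_trans.
right; pose S := S0 :&: A.
have ZA : Z \subset A by apply: subsetIl.
have sepS : separates (ind e A) X Z S.
  move=> a b aX aS bZ bS; apply/negP => c; have aA := subsetP XA a aX; have bA := subsetP ZA b bZ.
  move: aS bS; rewrite !in_setI aA bA !andbT => aS bS; move/negP: (sep0 a b aX aS bZ bS); apply.
  apply: connect_mono c => x y /and3P[/and3P[exy xA yA]]; rewrite !in_setC !in_setI xA yA !andbT => xS yS.
  by rewrite /= exy xA yA !in_setC xS yS.
have cS : #|S| <= #|S0| by apply: subset_leq_card; apply: subsetIl.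
have SA : S \subset A by apply: subsetIr.
have minS Y : separates (ind e A) X Z Y -> #|S| <= #|Y| by move/min0; apply: leq_trans.
clearbody S; clear sep0 min0.
(* [RA] is the part of [A] reachable from [X] before [S]; the rigid separation will be [RA :|: S]
   against the complement of [RA]. *)
pose RA := [set v in A :\: S | [exists x in X :\: S, connect (ind (ind e A) (~: S)) x v]].
have RAA v : v \in RA -> v \in A by rewrite inE => /andP[/setDP[]].
have RAS v : v \in RA -> v \notin S by rewrite inE => /andP[/setDP[]].
have RAZ v : v \in RA -> v \notin Z.
  rewrite inE => /andP[/setDP[_ vS] /existsP[x /andP[/setDP[xX xS] c]]]; apply/negP => vZ.
  by move/negP: (sepS x v xX xS vZ vS).
have RAB v : v \in RA -> v \notin B.
  by move=> vR; have := RAZ v vR; rewrite inE (RAA v vR).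
have RAX v : v \in X -> v \notin S -> v \in RA.
  move=> vX vS; rewrite inE in_setD vS (subsetP XA) //=; apply/existsP; exists v.
  by rewrite in_setD vS vX connect0.
have RAc u v : u \in RA -> v \in A -> e u v -> v \notin S -> v \in RA.
  move=> uR vA euv vS; have uA := RAA u uR; have uS := RAS u uR.
  move: uR; rewrite inE => /andP[_ /existsP[x /andP[xX c]]]; rewrite inE in_setD vS vA; apply/existsP; exists x.
  rewrite xX; apply: connect_trans c (connect1 _).
  by rewrite /= euv uA vA !in_setC uS vS.
clearbody RA.
have ZE : (A :\: RA) :&: B = Z.
  apply/setP => v; rewrite !inE; case: (boolP (v \in RA)) => //= vR; rewrite (negbTE (RAB v vR)).
  by rewrite !andbF.
exists (RA :|: S), (V :\: RA).
have IE : (RA :|: S) :&: (V :\: RA) = S.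
  apply/setP => v; rewrite !inE; case: (boolP (v \in RA)) => [/RAS/negbTE-> //|_] /=.
  case: (boolP (v \in S)) => //= vS; by rewrite -VE inE (subsetP SA v vS).
have BE : V :\: RA = (A :\: RA) :|: B.
  apply/setP => v; rewrite -VE !inE; case: (boolP (v \in RA)) => //= /RAB/negbTE->.
  by [].
split.
- split.
    apply/setP => v; rewrite !inE; case: (boolP (v \in RA)) => [vR|_] /=.
      by rewrite -VE inE (RAA v vR).
    by case: (boolP (v \in S)) => //= vS; rewrite -VE inE (subsetP SA v vS).
  move=> x y; rewrite !in_setU !in_setD; case: (boolP (x \in RA)) => [xR _ _|xR] /=; last first.
    by move=> xS; rewrite -VE inE (subsetP SA x xS).
  case: (boolP (y \in RA)) => //= yR yV yS; apply/negP => exy.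
  case: (boolP (y \in A)) => yA; first by rewrite (RAc x y) in yR.
  have yB : y \in B by move: yV; rewrite -VE inE (negbTE yA).
  by move/negP: (nc x y (RAA x xR) (RAB x xR) yB yA).
- by apply/subsetP => v vX; rewrite inE; case: (boolP (v \in S)) => vS; rewrite ?orbT // RAX.
- by rewrite IE; apply: leq_ltn_trans cS ltX.
- rewrite IE BE; apply: (@link_via _ _ m e e1 (A :\: RA) B S X) => //.
  + by apply/subsetP => v vS; rewrite inE (subsetP SA v vS) andbT; apply/negP => /RAS; rewrite vS.
  + by apply: ltnW; apply: leq_trans (leq_ltn_trans cS ltX) Xm.
  + by rewrite ZE.
  + apply/subsetP => v /setIP[vX vB]; apply/negPn/negP => vS; have := RAB v (RAX v vX vS).
    by rewrite vB.
  + rewrite ZE => Y sepY; apply: minS => x z xX xY zZ zY; apply/negP => c.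
    have c' : connect (ind (ind e A) (~: Y)) z x by apply: connect_symr c; apply/ind_sym/ind_sym.
    pose C v := v \notin RA /\ connect (ind (ind e (A :\: RA)) (~: Y)) v z.
    have [xR cx] : C x.
      apply: (connect_inv (P := C) _ c'); last by split; [apply/negP => /RAZ; rewrite zZ | apply: connect0].
      move=> u v [uR cu] /and3P[/and3P[euv uA vA]]; rewrite !in_setC => uY vY.
      have vR : v \notin RA.
        apply/negP => vR; have uS : u \in S by apply/negPn/negP => /(RAc v u vR uA); rewrite es euv (negbTE uR) => /(_ isT).
        by move/negP: (sepY u z uS uY zZ zY).
      split=> //; apply: (@connect_trans _ _ u) => //; apply: connect1.
      by rewrite /= es euv !inE uR vR uA vA uY vY.
    have xS : x \in S by apply/negPn/negP => /(RAX x xX); rewrite (negbTE xR).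
    by move/negP: (sepY x z xS xY zZ zY).
- apply/set0Pn; case: big => [/set0Pn[v /setDP[vB vA]]|le].
    exists v; rewrite !inE negb_or -VE inE vB orbT.
    have vR : v \notin RA by apply: contra vA; apply: RAA.
    by rewrite vR !andbT; apply: contra vA; apply: (subsetP SA).
  have : 0 < #|Z :\: S| by have := cardsD_ge Z S; nlia.
  case/card_gt0P => v /setDP[vZ vS]; exists v.
  have vR : v \notin RA by apply/negP => /RAZ; rewrite vZ.
  by rewrite !inE negb_or vR vS -VE inE (subsetP ZA v vZ).
Qed.

Lemma sepn_C V e A B : symmetric e -> sepn V e A B -> sepn V e B A.
Proof. by move=> es [VE nc]; split=> [|x y xB xA yA yB]; rewrite 1?setUC // es nc. Qed.

Lemma sepn_sub V e e' A B : (forall x y, e x y -> e' x y) -> sepn V e' A B -> sepn V e A B.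
Proof. by move=> ee [VE nc]; split=> // x y xA xB yB yA; apply: contra (nc x y xA xB yB yA); apply: ee. Qed.

Lemma sepn_subl V e A B : sepn V e A B -> A \subset V.
Proof. by case=> <- _; apply: subsetUl. Qed.

Lemma sepn_subr V e A B : sepn V e A B -> B \subset V.
Proof. by case=> <- _; apply: subsetUr. Qed.

Lemma sepn_nb V e A B x y : symmetric e -> sepn V e A B -> x \in B :\: A -> y \in V -> e x y -> y \in B.
Proof.
move=> es [VE nc] /setDP[xB xA] yV exy; apply/negPn/negP => yB.
have yA : y \in A by move: yV; rewrite -VE inE (negbTE yB) orbF.
by move/negP: (nc y x yA yB xB xA); rewrite es.
Qed.

(** [A] is attached to [B] only along [A :&: B], hence to the left part [A1], so adding it there
    changes neither the separator nor the far side. *)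
Lemma sepn_nest V e A B A1 B1 : symmetric e -> sepn V e A B -> sepn B e A1 B1 -> A :&: B \subset A1 ->
  [/\ sepn V e (A :|: A1) B1, (A :|: A1) :&: B1 = A1 :&: B1 & B1 :\: (A :|: A1) = B1 :\: A1].
Proof.
move=> es sVB sB1 ZA; have [VE nc] := sVB; have [BE nc1] := sB1.
have AB1 v : v \in A -> v \in B1 -> v \in A1.
  by move=> vA vB; apply: (subsetP ZA); rewrite inE vA -BE inE vB orbT.
split.
- split=> [|x y]; first by rewrite -setUA BE.
  move=> xA xB yB; rewrite inE negb_or => /andP[yA yA1]; apply/negP => exy.
  have yS : y \in B :\: A by rewrite inE yA -BE inE yB orbT.
  have xBB : x \in B.
    apply: (sepn_nb es sVB yS); last by rewrite es.
    by move: xA; rewrite -VE -BE !inE => /orP[->|->]; rewrite ?orbT.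
  have xA1 : x \in A1 by move: xBB; rewrite -BE inE (negbTE xB) orbF.
  by move/negP: (nc1 x y xA1 xB yB yA1).
- apply/setP => v; rewrite !inE; case: (boolP (v \in B1)) => vB; rewrite ?andbF ?andbT //.
  by case: (boolP (v \in A)) => //= vA; rewrite AB1.
- apply/setP => v; rewrite !inE; case: (boolP (v \in B1)) => vB; rewrite ?andbF ?andbT //.
  by case: (boolP (v \in A)) => //= vA; rewrite AB1.
Qed.

Lemma R_mono V V' e e' S : V \subset V' -> (forall x y, e x y -> e' x y) -> R V e S <= R V' e' S.
Proof. by move=> VV ee; apply: R_sub => x y xV yV exy ->; rewrite !(subsetP VV) // ee. Qed.

Lemma R_right V e A B : symmetric e -> sepn V e A B -> R V e (B :\: A) <= R B e (B :\: A).
Proof.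
move=> es sVB; apply: R_sub => x y xV yV exy xy; split=> //.
  case/orP: xy => [/setDP[]//|yS]; apply: (sepn_nb es sVB yS xV); by rewrite es.
by case/orP: xy => [xS|/setDP[]//]; apply: (sepn_nb es sVB xS yV).
Qed.

(** Choose a violating separation with the smallest right side. A violation inside [B] would extend
    by [sepn_nest] to one with a smaller right side, so [B] is massed over its separator. *)
Lemma min_violation lam V e X A B : symmetric e -> sepn V e A B -> X \subset A -> #|A :&: B| < #|X| ->
  2 * lam * #|B :\: A| < R V e (B :\: A) ->
  exists A B, [/\ sepn V e A B, X \subset A, #|A :&: B| < #|X|,
     2 * lam * #|B :\: A| < R V e (B :\: A) & massed lam B e (A :&: B)].
Proof.
move=> es s0 x0 c0 r0.
pose viol (p : {set T} * {set T}) := [/\ sepn V e p.1 p.2, X \subset p.1, #|p.1 :&: p.2| < #|X| &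
     2 * lam * #|p.2 :\: p.1| < R V e (p.2 :\: p.1)].
have [[{A B s0 x0 c0 r0}A B] [[/= sVB XA cA rA] minB]] : exists p, viol p /\ forall q, viol q -> #|p.2| <= #|q.2|.
  by apply: (@ex_min _ viol (fun p => #|p.2|)); exists (A, B).
exists A, B; split=> //; set Z := A :&: B in cA *.
have BZ : B :\: Z = B :\: A by apply/setP => v; rewrite !inE; case: (v \in B); rewrite ?andbT ?andbF.
split; first by rewrite BZ; apply: leq_trans rA (R_right es sVB).
move=> A1 B1 sB1 ZA c1; rewrite leqNgt; apply/negP => r1.
have [s2 E1 E2] := sepn_nest es sVB sB1 ZA.
have BB : B1 \subset B := sepn_subr sB1.
have /minB /= : viol (A :|: A1, B1).
  split=> /=; rewrite ?E1 ?E2 //; [by rewrite (subset_trans XA) ?subsetUl | by apply: leq_trans c1 (ltnW cA) |].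
  by apply: leq_trans r1 _; apply: R_mono (sepn_subr sVB) _.
rewrite leqNgt => /negP; apply; apply: proper_card; rewrite properEneq BB andbT.
apply: contraTneq c1 => E; rewrite -leqNgt E; apply: subset_leq_card.
by rewrite subsetI ZA /Z subsetIr.
Qed.

Definition induct lam m n := forall V e X, #|V| < n -> symmetric e -> irreflexive e ->
  X \subset V -> #|X| <= m -> massed lam V e X -> linked V e X.

Lemma clique_side V e A B Z : sepn V (addclq e Z) A B -> Z \subset V -> Z \subset A \/ Z \subset B.
Proof.
move=> [VE nc] ZV; have [ZA|/subsetPn[z zZ zA]] := boolP (Z \subset A); [by left | right].
apply/subsetP => y yZ; apply/negPn/negP => yB.
have inV v : v \in Z -> v \notin A -> v \in B.
  by move=> vZ vA; have := subsetP ZV v vZ; rewrite -VE inE (negbTE vA).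
have yA : y \in A by apply: contraR yB; apply: inV.
move/negP: (nc y z yA yB (inV z zZ zA) zA); apply; apply/orP; right; rewrite yZ zZ /=.
by apply: contraNneq yB => ->; apply: inV.
Qed.

(* Replace [B] by a clique on [A :&: B].  If the result is massed, induction and [link_lift] apply; otherwise a
   minimal violation leads to a rigid separation with a smaller left side. *)
Lemma no_rigid lam m V e X A B : induct lam m #|V| -> symmetric e -> irreflexive e ->
  #|X| <= m -> massed lam V e X -> rigid V e X A B -> linked V e X.
Proof.
move=> IH es ei Xm [M1 M2]; have [n] := ubnP #|A|; elim: n A B => // n IHn A B ltn [sVB XA cA lB BA].
set Z := A :&: B in cA lB; set e' := addclq e Z.
have es' : symmetric e' by apply: addclq_sym.
have ei' : irreflexive e' by apply: addclq_irr.
have ee x y : e x y -> e' x y by rewrite /e' /addclq => ->.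
have AV := sepn_subl sVB; have BV := sepn_subr sVB; have sBA := sepn_C es sVB.
have VE : A :|: B = V by case: sVB.
have ltA : #|A| < #|V|.
  apply: proper_card; apply/properP; split=> //; case/set0Pn: BA => v /setDP[vB vA].
  by exists v; rewrite ?(subsetP BV).
have M1' : 2 * lam * #|A :\: X| < R A e' (A :\: X).
  have VX : #|V :\: X| = #|A :\: X| + #|B :\: A|.
    rewrite -(cardsID A (V :\: X)); congr (_ + _); apply: eq_card => v; rewrite !inE -VE inE.
      by case: (v \in A); case: (v \in X); case: (v \in B).
    case: (boolP (v \in A)) => //= vA; have -> // : v \notin X.
    by apply: contra vA; apply: (subsetP XA).
  have : R V e (V :\: X) <= R A e' (A :\: X) + R V e (B :\: A).
    apply: leq_trans (cardsU_le _ _); apply: subset_leq_card; apply/subsetP => -[x y].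
    move=> h0.
    have {h0}/and4P[xV yV exy h] : [&& x \in V, y \in V, e x y & (x \in V :\: X) || (y \in V :\: X)] by move: h0; rewrite in_set.
    apply/setUP; case: (boolP ((x \in B :\: A) || (y \in B :\: A))) => xS; [right|left]; rewrite in_set /=.
      by rewrite xV yV exy.
    have inA v : v \in V -> v \notin B :\: A -> v \in A.
      by rewrite -VE !inE => /orP[->//|->]; rewrite andbT negbK.
    move: xS; rewrite negb_or => /andP[xS yS]; rewrite !inA // ee //=.
    by move: h; rewrite !in_setD !inA // xV yV.
  have := M2 A B sVB XA cA; move: M1; rewrite VX mulnDr; nlia.
have [ok|/not_all_ex_not[A0 h0]] := classic (forall A1 B1, sepn A e' A1 B1 -> X \subset A1 -> #|A1 :&: B1| < #|X| ->
    R A e' (B1 :\: A1) <= 2 * lam * #|B1 :\: A1|).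
  by apply: (link_lift es sVB XA _ lB); apply: IH.
have {A0 h0}[A1 [B1 [s1 XA1 c1 r1 m1]]] : exists A1 B1, [/\ sepn A e' A1 B1, X \subset A1, #|A1 :&: B1| < #|X|,
    2 * lam * #|B1 :\: A1| < R A e' (B1 :\: A1) & massed lam B1 e' (A1 :&: B1)].
  move/not_all_ex_not: h0 => [B0 h0].
  have [s1 {}h0] := imply_to_and _ _ h0; have [x1 {}h0] := imply_to_and _ _ h0; have [c1 {}h0] := imply_to_and _ _ h0.
  by apply: min_violation s1 x1 c1 _ => //; rewrite ltnNge; apply/negP.
have A1A := sepn_subl s1; have B1A := sepn_subr s1; have s1' : sepn A e A1 B1 := sepn_sub ee s1.
have BA1 : B1 :\: A1 != set0.
  apply: contraTneq r1 => ->; rewrite cards0 muln0 -leqNgt leqn0 cards_eq0; apply/eqP/setP => -[x y].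
  by rewrite !inE !andbF.
(* If the clique lies in [A1], no added edge is counted for [B1 :\: A1], so the violation already
   existed in [e], contrary to [M2]. *)
case: (clique_side s1) => [|ZA1|ZB1]; first exact: subsetIl.
  have [s2 E1 E2] : [/\ sepn V e (B :|: A1) B1, (B :|: A1) :&: B1 = A1 :&: B1 & B1 :\: (B :|: A1) = B1 :\: A1].
    by apply: (sepn_nest es sBA s1'); rewrite setIC.
  have := M2 _ _ s2; rewrite E1 E2 => h; have {h}h := h (subset_trans XA1 (subsetUr _ _)) c1.
  exfalso; move: r1; rewrite ltnNge => /negP; apply; apply: leq_trans h.
  apply: R_sub => x y xA yA exy xy; split; rewrite ?(subsetP AV) //.
  have nZ v : v \in B1 :\: A1 -> v \notin Z by move=> /setDP[_]; apply: contra; apply: (subsetP ZA1).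
  by case/orP: exy => // /and3P[xZ yZ _]; case/orP: xy => /nZ; rewrite ?xZ ?yZ.
(* Now the clique lies in [B1]. Induction links [B1] to its separator and [link_lift] replaces the
   clique by [B], so [B1 :|: B] is the right side of a rigid separation. *)
have lB1 : linked B1 e' (A1 :&: B1).
  apply: IH => //; [by apply: leq_ltn_trans (subset_leq_card B1A) ltA | exact: subsetIr |].
  by apply: leq_trans (ltnW c1) Xm.
have BZ : B1 :&: B = Z.
  apply/setP => v; rewrite !inE; apply/andP/andP => -[v1 v2]; split=> //; first exact: (subsetP B1A).
  by apply: (subsetP ZB1); rewrite inE v1.
have [s2 E1 E2] : [/\ sepn V e (B :|: B1) A1, (B :|: B1) :&: A1 = B1 :&: A1 & A1 :\: (B :|: B1) = A1 :\: B1].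
  by apply: (sepn_nest es sBA (sepn_C es s1')); rewrite setIC.
have IE : A1 :&: (B1 :|: B) = A1 :&: B1 by rewrite setIC [B1 :|: B]setUC E1 setIC.
apply: (IHn A1 (B1 :|: B)).
  rewrite -ltnS; apply: leq_trans ltn; rewrite ltnS; apply: proper_card; apply/properP; split=> //.
  by case/set0Pn: BA1 => v /setDP[vB vA]; exists v; rewrite ?(subsetP B1A).
split=> //; first by apply: sepn_C => //; rewrite setUC.
- by rewrite IE.
- rewrite IE; apply: (@link_lift _ _ _ e _ B1 B) => //; rewrite ?BZ //; last exact: subsetIr.
  split=> // x y xB1 xB yB yB1; have [_ nc] := sVB; apply: nc => //; first exact: (subsetP B1A).
  by apply: contra yB1 => yA; apply: (subsetP ZB1); rewrite inE yA.
- by case/set0Pn: BA1 => v /setDP[vB vA]; apply/set0Pn; exists v; rewrite !inE vA vB.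
Qed.
End TW.

(** * Massed sets are linked *)

Section TW.
Variables (T I : finType).
Implicit Types (e : rel T) (A B F S V X Z U L : {set T}) (P : {set I}) (w : I -> bool -> T).
Local Notation linked := (@linked T I).
Local Notation flex := (@flex T I).
Local Notation induct := (@induct T I).
Local Notation rigid := (@rigid T I).

Lemma R_set0 V e : R V e set0 = 0.
Proof. by apply/eqP; rewrite cards_eq0; apply/eqP/setP => -[x y]; rewrite !inE !andbF. Qed.

Lemma not_massed lam V e X : symmetric e -> 2 * lam * #|V :\: X| < R V e (V :\: X) -> ~ massed lam V e X ->
  exists A B, [/\ sepn V e A B, X \subset A, #|A :&: B| < #|X|,
     2 * lam * #|B :\: A| < R V e (B :\: A) & massed lam B e (A :&: B)].
Proof.
move=> es M1 nm; apply: NNPP => nv; apply: nm; split=> // A B s x c; rewrite leqNgt; apply/negP => r.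
by apply: nv; apply: min_violation s x c r.
Qed.

(** Contraction removes one vertex outside [X], and it loses the edge [u - v] and one edge for each
    common neighbour, at most [lam] in all. Adjacency to [v] is taken in [addclq e X], because a new
    edge inside [X] would not be counted by [R]. *)
Lemma contract_mass lam V e X u v : symmetric e -> irreflexive e -> X \subset V -> u \in V -> u \notin X ->
  v \in V -> e u v -> #|[set y in nb e V u | addclq e X v y]| < lam ->
  2 * lam * #|V :\: X| < R V e (V :\: X) ->
  2 * lam * #|(V :\ u) :\: X| < R (V :\ u) (contract e u v) ((V :\ u) :\: X).
Proof.
move=> es ei XV uV uX vV euv ct M1.
have vu : v != u by apply: contraTneq euv => ->; rewrite ei.
have VX : #|V :\: X| = (#|(V :\ u) :\: X|).+1.
  rewrite (cardsD1 u) !inE uV uX /=; congr _.+1; apply: eq_card => y; rewrite !inE.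
  by case: (y == u); rewrite ?andbF.
set N := nb e V u; set Ts := [set y in N | addclq e X v y] in ct *.
pose Y := [set y in N | (y != v) && ~~ addclq e X v y].
have cN : #|N| <= 1 + #|Ts| + #|Y|.
  have sb : N \subset [set v] :|: Ts :|: Y.
    by apply/subsetP => y yN; rewrite !in_setU in_set1 [y \in Ts]in_set [y \in Y]in_set yN /=; case: (y == v); case: addclq.
  apply: leq_trans (subset_leq_card sb) _; apply: leq_trans (cardsU_le _ _) _; rewrite leq_add2r.
  by apply: leq_trans (cardsU_le _ _) _; rewrite cards1.
pose old := [set p : T * T | [&& p.1 \in V :\ u, p.2 \in V :\ u, e p.1 p.2 & (p.1 \in (V :\ u) :\: X) || (p.2 \in (V :\ u) :\: X)]].
have h1 : R V e (V :\: X) <= #|old| + 2 * #|N|.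
  have sb : [set p : T * T | [&& p.1 \in V, p.2 \in V, e p.1 p.2 & (p.1 \in V :\: X) || (p.2 \in V :\: X)]] \subset
     old :|: setX [set u] N :|: setX N [set u].
    apply/subsetP => -[x y]; rewrite !inE /= => /and4P[xV yV exy h]; rewrite xV yV exy /=.
    move: exy h; rewrite xV yV !andbT; case: (eqVneq x u) => [->|xu] /=; first by move=> ->; rewrite ?orbT.
    case: (eqVneq y u) => [->|yu] /=; last by move=> _ h; rewrite ?andbT h.
    by rewrite es => ->; rewrite ?orbT.
  apply: leq_trans (subset_leq_card sb) _; apply: leq_trans (cardsU_le _ _) _.
  have := cardsU_le old (setX [set u] N); rewrite !cardsX !cards1; nlia.
have h2 : #|old| + #|setX [set v] Y| + #|setX Y [set v]| <= R (V :\ u) (contract e u v) ((V :\ u) :\: X).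
  have YP y : y \in Y -> [/\ y \in V, e u y, y != v, y != u & ~~ addclq e X v y].
    rewrite !inE => /andP[/andP[yV ey] /andP[yv ny]]; split=> //; by apply: contraTneq ey => ->; rewrite ei.
  have new y : y \in Y -> ((v \in (V :\ u) :\: X) || (y \in (V :\ u) :\: X)) && ~~ e v y.
    move=> /YP[yV ey yv yu]; rewrite /addclq negb_or => /andP[-> h]; rewrite !inE vu vV yu yV !andbT.
    by rewrite -negb_and; apply: contra h => /andP[-> ->]; rewrite eq_sym.
  rewrite /R; apply: card3_le.
  - apply/subsetP => -[x y]; rewrite !in_set /= => /and4P[-> -> exy ->].
    by rewrite /contract exy.
  - apply/subsetP => -[x y]; rewrite in_setX in_set1 /= => /andP[/eqP-> yY]; have [yV ey yv yu _] := YP y yY.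
    have /andP[h _] := new y yY; rewrite in_set /= h !in_setD1 vu vV yu yV /= andbT.
    by rewrite /contract eqxx ey yv !orbT.
  - apply/subsetP => -[y x]; rewrite in_setX in_set1 /= => /andP[yY /eqP->]; have [yV ey yv yu _] := YP y yY.
    have /andP[h _] := new y yY; rewrite in_set /= orbC h !in_setD1 vu vV yu yV /= andbT.
    by rewrite /contract eqxx ey yv !orbT.
  - apply/pred0P => -[x y] /=; apply/negP => /andP[]; rewrite in_set in_setX in_set1 /= => /and4P[_ _ exy _] /andP[/eqP Ex /new].
    by rewrite -Ex exy andbF.
  - apply/pred0P => -[x y] /=; apply/negP => /andP[]; rewrite !in_setX !in_set1 /= => /andP[/eqP-> _] /andP[/YP[_ _ /eqP]].
    by [].
  - apply/pred0P => -[x y] /=; apply/negP => /andP[]; rewrite in_set in_setX in_set1 /= => /and4P[_ _ exy _] /andP[/new + /eqP Ex].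
    by rewrite -Ex es exy andbF.
rewrite !cardsX !cards1 in h2; move: h1 h2 cN ct M1; rewrite VX mulnS; nlia.
Qed.

(** If the contraction is massed, induction applies. If not, a minimal violation of it is lifted to
    the original graph, and the position of [v] decides to which sides [u] returns. *)
Lemma contract_step lam m V e X u v : induct lam m #|V| -> symmetric e -> irreflexive e ->
  X \subset V -> #|X| <= m -> massed lam V e X -> u \in V -> u \notin X -> v \in V -> e u v ->
  #|[set y in nb e V u | addclq e X v y]| < lam -> linked V e X.
Proof.
move=> IH es ei XV Xm mas uV uX vV euv ct.
have [M1 M2] := mas; have vu : v != u by apply: contraTneq euv => ->; rewrite ei.
set V' := V :\ u; set e' := contract e u v.
have es' : symmetric e' := contract_sym u v es.
have ei' : irreflexive e' := contract_irr u v ei.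
have XV' : X \subset V' by rewrite subsetD1 XV.
have ltV : #|V'| < #|V| by rewrite /V' [in X in _ < X](cardsD1 u) uV.
have M1' : 2 * lam * #|V' :\: X| < R V' e' (V' :\: X) by apply: contract_mass.
have [mas'|nm] := classic (massed lam V' e' X).
  by apply: (link_contract es uV uX euv vu); apply: IH.
have {nm}[A [B [sAB XA c r mB]]] := not_massed es' M1' nm.
have ee x y : e x y -> e' x y by rewrite /e' /contract => ->.
have env y : e u y -> y != v -> e' v y by move=> h1 h2; rewrite /e' /contract eqxx h1 h2 orbT.
have [VE nc] := sAB.
have AV := sepn_subl sAB; have BV := sepn_subr sAB.
have uA : u \notin A by apply: contraTN isT => /(subsetP AV); rewrite !inE eqxx.
have uB : u \notin B by apply: contraTN isT => /(subsetP BV); rewrite !inE eqxx.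
have BA : B :\: A != set0 by apply: contraTneq r => ->; rewrite cards0 muln0 R_set0.
have VV : V = u |: V' by rewrite setD1K.
have V'V : V' \subset V := subsetDl _ _.
have ltB : #|u |: B| < #|V|.
  have /subsetPn[x xX xB] : ~~ (X \subset B).
    by apply/negP => XB; move: c; rewrite ltnNge subset_leq_card // subsetI XA.
  apply: proper_card; apply/properP; split; first by rewrite VV setUS.
  exists x; rewrite ?(subsetP XV) // !inE negb_or xB andbT.
  by apply: contraNneq uX => <-.
have lkB : linked B e' (A :&: B).
  apply: IH => //; [by apply: leq_ltn_trans (subset_leq_card BV) ltV | exact: subsetIr |].
  by apply: leq_trans (ltnW c) Xm.
have vAB : (v \in A) || (v \in B) by rewrite -in_setU VE !inE vu.
(* With [v] off [B], putting [u] on the left gives a violation in the original graph, which is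
   impossible. *)
case: (boolP (v \in B)) => vB; last first.
  rewrite (negbTE vB) orbF in vAB.
  have s2 : sepn V e (u |: A) B.
    split=> [|x y]; first by rewrite -setUA VE VV.
    rewrite in_setU1 => /predU1P[->|xA] xB yB; rewrite !inE negb_or => /andP[yu yA]; apply/negP => exy.
      have yv : y != v by apply: contraNneq vB => <-.
      by move/negP: (nc v y vAB vB yB yA); apply; apply: env.
    by move/negP: (nc x y xA xB yB yA); apply; apply: ee.
  have IE : (u |: A) :&: B = A :&: B.
    by apply/setP => y; rewrite !inE; case: eqVneq => //= ->; rewrite (negbTE uB) andbF.
  have DE : B :\: (u |: A) = B :\: A.
    by apply/setP => y; rewrite !inE; case: eqVneq => //= ->; rewrite (negbTE uB) andbF.
  have := M2 _ _ s2; rewrite IE DE => h; have {h}h := h (subset_trans XA (subsetUr _ _)) c.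
  exfalso; move: r; rewrite ltnNge => /negP; apply; apply: leq_trans h.
  apply: R_sub => x y xV yV exy xy; split; rewrite ?(subsetP V'V) //.
  have vS : v \notin B :\: A by rewrite inE (negbTE vB) andbF.
  have no y' : y' \in B :\: A -> e u y' -> y' != v -> False.
    by move=> /setDP[yB yA] ey yv; move/negP: (nc v y' vAB vB yB yA); apply; apply: env.
  case/or3P: exy xy => [//|/and3P[/eqP-> ey yv]|/and3P[/eqP-> ex xv]]; rewrite (negbTE vS) ?orbF ?orFb => hS.
    by case: (no y).
  by case: (no x).
(* With [v] strictly on the right, [u] joins it there and the separation becomes rigid. *)
case: (boolP (v \in A)) => vA; last first.
  have lk2 : linked (u |: B) e (A :&: B).
    apply: (@link_contract _ _ _ _ _ u v) => //; rewrite ?setU11 //; first by rewrite inE (negbTE uA).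
    by rewrite setU1K.
  apply: (no_rigid IH es ei Xm mas (A := A) (B := u |: B)).
  have IE : A :&: (u |: B) = A :&: B.
    by apply/setP => y; rewrite !inE; case: eqVneq => //= ->; rewrite (negbTE uA).
  split; rewrite ?IE //.
    split=> [|x y]; first by rewrite setUCA VE VV.
    move=> xA; rewrite in_setU1 negb_or => /andP[xu xB]; rewrite in_setU1 => /predU1P[->|yB] yA; apply/negP => exy.
      have xv : x != v by apply: contraNneq vA => <-.
      by move/negP: (nc x v xA xB vB vA); apply; rewrite es'; apply: env => //; rewrite es.
    by move/negP: (nc x y xA xB yB yA); apply; apply: ee.
  by apply/set0Pn; exists v; rewrite !inE vA vB orbT.
(* With [v] in the separator, [u] must go to both sides. The order may grow to [#|X|], so the
   separation need not be rigid; its right side is massed and [link_sep] concludes. *)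
have IE : (u |: A) :&: (u |: B) = u |: A :&: B by rewrite setUIr.
have s2 : sepn V e (u |: A) (u |: B).
  split=> [|x y]; first by rewrite -setUUr VE VV.
  rewrite !in_setU1 !negb_or => /orP[/eqP->|xA] /andP[xu xB]; first by rewrite eqxx in xu.
  move=> /orP[/eqP->|yB] /andP[yu yA]; first by rewrite eqxx in yu.
  by apply: contra (nc x y xA xB yB yA); apply: ee.
have DE : (u |: B) :\: (u |: A) = B :\: A.
  by apply/setP => y; rewrite !inE; case: eqVneq => //= ->; rewrite (negbTE uB) andbF.
have DZ : (u |: B) :\: (u |: A :&: B) = B :\: A.
  apply/setP => y; rewrite !inE; case: eqVneq => /= [->|_]; first by rewrite (negbTE uB) andbF.
  by case: (y \in B); rewrite ?andbT ?andbF.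
have cZ : #|u |: A :&: B| <= #|X|.
  by rewrite cardsU1; apply: leq_trans c; rewrite -add1n leq_add2r leq_b1.
have mB' : massed lam (u |: B) e (u |: A :&: B).
  split; first rewrite DZ.
    apply: leq_trans r _; apply: leq_trans (R_right es' sAB) _.
    (* Inherited edges at [v] are moved back to [u]; this is injective because [u] is not in [B]. *)
    pose f (p : T * T) := if e p.1 p.2 then p else if p.1 == v then (u, p.2) else (p.1, u).
    rewrite {1}/R -(@card_in_imset _ _ f); last first.
      move=> [x y] [x' y']; rewrite !in_set /= => /and4P[xB yB exy _] /and4P[xB' yB' exy' _]; rewrite /f /=.
      have nu z : z \in B -> z <> u by move=> zB E; rewrite -E zB in uB.
      case: (boolP (e x y)) => h1; case: (boolP (e x' y')) => h2 //.
      - by case: ifP => _ [E1 E2]; [case: (nu x xB) | case: (nu y yB)].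
      - by case: ifP => _ [E1 E2]; [case: (nu x' xB') | case: (nu y' yB')].
      - case/or3P: exy => [|/and3P[/eqP Ex _ yv]|/and3P[/eqP Ey _ xv]]; rewrite ?(negbTE h1) //;
        case/or3P: exy' => [|/and3P[/eqP Ex' _ yv']|/and3P[/eqP Ey' _ xv']]; rewrite ?(negbTE h2) //.
        + by rewrite Ex Ex' eqxx => -[->].
        + by rewrite Ex eqxx (negbTE xv') => -[E1 E2]; case: (nu _ xB').
        + by rewrite Ex' eqxx (negbTE xv) => -[E1 E2]; case: (nu _ xB).
        + by rewrite Ey Ey' (negbTE xv) (negbTE xv') => -[->].
    apply: subset_leq_card; apply/subsetP => q /imsetP[[x y]]; rewrite in_set /= => /and4P[xB yB exy xy] ->.
    rewrite /f /=; case: ifP => h1; first by rewrite in_set /= !in_setU1 xB yB h1 xy !orbT.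
    have vS : v \notin B :\: A by rewrite inE vA.
    case/or3P: exy xy => [|/and3P[/eqP Ex ey yv]|/and3P[/eqP Ey ex xv]]; first by rewrite h1.
      by rewrite Ex eqxx (negbTE vS) /= => yS; rewrite in_set /= setU11 in_setU1 yB ey yS !orbT.
    by rewrite Ey (negbTE xv) (negbTE vS) orbF => xS; rewrite in_set /= setU11 in_setU1 xB es ex xS !orbT.
  move=> A1 B1 s3 ZA1 c1; have [|s4 E1 E2] := sepn_nest es s2 s3; first by rewrite IE.
  have := M2 _ _ s4; rewrite E1 E2 => h; have {h}h : R V e (B1 :\: A1) <= 2 * lam * #|B1 :\: A1|.
    apply: h; last by apply: leq_trans c1 cZ.
    by apply: subset_trans XA _; apply: subset_trans (subsetUl _ _); apply: subsetUr.
  by apply: leq_trans h; apply: R_mono (sepn_subr s2) _.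
have lk3 : linked (u |: B) e ((u |: A) :&: (u |: B)).
  rewrite IE; apply: IH => //; last by apply: leq_trans cZ Xm.
  by rewrite setUS // subsetIr.
have XA2 : X \subset u |: A by rewrite (subset_trans XA) ?subsetUr.
have fx := @linked_flex _ _ #|X| _ _ _ lk3.
have [|||[A' [B' rg]]] := link_sep es s2 XA2 (leqnn #|X|) fx.
- by left.
- by left; rewrite DE.
- by [].
exact: (no_rigid IH es ei Xm mas rg).
Qed.

Lemma nopair_deg e P w L U x : distinct P w -> #|nb e L x| <= #|nb (nopair e P w) (L :\: U) x| + #|U| + 1.
Proof.
move=> dw; have [Pn [cP hP]] : exists Pn : {set T}, #|Pn| <= 1 /\ forall y, e x y -> ~~ nopair e P w x y -> y \in Pn.
  have [/termsP[i [b [iP xE]]]|xT] := boolP (x \in terms P w).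
    exists [set w i (~~ b)]; rewrite cards1; split=> // y exy; rewrite /nopair exy negbK => /existsP[j /andP[jP]].
    rewrite in_set1; case/orP=> /andP[/eqP E /eqP->]; move: E; rewrite xE => /(dw _ _ _ _ iP jP)[-> ->] //.
  exists set0; rewrite cards0; split=> // y exy; rewrite /nopair exy negbK => /existsP[j /andP[jP]].
  by case/orP=> /andP[/eqP E _]; rewrite E terms_in in xT.
apply: leq_trans (_ : #|nb (nopair e P w) (L :\: U) x :|: U :|: Pn| <= _).
  apply: subset_leq_card; apply/subsetP => y; rewrite in_nb => /andP[yL exy]; rewrite !in_setU in_nb in_setD yL andbT.
  case: (boolP (y \in U)) => //= _; rewrite ?orbT // orbF.
  by case: (boolP (nopair e P w x y)) => //= /(hP y exy).
apply: leq_trans (cardsU_le _ _) _; apply: leq_add => //; exact: cardsU_le.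
Qed.

Lemma nopair_irr e P w : irreflexive e -> irreflexive (nopair e P w).
Proof. by move=> ei x; rewrite /nopair ei. Qed.

Lemma nopair_term e P w i : i \in P -> ~~ nopair e P w (w i true) (w i false).
Proof. by move=> iP; rewrite /nopair negb_and negbK; apply/orP; right; apply/existsP; exists i; rewrite iP !eqxx. Qed.

Lemma flex_link m L e : (forall P w U, (forall i b, i \in P -> w i b \in L :\: U) -> distinct P w ->
  U \subset L -> 2 * #|P| + #|U| <= m -> exists D, linkage (nopair e P w) (L :\: U) P w D) -> flex m L L e.
Proof.
move=> h P w U wL dw UL dU c; have [|D [D1 D2 D3 D4]] := h P w U _ dw UL c.
  move=> i b iP; rewrite inE wL // andbT; apply/negP => wU.
  by move/pred0P/(_ (w i b)): dU => /=; rewrite wU terms_in.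
exists D; split=> [|i iP]; first by split=> // i iP; apply: subset_trans (D1 i iP) (subsetDl _ _).
by apply/pred0P => v /=; apply/negP => /andP[/(subsetP (D1 i iP)) /setDP[_ /negbTE->]].
Qed.

Lemma dense_flex (ell : nat) L e : symmetric e -> irreflexive e ->
  (forall x, x \in L -> 2 * #|L| + 5 * ell + 2 <= 4 * #|nb e L x|) -> 3 * ell < #|L| -> flex (2 * ell) L L e.
Proof.
move=> es ei deg cL; apply: flex_link => P w U wL dw UL c.
have cU : #|L :\: U| + #|U| = #|L| by have := cardsID U L; rewrite (setIidPr UL); nlia.
(* The least degree bound that the first numerical condition of [dense_link] admits. *)
apply: (@dense_link _ _ _ _ _ _ ((2 * #|L :\: U| + 5 * #|P| - 4) %/ 4)) => //.
- exact: nopair_sym.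
- exact: nopair_irr.
- exact: nopair_term.
- move=> x /setDP[xL xU]; have := deg x xL; have := @nopair_deg e P w L U x dw; nlia.
- nlia.
- nlia.
Qed.

(** Either [K] itself serves, or a pairing without linkage makes [K_lemma] produce a subset dense
    enough for [dense_flex]. Deleting the forbidden set [U] costs [#|U|] in the degrees, and the
    slack becomes [3 + #|U|]. *)
Lemma small_flex (ell lam : nat) (K : {set T}) e : symmetric e -> irreflexive e ->
  (forall x, x \in K -> lam + 1 <= #|nb e K x|) -> #|K| <= 2 * lam + 3 -> 6 * ell <= lam -> K != set0 ->
  exists L, [/\ L \subset K, 2 * ell <= #|L| & flex (2 * ell) L L e].
Proof.
move=> es ei deg cK le Kn; have [k kK] := set0Pn _ Kn.
have Kbig : lam + 2 <= #|K|.
  have := deg k kK; have : #|nb e K k| < #|K|.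
    apply: proper_card; apply/properP; split; first by apply/subsetP => v; rewrite in_nb => /andP[].
    by exists k; rewrite ?in_nb ?ei ?andbF.
  nlia.
have [fK|nfK] := classic (flex (2 * ell) K K e); first by exists K; split=> //; nlia.
have : ~ forall P w U, (forall i b, i \in P -> w i b \in K :\: U) -> distinct P w ->
  U \subset K -> 2 * #|P| + #|U| <= 2 * ell -> exists D, linkage (nopair e P w) (K :\: U) P w D.
  by move=> h; apply: nfK; apply: flex_link.
move=> /not_all_ex_not[P] /not_all_ex_not[w] /not_all_ex_not[U] h.
have [wK {}h] := imply_to_and _ _ h; have [dw {}h] := imply_to_and _ _ h.
have [UK {}h] := imply_to_and _ _ h; have [c nl] := imply_to_and _ _ h.
have cU : #|K :\: U| + #|U| = #|K| by have := cardsID U K; rewrite (setIidPr UK); nlia.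
have [||||||||lk|[L [LK Ln Ld]]] := @K_lemma T I (nopair e P w) (K :\: U) P w (lam - #|U|) (3 + #|U|).
- exact: nopair_sym.
- exact: nopair_irr.
- by [].
- by [].
- exact: nopair_term.
- by move=> x /setDP[xK _]; have := deg x xK; have := @nopair_deg e P w K U x dw; nlia.
- nlia.
- nlia.
- by case: nl.
have nbL x : #|nb (nopair e P w) L x| <= #|nb e L x|.
  by apply: subset_leq_card; apply/subsetP => y; rewrite !in_nb => /andP[-> /andP[->]].
have lL x : x \in L -> #|nb e L x| < #|L|.
  move=> xL; apply: proper_card; apply/properP; split; first by apply/subsetP => v; rewrite in_nb => /andP[].
  by exists x; rewrite ?in_nb ?ei ?andbF.
have [x0 x0L] := set0Pn _ Ln.
have L3 : 3 * ell < #|L|.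
  by have [_] := Ld x0 x0L; have := nbL x0; have := lL x0 x0L; nlia.
exists L; split; [exact: subset_trans LK (subsetDl _ _) | nlia |].
apply: dense_flex => // x xL; have [h1 _] := Ld x xL; have := nbL x; nlia.
Qed.

(* For a largest possible [lam] there is a vertex [u] of degree at most [2 * lam + 2], and by [contract_step] every
   neighbour of [u] has [lam] neighbours in common with it, so [K_lemma] applies to the neighbourhood of [u]. *)
Theorem massed_linked (ell lam : nat) V e X : symmetric e -> irreflexive e -> X \subset V ->
  #|X| <= 2 * ell -> 6 * ell <= lam -> massed lam V e X -> linked V e X.
Proof.
have [n] := ubnP #|V|; elim: n V e X lam => // n IHn V e X lam ltn es ei XV cX le [M1 M2].
have [lam1 [r1 max1]] : exists l, (lam <= l /\ 2 * l * #|V :\: X| < R V e (V :\: X)) /\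
   forall l', lam <= l' /\ 2 * l' * #|V :\: X| < R V e (V :\: X) -> l' <= l.
  apply: (@ex_max _ (fun l => lam <= l /\ 2 * l * #|V :\: X| < R V e (V :\: X)) id (R V e (V :\: X))).
    by exists lam.
  move=> l [_ h]; have [E|E] := posnP #|V :\: X|; last by move: h; nia.
  by move: h; rewrite (cards0_eq E) R_set0.
case: r1 => le1 r1; have {}M2 A B : sepn V e A B -> X \subset A -> #|A :&: B| < #|X| -> R V e (B :\: A) <= 2 * lam1 * #|B :\: A|.
  by move=> s x c; apply: leq_trans (M2 A B s x c) _; rewrite leq_mul2r leq_mul2l le1 !orbT.
have mas : massed lam1 V e X by [].
have IH : induct lam1 (2 * ell) #|V|.
  move=> V' e' X' lt es' ei' XV' cX' m'; apply: (IHn V' e' X' lam1) => //; first by apply: leq_trans lt ltn.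
  exact: leq_trans le le1.
have VXn : 0 < #|V :\: X|.
  by rewrite lt0n; apply: contraTneq r1 => E; rewrite (cards0_eq E) R_set0 cards0 muln0.
have r2 : R V e (V :\: X) <= 2 * lam1.+1 * #|V :\: X|.
  rewrite leqNgt; apply/negP => h; have /max1 : lam <= lam1.+1 /\ 2 * lam1.+1 * #|V :\: X| < R V e (V :\: X) by split=> //; nlia.
  by rewrite ltnn.
have [u /setDP[uV uX] du] : exists2 u, u \in V :\: X & #|nb e V u| <= 2 * lam1 + 2.
  apply: NNPP => no; have : (2 * lam1 + 3) * #|V :\: X| <= \sum_(u in V :\: X) #|nb e V u|.
    rewrite mulnC -sum_nat_const; apply: leq_sum => u uS; rewrite leqNgt; apply/negP => lt; apply: no.
    by exists u => //; nlia.
  have : \sum_(u in V :\: X) #|nb e V u| <= R V e (V :\: X).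
    rewrite (eq_bigr (fun u => #|setX [set u] (nb e V u)|)); last by move=> u _; rewrite cardsX cards1 mul1n.
    rewrite -card_bigcup_disj; last first.
      by move=> u u' [x y] _ _; rewrite !in_setX !in_set1 /= => /andP[/eqP<- _] /andP[/eqP-> _].
    apply: subset_leq_card; apply/subsetP => -[x y] /bigcupP[u uS]; rewrite in_setX in_set1 /= in_nb.
    move=> /and3P[/eqP-> yV exy]; have /setDP[uV uX] := uS; by rewrite in_set /= uV yV exy uS.
  by nia.
(* An isolated [u] leaves nothing to contract; deleting it loses no edge. *)
case: (set_0Vmem (nb e V u)) => [N0|[v0 v0N]].
  apply: (@linkedW _ _ (V :\ u)); first exact: subsetDl.
  have nou y : y \in V -> e u y -> False.
    by move=> yV ey; have : y \in nb e V u by [rewrite in_nb yV ey]; rewrite N0 inE.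
  have sub x y : x \in V -> y \in V -> e x y -> x \in V :\ u /\ y \in V :\ u.
    move=> xV yV exy; rewrite !in_setD1 xV yV !andbT; split; apply/eqP => E; move: exy; rewrite E; first exact: nou.
    by rewrite es; apply: nou.
  apply: IH => //.
  - by rewrite [X in _ < X](cardsD1 u) uV.
  - by rewrite subsetD1 XV.
  split=> [|A B sAB XA c].
    apply: leq_ltn_trans (_ : 2 * lam1 * #|V :\: X| < _); first by rewrite leq_mul2l subset_leq_card ?orbT // setSD ?subsetDl.
    apply: leq_trans r1 _; apply: R_sub => x y xV yV exy; have [xV' yV'] := sub x y xV yV exy.
    by move=> h; split=> //; move: h xV' yV'; rewrite !inE xV yV !andbT => + -> ->; rewrite ?andbT.
  have uB : u \notin B by apply/negP => /(subsetP (sepn_subr sAB)); rewrite !inE eqxx.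
  have DE : B :\: (u |: A) = B :\: A.
    by apply/setP => y; rewrite !inE; case: eqVneq => //= ->; rewrite (negbTE uB) andbF.
  have IE : (u |: A) :&: B = A :&: B.
    by apply/setP => y; rewrite !inE; case: eqVneq => //= ->; rewrite (negbTE uB) andbF.
  have := M2 (u |: A) B; rewrite DE IE => h; apply: leq_trans (h _ _ c).
  - by apply: R_mono => //; apply: subsetDl.
  - have [VE nc] := sAB; split; first by rewrite -setUA VE setD1K.
    move=> x y; rewrite !in_setU1 negb_or => /predU1P[->|xA] xB yB /andP[yu yA]; last exact: nc.
    apply/negP; apply: nou; have := subsetP (sepn_subr sAB) y yB; by rewrite inE => /andP[].
  - by rewrite (subset_trans XA) ?subsetUr.
apply: NNPP => nl.
have ct v : v \in nb e V u -> lam1 <= #|[set y in nb e V u | addclq e X v y]|.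
  rewrite in_nb => /andP[vV euv]; rewrite leqNgt; apply/negP => lt; apply: nl.
  exact: (contract_step IH es ei XV cX mas uV uX vV euv lt).
(* The common neighbours in [ct] are counted with [X] completed to a clique, so [K] is studied in
   [e1]. The added edges are admissible in [link_sep]. *)
pose K := u |: nb e V u; set e1 := addclq e X in ct.
have e1s : symmetric e1 := addclq_sym X es. have e1i : irreflexive e1 := addclq_irr X ei.
have uN : u \notin nb e V u by rewrite in_nb ei andbF.
have cN : lam1 + 1 <= #|nb e V u|.
  apply: leq_trans (_ : #|v0 |: [set y in nb e V u | e1 v0 y]| <= _).
    by rewrite cardsU1 in_set e1i andbF /= addnC leq_add2l ct.
  by apply: subset_leq_card; rewrite subUset sub1set v0N; apply/subsetP => y; rewrite in_set => /andP[].
have degK v : v \in K -> lam1 + 1 <= #|nb e1 K v|.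
  rewrite in_setU1 => /predU1P[->|vN].
    apply: leq_trans cN _; apply: subset_leq_card; apply/subsetP => y yN.
    rewrite in_nb in_setU1 yN orbT /= /e1 /addclq; by move: yN; rewrite in_nb => /andP[_ ->].
  apply: leq_trans (_ : #|u |: [set y in nb e V u | e1 v y]| <= _).
    by rewrite cardsU1 in_set (negbTE uN) /= addnC leq_add2l ct.
  apply: subset_leq_card; rewrite subUset sub1set; apply/andP; split.
    by rewrite in_nb setU11 e1s /e1 /addclq; move: vN; rewrite in_nb => /andP[_ ->].
  by apply/subsetP => y; rewrite in_set => /andP[yN ey]; rewrite in_nb in_setU1 yN ey orbT.
have cK : #|K| <= 2 * lam1 + 3 by rewrite cardsU1 uN; nlia.
have Kn : K != set0 by apply/set0Pn; exists u; rewrite setU11.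
have [L [LK L2 fL]] := small_flex e1s e1i degK cK (leq_trans le le1) Kn.
have LV : L \subset V.
  apply: subset_trans LK _; rewrite subUset sub1set uV; by apply/subsetP => y; rewrite in_nb => /andP[].
have sVL : sepn V e V L.
  split=> [|x y _ _ yL]; first by apply/setUidPl.
  by rewrite (subsetP LV).
have IE : V :&: L = L by apply/setIidPr.
have fL' : flex (2 * ell) L (V :&: L) e1 by rewrite IE.
have [|||[A [B rg]]] := link_sep es sVL XV cX fL'.
- move=> x y /orP[->|/and3P[-> -> _]]; by [left | right].
- by right; rewrite IE; apply: leq_trans cX L2.
- exact: nl.
by apply: nl; apply: no_rigid IH es ei cX mas rg.
Qed.
End TW.

(** * The Tutte-Berge formula *)

Section TutteBerge.
Variables (T : finType) (g : rel T).
Hypothesis gs : symmetric g.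
Implicit Types (U W C : {set T}) (f : T -> T).

(** A matching is encoded as an involution of [W]; its fixed points are the unmatched vertices. *)
Definition matching W f := forall x, x \in W -> [/\ f x \in W, f (f x) = x & f x != x -> g x (f x)].

Definition fixed W f := [set x in W | f x == x].

Lemma in_fixed W f x : (x \in fixed W f) = (x \in W) && (f x == x).
Proof. by rewrite in_set. Qed.

Definition optimal W f := matching W f /\ forall f', matching W f' -> #|fixed W f| <= #|fixed W f'|.

Lemma matching_del W f x : matching W f -> x \in W -> f x != x ->
  [/\ matching (W :\: [set x; f x]) f, fixed (W :\: [set x; f x]) f = fixed W f & #|W :\: [set x; f x]| + 2 = #|W|].
Proof.
move=> mf xW fx; have [fW ff gx] := mf x xW; split.
- move=> y; rewrite !inE negb_or => /andP[/andP[yx yf] yW]; have [h1 h2 h3] := mf y yW; split=> //.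
  rewrite ?inE h1 andbT negb_or; apply/andP; split; [apply: contraNneq yf => <- | apply: contraNneq yx => E].
    by rewrite h2.
  by rewrite -[y]h2 E ff.
- apply/setP => y; rewrite !in_fixed !inE; case: eqVneq => [->|yx] /=; first by rewrite (negbTE fx) !andbF.
  by case: eqVneq => [->|yf] //=; rewrite ff [x == f x]eq_sym (negbTE fx) !andbF.
have := cardsID [set x; f x] W; rewrite (setIidPr _); last by apply/subsetP => y; rewrite !inE => /orP[]/eqP->.
by rewrite cards2 eq_sym fx; nlia.
Qed.

Lemma matching_parity W f : matching W f -> odd #|W| = odd #|fixed W f|.
Proof.
have [n] := ubnP #|W|; elim: n W => // n IH W ltn mf.
case: (classic (exists2 x, x \in W & f x != x)) => [[x xW fx]|no]; last first.
  congr (odd _); apply: eq_card => x; rewrite in_fixed; case: (boolP (x \in W)) => //= xW; apply/esym.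
  by apply/negPn/negP => fx; apply: no; exists x.
have [mf' fE cW] := matching_del mf xW fx.
rewrite -fE -(IH (W :\: [set x; f x])) //; last by nlia.
by rewrite -cW addn2 /= negbK.
Qed.

Lemma optimal_ex W : exists f, optimal W f.
Proof.
apply: (@ex_min _ (matching W) (fun f => #|fixed W f|)).
by exists id => x xW; split=> //; rewrite eqxx.
Qed.

Definition rematch f x y z : T -> T := fun v => if v == x then y else if v == y then x else if v == z then z else f v.

(* Replaces the edge [y - f y] of a matching fixing [x] by the edge [x - y]; [y = f y] is allowed. *)
Lemma rematchP W f x y : matching W f -> x \in W -> y \in W -> f x = x -> x != y -> g x y ->
  let f' := rematch f x y (f y) in matching W f' /\ fixed W f' = (fixed W f :\: [set x; y]) :|: [set z | (z == f y) && (z != y)].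
Proof.
move=> mf xW yW fx xy gxy f'; have [fyW ffy _] := mf y yW.
have zx : f y != x by apply: contraNneq xy => E; rewrite -fx -E ffy.
have f'x : f' x = y by rewrite /f' /rematch eqxx.
have f'y : f' y = x by rewrite /f' /rematch eq_sym (negbTE xy) eqxx.
have f'z : f y != y -> f' (f y) = f y by rewrite /f' /rematch eqxx (negbTE zx) => /negbTE ->.
have f'o v : v != x -> v != y -> v != f y -> f' v = f v by rewrite /f' /rematch => /negbTE-> /negbTE-> /negbTE->.
split=> [v vW|].
  have [->|vx] := eqVneq v x; first by rewrite f'x f'y; split.
  have [->|vy] := eqVneq v y; first by rewrite f'y f'x; split=> // _; rewrite gs.
  have [E|vz] := eqVneq v (f y).
    have zy : f y != y by rewrite -E. rewrite E !f'z //; split=> //; by rewrite eqxx.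
  have [h1 h2 h3] := mf v vW; rewrite (f'o v) //.
  have o1 : f v != x by apply: contraNneq vx => E; rewrite -h2 E fx.
  have o2 : f v != y by apply: contraNneq vz => E; rewrite -h2 E.
  have o3 : f v != f y by apply: contraNneq vy => E; rewrite -h2 E ffy.
  by rewrite f'o.
apply/setP => v; rewrite in_setU in_setD !in_fixed !inE.
have [->|vx] := eqVneq v x; first by rewrite f'x eq_sym (negbTE xy) andbF /= [x == f y]eq_sym (negbTE zx).
have [->|vy] := eqVneq v y; first by rewrite f'y (negbTE xy) !andbF.
have [E|vz] := eqVneq v (f y); last by rewrite f'o //= orbF.
have zy : f y != y by rewrite -E.
by rewrite E f'z // eqxx fyW orbT.
Qed.

Lemma optimal_nadj W f x y : optimal W f -> x \in W -> y \in W -> f x = x -> f y = y -> x != y -> ~~ g x y.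
Proof.
move=> [mf of'] xW yW fx fy xy; apply/negP => gxy; have [m' E] := rematchP mf xW yW fx xy gxy.
have := of' _ m'; rewrite E leqNgt => /negP; apply; apply: proper_card; apply/properP; split.
  by apply/subsetP => v; rewrite in_setU in_setD !in_fixed !inE fy => /orP[/andP[] //|/andP[/eqP->]]; rewrite eqxx.
by exists x; rewrite ?in_setU ?in_setD !in_fixed ?inE ?xW ?fx ?eqxx // fy /= andbN.
Qed.

(** If every vertex is missed by some optimal matching, this is an equivalence relation, and
    adjacent vertices are equivalent by [optimal_nadj]. *)
Definition together W u v := u = v \/ forall f, optimal W f -> ~ (f u = u /\ f v = v).

(* Gallai's argument: take an optimal matching fixing [u] and [v] and one fixing [t] with as much in common as
   possible, and modify the second one along a single edge of the first. *)
Lemma together_trans W u t v : (forall x, x \in W -> exists f, optimal W f /\ f x = x) ->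
  u \in W -> t \in W -> v \in W -> together W u t -> together W t v -> together W u v.
Proof.
move=> allm uW tW vW [->//|Dut] [<-|Dtv]; first by right.
have [->|uv] := eqVneq u v; first by left.
right=> M0 oM0 [M0u M0v].
pose Q (p : (T -> T) * (T -> T)) := [/\ optimal W p.1, p.1 u = u, p.1 v = v, optimal W p.2 & p.2 t = t].
have [[M N] [[/= oM Mu Mv oN Nt] mx]] : exists p, Q p /\ forall q, Q q -> #|[set x in W | q.1 x == q.2 x]| <= #|[set x in W | p.1 x == p.2 x]|.
  apply: (@ex_max _ Q (fun p => #|[set x in W | p.1 x == p.2 x]|) #|T|); last by move=> *; apply: max_card.
  by have [N [oN Nt]] := allm t tW; exists (M0, N).
have [mM minM] := oM; have [mN minN] := oN.
have Nu : N u != u by apply/eqP => Nu; apply: (Dut N oN).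
have Nv : N v != v by apply/eqP => Nv; apply: (Dtv N oN).
have Mt : M t != t by apply/eqP => Mt; apply: (Dut M oM).
have cE : #|fixed W M| = #|fixed W N| by apply/eqP; rewrite eqn_leq minM // minN.
have [x [xW xt Nx Mx]] : exists x, [/\ x \in W, x != t, N x = x & M x != x].
  have c1 : 1 < #|fixed W M :\: fixed W N|.
    apply: leq_trans (_ : #|[set u; v]| <= _); first by rewrite cards2 uv.
    by apply: subset_leq_card; apply/subsetP => y; rewrite in_set2 => /orP[]/eqP->; rewrite in_setD !in_fixed ?uW ?vW ?Mu ?Mv ?eqxx ?Nu ?Nv.
  have c2 : 0 < #|(fixed W N :\: fixed W M) :\ t|.
    have := cardsID (fixed W M) (fixed W N); have := cardsID (fixed W N) (fixed W M).
    rewrite setIC; have := cardsD1 t (fixed W N :\: fixed W M); have := leq_b1 (t \in fixed W N :\: fixed W M); nlia.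
  have [x] := card_gt0P c2; rewrite in_setD1 in_setD !in_fixed => /and3P[xt h /andP[xW /eqP Nx]]; exists x; split=> //.
  by apply: contra h => ->; rewrite xW.
have [yW My gxy] := mM x xW; set y := M x in yW My gxy Mx.
have xy : x != y by rewrite eq_sym.
have Ny : N y != y.
  apply/eqP => Ny; move/negP: (optimal_nadj oN xW yW Nx Ny xy); apply; exact: gxy.
have [m' fE] := rematchP mN xW yW Nx xy (gxy Mx); set N' := rematch N x y (N y) in m' fE.
have [zW Nz _] := mN y yW.
have cf : #|fixed W N'| <= #|fixed W N|.
  rewrite fE; apply: leq_trans (cardsU_le _ _) _.
  have : #|[set z | (z == N y) && (z != y)]| <= 1.
    rewrite -(cards1 (N y)); apply: subset_leq_card; apply/subsetP => z; by rewrite !inE => /andP[].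
  have : #|fixed W N :\: [set x; y]| < #|fixed W N|.
    apply: proper_card; apply/properP; split; first exact: subsetDl.
    by exists x; rewrite ?in_setD !in_fixed ?inE ?xW ?Nx ?eqxx.
  by nlia.
have tn : t != y by apply: contraNneq Ny => <-; apply/eqP.
have tz : t != N y by apply: contraNneq Ny => E; rewrite -E -{1}Nt E Nz.
have /mx /= : Q (M, N').
  split=> //=; first by split=> // f' /minN; apply: leq_trans.
  by rewrite /N' /rematch [t == x]eq_sym (negbTE xt) (negbTE tn) (negbTE tz).
rewrite leqNgt => /negP; apply; apply: proper_card; apply/properP; split; last first.
  by exists x; rewrite inE xW /= -/y; [rewrite /N' /rematch !eqxx | rewrite Nx (negbTE Mx)].
apply/subsetP => w; rewrite !inE => /andP[wW /eqP Mw]; rewrite wW /= /N' /rematch.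
have [E|wx] := eqVneq w x; first by rewrite E.
have [E|wy] := eqVneq w y; first by rewrite E My.
have [E|wz] := eqVneq w (N y); last by rewrite Mw.
have [_ MMz _] := mM _ zW; move: Mw; rewrite E Nz => MNy.
have xz : x = N y by rewrite -MMz MNy My.
by case/eqP: xy; rewrite -Nx {1}xz.
Qed.

(** A vertex whose deletion raises the defect is put into [U], and induction does the rest. If there
    is none, every vertex is missed by an optimal matching, and the classes of [together] are the
    odd sets, with [U] empty. *)
Theorem tutte_berge W f : optimal W f -> exists U (Cs : {set {set T}}),
  [/\ U \subset W, #|fixed W f| + #|U| <= #|Cs|,
      forall C, C \in Cs -> [/\ C \subset W :\: U, odd #|C| & forall x y, x \in C -> y \in W :\: U -> g x y -> y \in C] &
      forall C D x, C \in Cs -> D \in Cs -> x \in C -> x \in D -> C = D].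
Proof.
have [n] := ubnP #|W|; elim: n W f => // n IH W f ltn of_.
case: (classic (exists v f', [/\ v \in W, optimal (W :\ v) f' & #|fixed W f| < #|fixed (W :\ v) f'|])) => [[v [f' [vW of' lt]]]|no].
  have cW : #|W| = #|W :\ v|.+1 by rewrite (cardsD1 v) vW.
  have [|U [Cs [UW c odd_ dis]]] := IH (W :\ v) f' _ of'; first by nlia.
  have vU : v \notin U by apply: contraTN isT => /(subsetP UW); rewrite !inE eqxx.
  have DE : W :\: (v |: U) = (W :\ v) :\: U by apply/setP => x; rewrite !inE negb_or -andbA; case: (x == v); case: (x \in U).
  exists (v |: U), Cs; rewrite DE; split=> //.
    by rewrite subUset sub1set vW (subset_trans UW) ?subsetDl.
  by rewrite cardsU1 vU; nlia.
(* Leave [v] unmatched and take an optimal matching of the rest. Its defect exceeds the minimum by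
   at most one, hence not at all, by parity. *)
have allm v : v \in W -> exists f', optimal W f' /\ f' v = v.
  move=> vW; have [h oh] := optimal_ex (W :\ v); have [mh _] := oh.
  have le : #|fixed (W :\ v) h| <= #|fixed W f|.
    by rewrite leqNgt; apply/negP => lt; apply: no; exists v, h.
  pose h' x := if x == v then v else h x.
  have mh' : matching W h'.
    move=> x xW; have [->|xv] := eqVneq x v; first by rewrite /h' !eqxx vW.
    have [|h1 h2 h3] := mh x; first by rewrite !inE xv.
    have [hv hW] : h x != v /\ h x \in W by apply/andP; move: h1; rewrite !inE.
    by rewrite /h' (negbTE xv) (negbTE hv).
  have fE : fixed W h' = v |: fixed (W :\ v) h.
    apply/setP => x; rewrite in_setU1 !in_fixed !inE /h'; have [->|xv] := eqVneq x v; last by [].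
    by rewrite vW eqxx.
  have cE : #|fixed W h'| = #|fixed (W :\ v) h|.+1 by rewrite fE cardsU1 in_fixed !inE eqxx.
  exists h'; rewrite {2}/h' eqxx; split=> //; split=> // f' /(proj2 of_); apply: leq_trans.
  have := matching_parity mh'; rewrite (matching_parity (proj1 of_)) cE => par.
  move: le; rewrite leq_eqVlt => /predU1P[E|//].
  by move: par; rewrite E /=; case: (odd _).
pose r u v := cdec (together W u v).
have rP u v : reflect (together W u v) (r u v) by rewrite /r; apply/cdecP.
pose cl u := [set v in W | r u v].
have rr u : r u u by apply/rP; left.
have rsym u v : r u v -> r v u.
  by move/rP=> [->|h]; apply/rP; [left | right => k /h no' [h1 h2]; apply: no'].
have rtr u t v : u \in W -> t \in W -> v \in W -> r u t -> r t v -> r u v.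
  by move=> uW tW vW /rP h1 /rP h2; apply/rP; apply: together_trans h1 h2.
have rcl u v : u \in W -> v \in W -> r u v -> cl u = cl v.
  move=> uW vW ruv; apply/setP => x; rewrite !inE; case: (boolP (x \in W)) => //= xW.
  by apply/idP/idP => h; [apply: rtr (rsym _ _ ruv) h | apply: rtr ruv h].
have clC u x y : u \in W -> x \in cl u -> y \in W -> g x y -> y \in cl u.
  move=> uW; rewrite !inE => /andP[xW rux] yW gxy; rewrite yW /=; apply: rtr rux _ => //.
  have [->|xy] := eqVneq x y; first exact: rr.
  apply/rP; right=> h oh [hx hy]; move/negP: (optimal_nadj oh xW yW hx hy xy); apply; exact: gxy.
have mcl h u : optimal W h -> u \in W -> matching (cl u) h.
  move=> [mh _] uW x xu; have xW : x \in W by move: xu; rewrite inE => /andP[].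
  have [h1 h2 h3] := mh x xW; split=> //; have [->//|hx] := eqVneq (h x) x.
  by apply: clC xu h1 (h3 hx).
have fcl h u : optimal W h -> u \in W -> #|fixed (cl u) h| <= 1.
  move=> oh uW; rewrite leqNgt; apply/negP => /card_gt1P[x [y [xF yF xy]]].
  move: xF yF; rewrite !in_fixed !inE => /andP[/andP[xW rx] /eqP hx] /andP[/andP[yW ry] /eqP hy].
  have /rP[E|no'] : r x y by apply: rtr (rsym _ _ rx) ry.
    by rewrite E eqxx in xy.
  by apply: (no' h oh).
(* An optimal matching that misses [u] restricts to the class of [u] and misses nothing else
   there. *)
have oddcl u : u \in W -> odd #|cl u|.
  move=> uW; have [h [oh hu]] := allm u uW; rewrite (matching_parity (mcl h u oh uW)).
  have : #|fixed (cl u) h| = 1.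
    apply/eqP; rewrite eqn_leq fcl //; apply/card_gt0P; exists u.
    by rewrite in_fixed inE uW rr hu eqxx.
  by move=> ->.
exists set0, [set cl u | u in W]; split.
- exact: sub0set.
- rewrite cards0 addn0 -(@card_in_imset _ _ cl); first by apply: subset_leq_card; apply/subsetP => C /imsetP[u + ->]; rewrite in_fixed => /andP[uW _]; apply: imset_f.
  move=> x y; rewrite !in_fixed => /andP[xW /eqP fx] /andP[yW /eqP fy] E.
  have : y \in cl x by rewrite E inE yW rr.
  by rewrite inE yW => /rP[//|/(_ f of_)]; case.
- move=> C /imsetP[u uW ->]; rewrite setD0; split; [by apply/subsetP => x; rewrite inE => /andP[] | exact: oddcl |].
  by move=> x y; apply: clC.
- move=> C D x /imsetP[u uW ->] /imsetP[v vW ->]; rewrite !inE => /andP[xW rux] /andP[_ rvx].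
  by apply: rcl => //; apply: rtr rux (rsym _ _ rvx).
Qed.
End TutteBerge.

(** * Odd paths *)

Section OddPaths.
Variables (T : finType) (e : rel T).
Hypotheses (es : symmetric e) (ei : irreflexive e).
Implicit Types (V A Y Z : {set T}) (c : T -> bool).

(* Two layers of copies of [V]; a vertex of [A] has only the copy in the layer of its colour. *)
Definition dbl V A c := [set x : T * bool | (x.1 \in V) && ((x.1 \in A) ==> (x.2 == c x.1))].

Definition dadj : rel (T * bool) := fun x y =>
  (x.2 == y.2) && e x.1 y.1 || (x.1 == y.1) && (x.2 != y.2).

Definition odd_path V A c (p : seq T) := exists x q,
  [/\ p = x :: q, path e x q, (q != [::]) && (x \in A) && (last x q \in A),
      odd (size q) = (c x == c (last x q)) &
      forall v, v \in p -> v \in V /\ (v \in A -> v = x \/ v = last x q)].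

Lemma dadj_sym : symmetric dadj.
Proof. by move=> x y; rewrite /dadj es; congr (_ || _); congr (_ && _); rewrite eq_sym. Qed.

(* If the copy of [a] in [A] is matched to a copy of [v] outside [A], then [a] is deleted and the other copy of [v]
   becomes its copy in the new [A]; odd paths ending in [v] are prolonged to [a]. *)
Lemma odd_paths m V A c f : A \subset V -> matching dadj (dbl V A c) f ->
  #|fixed (dbl V A c) f| + 2 * m <= #|A| ->
  exists ps, [/\ size ps = m, uniq (flatten ps) & forall p, p \in ps -> odd_path V A c p].
Proof.
have [n] := ubnP #|V|; elim: n V A c m => // n IH V A c [|m] ltn AV mf le; first by exists [::].
have [a aA fa] : exists2 a, a \in A & f (a, c a) != (a, c a).
  apply: NNPP => no; have sb : [set (a, c a) | a in A] \subset fixed (dbl V A c) f.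
    apply/subsetP => _ /imsetP[a aA ->]; rewrite in_fixed in_set /= (subsetP AV) // aA eqxx /=.
    by apply/negPn/negP => h; apply: no; exists a.
  have := subset_leq_card sb; rewrite card_in_imset; last by move=> a b _ _ [].
  by nlia.
have aW : (a, c a) \in dbl V A c by rewrite in_set /= (subsetP AV) // aA eqxx.
have [mf' fE _] := matching_del mf aW fa.
have [fW ff /(_ fa)] := mf _ aW; case fE0 : (f (a, c a)) fW mf' fE => [v b] fW mf' fE.
have /andP[/= vV vb] : (v \in V) && ((v \in A) ==> (b == c v)) by move: fW; rewrite in_set.
rewrite /dadj /= => /orP[/andP[/eqP Eb eav]|/andP[/eqP Ev cb]]; last first.
  by move: vb cb; rewrite -Ev aA /= => /eqP->; rewrite eqxx.
subst b; have av : a != v by apply: contraTneq eav => ->; rewrite ei.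
have aV := subsetP AV a aA.
(* Two vertices of [A] with adjacent copies in one layer have the same colour, so the edge between
   them is an odd path by itself. *)
case: (boolP (v \in A)) vb => [vA /eqP cav|vA _].
  pose V' := V :\: [set a; v]; pose A' := A :\: [set a; v].
  have WE : dbl V' A' c = dbl V A c :\: [set (a, c a); (v, c a)].
    apply/setP => -[u b]; rewrite !inE !xpair_eqE /=.
    have [->|ua] := eqVneq u a; first by rewrite aA aV; case: (b == c a); case: (a == v).
    have [->|uv] := eqVneq u v; last by rewrite /=.
    by rewrite vA vV cav; case: (b == c v).
  have cA : #|A'| + 2 = #|A|.
    have := cardsID [set a; v] A; rewrite (setIidPr _); last by apply/subsetP => u; rewrite !inE => /orP[]/eqP->.
    by rewrite cards2 av /A'; nlia.
  have ltV : #|V'| < n.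
    have : #|V'| < #|V|.
      by apply: proper_card; apply/properP; split; [exact: subsetDl | exists a; rewrite // !inE eqxx].
    by move: ltn; nlia.
  have [||ps [sp up hp]] := IH V' A' c m ltV (setSD _ AV).
  - by rewrite WE.
  - by rewrite WE fE; nlia.
  have hp' p u : p \in ps -> u \in p -> u \in V' by move=> /hp[x [q [_ _ _ _ h]]] /h[].
  have nfl u : u \in [set a; v] -> u \notin flatten ps.
    by move=> h; apply/negP => /flattenP[p pps /(hp' _ _ pps)]; rewrite inE h.
  exists ([:: a; v] :: ps); split; first by rewrite /= sp.
    by rewrite /= inE negb_or av !nfl ?inE ?eqxx ?orbT.
  move=> p; rewrite inE => /predU1P[->|pps].
    exists a, [:: v]; split=> //=; rewrite ?eav ?aA ?vA ?cav ?eqxx //.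
    by move=> u; rewrite !inE => /orP[]/eqP->; split; auto.
  have [x [q [pE pq /andP[/andP[qn xA] lA] par h]]] := hp p pps; exists x, q; split=> //.
    by rewrite qn; move: xA lA; rewrite !inE => /andP[_ ->] /andP[_ ->].
  move=> u up'; have [uV uA] := h u up'; split; first by move: uV; rewrite inE => /andP[].
  by move=> uA0; apply: uA; rewrite inE uA0 andbT; move: uV; rewrite inE => /andP[].
(* The surviving copy of [v] lies in the layer opposite to [a]. With this colour, prolonging a path
   by the edge from [v] to [a] changes length and end colour together, so it stays odd. *)
pose V' := V :\ a; pose A' := v |: (A :\ a); pose c' u := if u == v then ~~ c a else c u.
have WE : dbl V' A' c' = dbl V A c :\: [set (a, c a); (v, c a)].
  apply/setP => -[u b]; rewrite !inE !xpair_eqE /c' /=.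
  have [->|ua] := eqVneq u a; first by rewrite aA aV (negbTE av) /=; case: (b == c a).
  have [->|uv] := eqVneq u v; last by rewrite /=.
  by rewrite (negbTE vA) vV; case: b; case: (c a).
have cA : #|A'| = #|A|.
  by rewrite /A' cardsU1 inE (negbTE vA) andbF /= [RHS](cardsD1 a) aA.
have ltV : #|V'| < n by move: ltn; rewrite (cardsD1 a) aV.
have [|||ps [sp up hp]] := IH V' A' c' m.+1 ltV.
- by rewrite /A' subUset sub1set !inE eq_sym av vV setSD.
- by rewrite WE.
- by rewrite WE fE cA.
have hp' p u : p \in ps -> u \in p -> u \in V' by move=> /hp[x [q [_ _ _ _ h]]] /h[].
have afl : a \notin flatten ps.
  by apply/negP => /flattenP[p pps /(hp' _ _ pps)]; rewrite !inE eqxx.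
have AA' u : u \in V' -> u \in A -> u \in A' by rewrite !inE => /andP[-> _] ->; rewrite orbT.
have A'A u : u \in A' -> u != v -> u \in A by rewrite !inE => /predU1P[->|/andP[] //]; rewrite eqxx.
have A'V u : u \in A' -> u != a by rewrite !inE => /predU1P[->|/andP[] //]; rewrite eq_sym.
have keep p : p \in ps -> v \notin p -> odd_path V A c p.
  move=> pps vp; have [x [q [pE pq /andP[/andP[qn xA] lA] par h]]] := hp p pps; exists x, q.
  have xv : x != v by apply: contraNneq vp => <-; rewrite pE mem_head.
  have lv : last x q != v by apply: contraNneq vp => <-; rewrite pE mem_last.
  split=> //; first by rewrite qn !A'A.
    by move: par; rewrite /c' (negbTE xv) (negbTE lv).
  move=> u up'; have [uV uA] := h u up'; split; first by move: uV; rewrite inE => /andP[].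
  by move=> uA0; apply: uA; apply: AA'.
have [/flattenP[p pps vp]|vfl] := boolP (v \in flatten ps); last first.
  exists ps; split=> // p pps; apply: keep => //.
  by apply: contra vfl => vp; apply/flattenP; exists p.
have [x [q [pE pq /andP[/andP[qn xA] lA] par h]]] := hp p pps.
have [/splitPr pps'] := (pps); case: pps' sp up hp hp' afl keep pps => l1 l2 sp up hp hp' afl keep pps.
have upx : uniq (x :: q) by move: up; rewrite flatten_cat cat_uniq /= cat_uniq pE => /and3P[_ _ /and3P[]].
have xl : x != last x q.
  apply: contraTneq upx => E; case: q qn E {pE pq lA par h} => // z q _ /= E.
  by rewrite {1}E mem_last.
have oth p' : p' \in l1 ++ l2 -> v \notin p'.
  move=> p'l; apply/negP => vp'; move: up; have : perm_eq (flatten (l1 ++ p :: l2)) (p ++ flatten (l1 ++ l2)).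
    by rewrite !flatten_cat /= perm_catCA.
  move/perm_uniq=> ->; rewrite cat_uniq => /and3P[_ /hasPn/(_ v) hv _]; move: hv; rewrite vp => /(_ _)/negP; apply=> //.
  by apply/flattenP; exists p'.
suff [p' [pp' op']] : exists p', perm_eq p' (a :: p) /\ odd_path V A c p'.
  exists (l1 ++ p' :: l2); split; first by rewrite -sp !size_cat.
    have : perm_eq (flatten (l1 ++ p' :: l2)) (a :: flatten (l1 ++ p :: l2)).
      rewrite !flatten_cat /=; apply: perm_trans (_ : perm_eq _ (flatten l1 ++ (a :: p) ++ flatten l2)) _.
        by rewrite perm_cat2l perm_cat2r.
      by rewrite -(cat1s a p) -(cat1s a (_ ++ _)) -catA perm_catCA.
    by move/perm_uniq ->; rewrite cons_uniq afl up.
  move=> p0; rewrite mem_cat inE => /or3P[h0|/eqP->|h0] //; apply: keep;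
    by rewrite ?mem_cat ?inE ?h0 ?orbT // oth // mem_cat h0 ?orbT.
have [vx|vx] := eqVneq v x.
  subst x; have lv : last v q != v by rewrite eq_sym.
  exists (a :: p); split=> //; exists a, p; rewrite pE; split=> //.
  - by rewrite /= eav.
  - by rewrite /= aA A'A.
  - by rewrite /= par /c' eqxx (negbTE lv); case: (c a); case: (c _).
  - move=> u; rewrite inE => /predU1P[->|up']; first by split; [|left].
    have [|uV uA] := h u; first by rewrite pE.
    split=> [|uA0]; first by move: uV; rewrite inE => /andP[].
    case: (uA (AA' u uV uA0)) => [ux|->]; last by right.
    by move: vA; rewrite -ux uA0.
have vl : v = last x q.
  by have [_ hv] := h v vp; case: (hv (setU11 _ _)) => // E; rewrite E eqxx in vx.
exists (x :: rcons q a); split.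
  by rewrite -rcons_cons pE perm_rcons.
exists x, (rcons q a); rewrite last_rcons size_rcons rcons_path pq -vl es eav; split=> //.
- by rewrite aA andbT A'A 1?eq_sym // andbT; case: (q).
- by rewrite /= par -vl /c' eqxx (eq_sym x v) (negbTE vx); case: (c a); case: (c _).
- move=> u; rewrite -rcons_cons mem_rcons inE => /predU1P[->|up']; first by split; [|right].
  have [|uV uA] := h u; first by rewrite pE.
  split=> [|uA0]; first by move: uV; rewrite inE => /andP[].
  case: (uA (AA' u uV uA0)) => [ux|ul]; first by left.
  by move: vA; rewrite vl -ul uA0.
Qed.

(** A Tutte-Berge set of the layered graph yields the bipartition: each odd component gets a
    representative, all but few vertices have a representative copy, and its layer is the colour.
    High connectivity excludes vertices that keep both copies. *)
Lemma odd_hit m V A c f : A \subset V -> optimal dadj (dbl V A c) f ->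
  #|A| < #|fixed (dbl V A c) f| + 2 * m -> 2 * m < #|A| ->
  (forall Z, #|Z| <= 2 * m -> forall x y, x \in V :\: Z -> y \in V :\: Z -> connect (ind e (V :\: Z)) x y) ->
  exists Y, #|Y| < 2 * m /\ exists col : T -> bool, forall x y, x \in V :\: Y -> y \in V :\: Y -> e x y -> col x != col y.
Proof.
move=> AV of_ lt bigA conn; have [U [Cs [UW cU hC dis]]] := tutte_berge dadj_sym of_.
set W := dbl V A c in of_ lt UW cU hC.
have WE v b : ((v, b) \in W) = (v \in V) && ((v \in A) ==> (b == c v)) by rewrite in_set.
pose f0 (x : T * bool) := (x.1, ~~ x.2).
have f0K x : f0 (f0 x) = x by case: x => v b; rewrite /f0 /= negbK.
have f0n x : f0 x != x by case: x => v []; rewrite xpair_eqE /= andbF.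
have f0a x : dadj x (f0 x) by rewrite /dadj /= eqxx; case: (x.2); rewrite ?orbT.
(* The copies whose twin is missing. Every odd component contains one, since otherwise exchanging
   twins would match it perfectly. *)
pose Sg := [set x in W :\: U | (x.1 \in A) || (f0 x \in U)].
have repC C : C \in Cs -> exists x, x \in C /\ x \in Sg.
  move=> CC; have [CW oC clC] := hC C CC; apply: NNPP => no.
  have nS x : x \in C -> [/\ x.1 \notin A, f0 x \notin U & x.1 \in V].
    move=> xC; have := subsetP CW x xC; have : x \notin Sg by apply/negP => xS; apply: no; exists x.
    rewrite [x \in Sg]in_set => + xW; rewrite xW /= negb_or => /andP[-> ->]; split=> //.
    by move: xW; rewrite inE => /andP[_]; case: (x) => v b; rewrite WE => /andP[].
  have : matching dadj C f0.
    move=> x xC; have [h1 h2 h3] := nS x xC; split=> //; apply: clC xC _ (f0a x).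
    by rewrite in_setD h2; rewrite /f0 WE h3 (negbTE h1).
  move/matching_parity; rewrite oC; suff -> : fixed C f0 = set0 by rewrite cards0.
  by apply/setP => x; rewrite in_fixed (negbTE (f0n x)) andbF inE.
have [C0 C0C] : exists C, C \in Cs by apply/card_gt0P; move: cU lt bigA; nlia.
have [x0 _] := repC C0 C0C.
have [rho hrho] := fchoice x0 repC.
pose Reps := rho @: Cs.
have cR : #|Reps| = #|Cs|.
  rewrite card_in_imset // => C D CC DC E; apply: (dis C D (rho C)) => //; first by case: (hrho C CC).
  by rewrite E; case: (hrho D DC).
have RS : Reps \subset Sg by apply/subsetP => x /imsetP[C CC ->]; case: (hrho C CC).
pose rem v := ((v, true) \in Reps) || ((v, false) \in Reps) || [&& v \notin A, (v, true) \notin U & (v, false) \notin U].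
pose Y := [set v in V | ~~ rem v].
pose U1 := [set x in U | (x.1 \notin A) && (f0 x \notin U)].
(* A vertex of [Y] is charged to a copy in [U :\: U1] or in [Sg :\: Reps]. As
   [#|Sg| <= #|A| + #|U1|], the term [#|U1|] cancels and [#|A| + #|U| - #|Cs|] remains. *)
have cY : #|Y| < 2 * m.
  have cSg : #|Sg| <= #|A| + #|U1|.
    have sb : Sg \subset [set (a, c a) | a in A] :|: f0 @: U1.
      apply/subsetP => -[v b]; rewrite in_set in_setU inE => /andP[/andP[vU vW] /=].
      have [vA _|vA /= fU] := boolP (v \in A).
        by move: vW; rewrite WE vA /= => /andP[_ /eqP->]; rewrite imset_f.
      apply/orP; right; apply/imsetP; exists (f0 (v, b)); rewrite ?f0K //.
      by rewrite in_set fU /= vA f0K.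
    apply: leq_trans (subset_leq_card sb) _; apply: leq_trans (cardsU_le _ _) _.
    by apply: leq_add; apply: leq_imset_card.
  have sb : Y \subset [set x.1 | x in U :\: U1] :|: [set x.1 | x in Sg :\: Reps].
    apply/subsetP => v; rewrite in_set in_setU => /andP[vV]; rewrite /rem !negb_or => /andP[/andP[vt vf] h].
    have nR b : (v, b) \notin Reps by case: b.
    have inS b : (v, b) \in W -> (v, b) \notin U -> (v \in A) || ((v, ~~ b) \in U) -> v \in [set x.1 | x in Sg :\: Reps].
      by move=> h1 h2 h3; apply/imsetP; exists (v, b) => //; rewrite in_setD nR in_set in_setD h1 h2 /= h3.
    have inU b : (v, b) \in U -> (v, b) \notin U1 -> v \in [set x.1 | x in U :\: U1].
      by move=> h1 h2; apply/imsetP; exists (v, b) => //; rewrite in_setD h1 h2.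
    have [vA|vA] := boolP (v \in A).
      have vW : (v, c v) \in W by rewrite WE vV eqxx implybT.
      have [vU|vU] := boolP ((v, c v) \in U); last by rewrite (inS (c v)) ?vA ?orbT.
      by rewrite (inU (c v)) // in_set vU /= vA.
    have vW b : (v, b) \in W by rewrite WE vV (negbTE vA).
    move: h; rewrite vA /= negb_and !negbK => h.
    have [/andP[u1 u2]|h'] := boolP (((v, true) \in U) && ((v, false) \in U)).
      by rewrite (inU true) // in_set u1 /= vA u2.
    apply/orP; right; case/orP: h => h; [apply: (inS false) | apply: (inS true)] => //; rewrite ?h ?orbT //;
      by move: h'; rewrite h ?andbT.
  have := subset_leq_card sb; have := cardsU_le [set x.1 | x in U :\: U1] [set x.1 | x in Sg :\: Reps].
  have : #|[set x.1 | x in U :\: U1]| <= #|U :\: U1| := leq_imset_card _ _.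
  have : #|[set x.1 | x in Sg :\: Reps]| <= #|Sg :\: Reps| := leq_imset_card _ _.
  have := cardsID Reps Sg; rewrite (setIidPr RS).
  have U1U : U1 \subset U by apply/subsetP => x; rewrite inE => /andP[].
  have := cardsID U1 U; rewrite (setIidPr U1U); nlia.
exists Y; split=> //.
have remV v : v \in V :\: Y -> v \in V /\ rem v.
  by rewrite !inE => /andP[h vV]; move: h; rewrite vV negbK.
have hR x : x \in Reps -> exists2 C, C \in Cs & x \in C /\ x = rho C.
  by move=> /imsetP[C CC ->]; exists C; rewrite // (proj1 (hrho C CC)).
have CW C x : C \in Cs -> x \in C -> x \in W :\: U by move=> CC xC; have [h _ _] := hC C CC; apply: (subsetP h).
have ccl C x y : C \in Cs -> x \in C -> y \in W :\: U -> dadj x y -> y \in C.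
  by move=> CC xC; have [_ _ h] := hC C CC; apply: h.
have ccl' C x y : C \in Cs -> x \in W :\: U -> y \in W :\: U -> dadj x y -> (x \in C) = (y \in C).
  move=> CC xW yW xy; apply/idP/idP => h; first exact: ccl xy.
  by apply: ccl h xW _; rewrite // dadj_sym.
(* Otherwise both copies of [d] survive, in the same components. On a walk from [d] to [A] that
   avoids [Y] and the representative of such a component, this property is passed on, but a vertex
   of [A] has only one copy. *)
have single v : v \in V :\: Y -> ((v, true) \in Reps) || ((v, false) \in Reps).
  move=> dV; have [vV] := remV v dV; case/orP=> // /and3P[vA vt vf]; exfalso; move: v dV vV vA vt vf => d dVY dV dA dt df.
  have dW b : (d, b) \in W :\: U by rewrite in_setD WE dV (negbTE dA) andbT; case: b.
  pose Rd := [set w | [exists C in Cs, ((d, true) \in C) && (w == (rho C).1)]].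
  have cRd : #|Rd| <= 1.
    rewrite leqNgt; apply/negP => /card_gt1P[w [w' [/[!in_set]/existsP[C /and3P[CC dC /eqP wE]] /existsP[C' /and3P[CC' dC' /eqP wE']] ww]]].
    by move: ww; rewrite wE wE' (dis C C' (d, true)) // eqxx.
  have [a] : exists a, a \in A :\: (Y :|: Rd).
    by apply/card_gt0P; have := cardsD_ge A (Y :|: Rd); have := cardsU_le Y Rd; move: cRd cY bigA; nlia.
  rewrite in_setD => /andP[aYR aA].
  have dR : d \notin Rd.
    apply/negP; rewrite in_set => /existsP[C /and3P[CC _ /eqP E]]; have [_] := hrho C CC.
    rewrite in_set -E (negbTE dA) /= /f0 => /andP[_]; rewrite -E.
    by case: (rho C).2; rewrite /= ?(negbTE dt) ?(negbTE df).
  have c1 : connect (ind e (V :\: (Y :|: Rd))) d a.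
    apply: conn; first by have := cardsU_le Y Rd; move: cRd cY; nlia.
      by move: dVY; rewrite !in_setD in_setU negb_or dR => /andP[-> ->].
    by rewrite in_setD aYR (subsetP AV).
  pose Kd v := [/\ v \in V, v \notin A, forall b, (v, b) \notin U & forall C, C \in Cs -> forall b, ((v, b) \in C) = ((d, true) \in C)].
  have [_ nA _ _] : Kd a; last by rewrite aA in nA.
  apply: (connect_inv (P := Kd) _ c1); last first.
    split=> // [b|C CC b]; first by case: b.
    by case: b => //; apply: ccl' => //; rewrite /dadj /= eqxx.
  move=> u w [uV uA uU uC] /and3P[euw _]; rewrite in_setD in_setU negb_or => /andP[/andP[wY wR] wV].
  have uW b : (u, b) \in W :\: U by rewrite in_setD uU WE uV (negbTE uA).
  have uw b : dadj (u, b) (w, b) by rewrite /dadj /= eqxx euw.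
  have nRw b : (w, b) \notin Reps.
    apply/negP => /hR[C CC [wC wE]]; move/negP: wR; apply; rewrite in_set; apply/existsP; exists C; rewrite CC -wE eqxx andbT /=.
    rewrite -(uC C CC b); rewrite (ccl' C (u, b) (w, b)) //; exact: CW wC.
  have [|_] := remV w; first by rewrite in_setD wY.
  rewrite /rem (negbTE (nRw true)) (negbTE (nRw false)) /= => /and3P[wA wt wf].
  have wU b : (w, b) \notin U by case: b.
  split=> // C CC b; rewrite -(uC C CC b); apply/esym; apply: ccl' => //.
  by rewrite in_setD wU WE wV (negbTE wA).
(* Adjacent vertices represented in the same layer would lie in one component, which has a single
   representative. *)
exists (fun v => (v, true) \in Reps) => v w vV wV evw; apply/eqP => E.
have [b [vR wR]] : exists b, (v, b) \in Reps /\ (w, b) \in Reps.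
  have := single v vV; have := single w wV; rewrite -E; have [h|h] /= := boolP ((v, true) \in Reps).
    by exists true; rewrite -E h.
  by exists false.
have [C CC [vC vE]] := hR _ vR; have [D DC [wD wE]] := hR _ wR.
have wC : (w, b) \in C by apply: (ccl C (v, b)) => //; [exact: CW wD | rewrite /dadj /= eqxx evw].
have CD := dis C D _ CC DC wC wD; move: vE wE; rewrite CD => <- [Ew].
by rewrite Ew ei in evw.
Qed.
End OddPaths.

(** * Odd cycles from linkages *)

Section Assembly.
Variables (T : finType) (e : rel T).
Hypotheses (es : symmetric e) (ei : irreflexive e).
Variable c : T -> bool.
Implicit Types (U D X S : {set T}) (x y v : T) (p q : seq T).

Definition cross : rel T := fun x y => e x y && (c x != c y).

(** Whether the parity of the path contradicts the colours of its ends. This is additive under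
    concatenation, vanishes on properly coloured paths, and is the parity of the length of a closed
    walk. *)
Definition bend x q := odd (size q) (+) (c x != c (last x q)).

Lemma cross_sym : symmetric cross.
Proof. by move=> x y; rewrite /cross es eq_sym. Qed.

Lemma bend_cat x q1 q2 : bend x (q1 ++ q2) = bend x q1 (+) bend (last x q1) q2.
Proof.
rewrite /bend size_cat oddD last_cat.
by case: (odd _); case: (odd _); case: (c x); case: (c (last x q1)); case: (c (last (last x q1) q2)).
Qed.

Lemma bend_cross x q : path cross x q -> bend x q = false.
Proof.
elim: q x => [|y q IH] x /=; first by rewrite /bend /= eqxx.
move=> /andP[/andP[_ cxy] /IH]; rewrite /bend /=.
by case: (odd _) => /=; move: cxy; case: (c x); case: (c y); case: (c _).
Qed.

Lemma crossing_path X D x y : x \in D -> connect (ind (off cross X) D) x y -> exists p,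
  [/\ path e x p, bend x p = false, uniq (x :: p), last x p = y & {subset x :: p <= D}].
Proof.
move=> xD /(connect_path xD)[p [pp up lp sp]].
have pc : path cross x p by apply: sub_path pp => u v /andP[].
by exists p; split=> //; [apply: sub_path pc => u v /andP[] | exact: bend_cross].
Qed.

Lemma close_cycle X D x q : path e x q -> uniq (x :: q) -> q != [::] -> bend x q ->
  last x q \in D -> connect (ind (off cross X) D) (last x q) x ->
  (forall v, v \in x :: q -> v \in D -> v = x \/ v = last x q) ->
  exists C, [/\ is_cycle e C, odd (size C), {subset x :: q <= C} & forall v, v \in C -> v \in x :: q \/ v \in D].
Proof.
move=> pq uq qn bq lD cn dis; have [p [pp bp up lp sp]] := crossing_path lD cn.
have xl : x != last x q.
  by apply: contraTneq uq => E; case: q qn E {pq bq lD cn dis pp bp up lp sp} => // z q _ /= E; rewrite {1}E mem_last.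
case/lastP: p pp bp up lp sp => [|p z] pp bp up lp sp; first by rewrite /= in lp; rewrite lp eqxx in xl.
rewrite last_rcons in lp; subst z.
have od : odd (size (x :: q ++ p)).
  have : bend x (q ++ rcons p x) by rewrite bend_cat bq bp.
  by rewrite /bend last_cat last_rcons eqxx addbF /= !size_cat size_rcons addnS.
have uC : uniq (x :: q ++ p).
  rewrite -cat_cons cat_uniq uq /=; move: up; rewrite /= mem_rcons inE negb_or rcons_uniq => /and3P[/andP[_ lnp] xp ->].
  rewrite andbT; apply/hasPn => v vp; apply/negP => vq.
  have vD : v \in D by apply: sp; rewrite inE mem_rcons inE vp !orbT.
  by case: (dis v vq vD) => E; [rewrite E (negbTE xp) in vp | rewrite E (negbTE lnp) in vp].
exists (x :: q ++ p); split=> //.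
- split=> //; last by rewrite /= rcons_cat cat_path pq.
  by move: od; case: (q) qn => // z q1 _ /=; case: (q1 ++ p).
- by move=> v vq; rewrite -cat_cons mem_cat vq.
move=> v; rewrite -cat_cons mem_cat => /orP[|vp]; [by left | right; apply: sp].
by rewrite inE mem_rcons inE vp !orbT.
Qed.

Lemma join_paths X D x q x' q' : path e x q -> uniq (x :: q) -> path e x' q' -> uniq (x' :: q') ->
  last x q \in D -> connect (ind (off cross X) D) (last x q) x' ->
  (forall v, v \in x :: q -> v \in x' :: q' -> False) ->
  (forall v, v \in x :: q -> v \in D -> v = last x q) ->
  (forall v, v \in x' :: q' -> v \in D -> v = x') ->
  exists r, [/\ path e x r, uniq (x :: r), bend x r = bend x q (+) bend x' q', last x r = last x' q'
     & {subset x :: q <= x :: r} /\ forall v, v \in x :: r -> (v \in x :: q) \/ (v \in x' :: q') \/ (v \in D)].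
Proof.
move=> pq uq pq' uq' lD cn dis d1 d2; have [p [pp bp up lp sp]] := crossing_path lD cn.
have nl : last x q != x'.
  by apply/eqP => E; apply: (dis (last x q)); [exact: mem_last | rewrite E mem_head].
have xp : x' \in p by move: (mem_last (last x q) p); rewrite lp inE eq_sym (negbTE nl).
have lnp : last x q \notin p by case/andP: up.
exists (q ++ p ++ q'); split.
- by rewrite !cat_path pq pp lp pq'.
- have up' : uniq p by case/andP: up.
  rewrite -cat_cons cat_uniq uq [uniq (p ++ q')]cat_uniq up'.
  have uq2 : uniq q' by case/andP: uq'.
  have xq' : x' \notin q' by case/andP: uq'.
  rewrite uq2 !andTb andbT; apply/andP; split.
    apply/hasPn => v; rewrite mem_cat => /orP[vp|vq']; apply/negP => vq.
      have vD : v \in D by apply: sp; rewrite inE vp orbT.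
      by rewrite (d1 v vq vD) (negbTE lnp) in vp.
    by apply: (dis v vq); rewrite inE vq' orbT.
  apply/hasPn => v vq'; apply/negP => vp.
  have E : v = x' by apply: d2; [rewrite inE vq' orbT | apply: sp; rewrite inE vp orbT].
  by rewrite E (negbTE xq') in vq'.
- by rewrite !bend_cat bp lp.
- by rewrite !last_cat lp.
split=> v; rewrite -cat_cons; first by rewrite mem_cat => ->.
rewrite !mem_cat => /or3P[h|h|h]; [by left | right; right | right; left].
  by apply: sp; rewrite inE h orbT.
by rewrite inE h orbT.
Qed.

Definition rail U x q := [/\ path e x q, uniq (x :: q), q != [::], (x \in U) && (last x q \in U) &
  forall v, v \in x :: q -> v \in U -> v = x \/ v = last x q].

Lemma rail_ends U x q : rail U x q -> x != last x q.
Proof.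
case=> _ uq qn _ _; apply: contraTneq uq => E; case: q qn E => // z q _ /= E.
by rewrite {1}E mem_last.
Qed.

(* A rail [x :: q] that is not bent is completed to an odd cycle with the help of the bent rail [x' :: q']. *)
Lemma assemble (k : nat) U S (x x' : 'I_k -> T) (q q' : 'I_k -> seq T) :
  (forall X, X \subset U -> #|X| <= 4 * k -> @linked T ('I_k * bool)%type U cross X) ->
  (forall i, rail U (x i) (q i) /\ has (mem S) (x i :: q i)) ->
  (forall i, ~~ bend (x i) (q i) -> rail U (x' i) (q' i) /\ bend (x' i) (q' i)) ->
  (forall i j v, v \in x i :: q i -> v \in x j :: q j -> i = j) ->
  (forall i j v, ~~ bend (x j) (q j) -> v \in x i :: q i -> v \in x' j :: q' j -> False) ->
  (forall i j v, v \in x' i :: q' i -> v \in x' j :: q' j -> ~~ bend (x i) (q i) -> ~~ bend (x j) (q j) -> i = j) ->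
  exists cs : 'I_k -> seq T, (forall i, odd_S_cycle e S (cs i)) /\
    (forall i j, i != j -> forall v, v \in cs i -> v \notin cs j).
Proof.
move=> lk hF hP dFF dFP dPP.
pose tB i := ~~ bend (x i) (q i).
pose P : {set 'I_k * bool} := [set t | t.2 || tB t.1].
(* Connection [(i, true)] leads from the end of rail [i] to its own start if the rail is bent, and
   to the start of its partner otherwise; in the latter case [(i, false)] returns from the end of
   the partner to the start of the rail. *)
pose w (t : 'I_k * bool) (b : bool) := if t.2 then (if b then last (x t.1) (q t.1) else if tB t.1 then x' t.1 else x t.1)
  else (if b then last (x' t.1) (q' t.1) else x t.1).
pose own i v := (v \in x i :: q i) || tB i && (v \in x' i :: q' i).
have ownE i j v : own i v -> own j v -> i = j.
  case/orP=> [h1|/andP[b1 h1]]; case/orP=> [h2|/andP[b2 h2]]; [exact: dFF h1 h2 | | |].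
  - by case: (dFP i j v b2 h1 h2).
  - by case: (dFP j i v b1 h2 h1).
  - exact: dPP h1 h2 b1 b2.
have wown t b : t \in P -> own t.1 (w t b).
  rewrite in_set /own /w; case: (t.2) b => -[] //= tb; rewrite ?mem_last //.
  - by case: (boolP (tB t.1)) => /= _; rewrite mem_head ?orbT.
  - by rewrite tb orbT.
  - by rewrite mem_head.
have wU t b : t \in P -> w t b \in U.
  rewrite in_set /w; have [[_ _ _ /andP[h1 h2] _] _] := hF t.1.
  case: (t.2) b => -[] //= tb; first by case: (boolP (tB t.1)) => // tb'; have [[_ _ _ /andP[]]] := hP _ tb'.
  by have [[_ _ _ /andP[]]] := hP _ tb.
have dw : distinct P w.
  move=> [i b] [j b'] s s' tP tP' E.
  have ij : i = j by apply: (ownE i j (w (i, b) s)); [exact: (wown (i, b)) | rewrite E; exact: (wown (j, b'))].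
  subst j; have xl : x i != last (x i) (q i) by have [h _] := hF i; exact: rail_ends h.
  have xl' : tB i -> x' i != last (x' i) (q' i) by move=> tb; have [h _] := hP i tb; exact: rail_ends h.
  have FP a a' : tB i -> a \in x i :: q i -> a' \in x' i :: q' i -> a != a'.
    by move=> tb h1 h2; apply/eqP => E'; apply: (dFP i i a tb h1); rewrite E'.
  move: tP tP' E; rewrite !in_set /w /=; case: b b' s s' => -[] [] [] //=.
  + by move=> _ _ E; case: (boolP (tB i)) E => tb E; [case/eqP: (FP _ _ tb (mem_last (x i) (q i)) (mem_head (x' i) (q' i))) | case/eqP: xl].
  + by move=> _ _ E; case: (boolP (tB i)) E => tb E; [case/eqP: (FP _ _ tb (mem_last (x i) (q i)) (mem_head (x' i) (q' i))) | case/eqP: xl].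
  + by move=> _ tb E; case/eqP: (FP _ _ tb (mem_last (x i) (q i)) (mem_last (x' i) (q' i))).
  + by move=> _ tb E; case/eqP: xl.
  + by move=> _ tb; rewrite tb => E; case/eqP: (xl' tb).
  + by move=> _ tb; rewrite tb => E; case/eqP: (FP _ _ tb (mem_head (x i) (q i)) (mem_head (x' i) (q' i))).
  + by move=> tb _ E; case/eqP: (FP _ _ tb (mem_last (x i) (q i)) (mem_last (x' i) (q' i))).
  + by move=> tb _; rewrite tb => E; case/eqP: (xl' tb).
  + by move=> tb _ E; case/eqP: xl.
  + by move=> tb _; rewrite tb => E; case/eqP: (FP _ _ tb (mem_head (x i) (q i)) (mem_head (x' i) (q' i))).
  + by move=> tb _ E; case/eqP: (FP _ _ tb (mem_head (x i) (q i)) (mem_last (x' i) (q' i))).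
  + by move=> tb _ E; case/eqP: (FP _ _ tb (mem_head (x i) (q i)) (mem_last (x' i) (q' i))).
have [|||D [[D1 D2 D3 D4] D5]] := lk (terms P w) _ _ P w _ dw.
- by apply/subsetP => v /termsP[t [b [tP ->]]]; apply: wU.
- rewrite card_terms //; have : #|P| <= k * 2.
    by apply: leq_trans (max_card _) _; rewrite card_prod card_ord card_bool.
  by nlia.
- by move=> t b tP; apply: terms_in.
have Ddis t t' v : t \in P -> t' \in P -> v \in D t -> v \in D t' -> t = t'.
  move=> tP tP' h1 h2; apply/eqP/negPn/negP => tt; have /disjoint_setI0/setP/(_ v) := D4 t t' tP tP' tt.
  by rewrite !inE h1 h2.
have DU t v : t \in P -> v \in D t -> v \in U by move=> tP; apply: (subsetP (D1 t tP)).
have PT i : (i, true) \in P by rewrite in_set.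
have PF i : tB i -> (i, false) \in P by move=> tb; rewrite in_set /= tb.
have endF i v : v \in x i :: q i -> v \in U -> v = x i \/ v = last (x i) (q i).
  by have [[_ _ _ _ h] _] := hF i; apply: h.
have endP i v : tB i -> v \in x' i :: q' i -> v \in U -> v = x' i \/ v = last (x' i) (q' i).
  by move=> tb; have [[_ _ _ _ h] _] := hP i tb; apply: h.
have lF i : last (x i) (q i) \in D (i, true) by apply: (D2 (i, true) true).
have ownT i v : own i v -> v \in U -> v \in terms P w.
  case/orP=> [vF|/andP[tb vP]] vU.
    case: (endF i v vF vU) => ->; last by apply: (terms_in w true (PT i)).
    have [tb|tb] := boolP (tB i); first by apply: (terms_in w false (PF i tb)).
    by have := terms_in w false (PT i); rewrite /w /= (negbTE tb).
  case: (endP i v tb vP vU) => ->; last by apply: (terms_in w true (PF i tb)).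
  by have := terms_in w false (PT i); rewrite /w /= tb.
have ownD i t v : own i v -> t \in P -> v \in D t -> t.1 = i.
  move=> ov tP vD; have [b vE] := D5 t v tP vD (ownT i v ov (DU t v tP vD)).
  by apply: (ownE _ _ v) => //; rewrite vE wown.
have cyc i : exists C, odd_S_cycle e S C /\ forall v, v \in C -> own i v \/ exists b, (i, b) \in P /\ v \in D (i, b).
  have [[pF uF nF _ _] sF] := hF i; have cT := D3 (i, true) (PT i).
  have hasS C : {subset x i :: q i <= C} -> has (mem S) C.
    by move=> sub; have /hasP[v vq vS] := sF; apply/hasP; exists v; rewrite ?sub.
  have [tb|tb] := boolP (tB i); last first.
    have [||C [cC oC sC hC]] := @close_cycle (terms P w) (D (i, true)) (x i) (q i) pF uF nF (negbNE tb) (lF i) _ _.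
    - by move: cT; rewrite /w /= (negbTE tb).
    - by move=> v vF vD; apply: endF; rewrite // (DU _ _ (PT i)).
    exists C; split; first by split=> //; apply: hasS.
    by move=> v /hC[h|h]; [left; rewrite /own h | right; exists true].
  have [[pP uP nP _ _] bP] := hP i tb; have cF := D3 (i, false) (PF i tb).
  have noTF v : v \in D (i, true) -> v \in D (i, false) -> False.
    by move=> h1 h2; have := Ddis _ _ v (PT i) (PF i tb) h1 h2.
  have xD : x i \in D (i, false) by apply: (D2 (i, false) false (PF i tb)).
  have lP : last (x' i) (q' i) \in D (i, false) by apply: (D2 (i, false) true (PF i tb)).
  have x'D : x' i \in D (i, true) by have := D2 (i, true) false (PT i); rewrite /w /= tb.
  have [|||r [pr ur br lr [sr hr]]] := @join_paths (terms P w) (D (i, true)) (x i) (q i) (x' i) (q' i) pF uF pP uP (lF i) _ (fun v => dFP i i v tb) _ _.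
  - by move: cT; rewrite /w /= tb.
  - by move=> v vF vD; case: (endF i v vF (DU _ _ (PT i) vD)) => // E; case: (noTF (x i)) => //; rewrite -E.
  - by move=> v vP vD; case: (endP i v tb vP (DU _ _ (PT i) vD)) => // E; case: (noTF v) => //; rewrite E.
  have [|||||C [cC oC sC hC]] := @close_cycle (terms P w) (D (i, false)) (x i) r pr ur.
  - apply: contraTneq uP => r0; move: lr; rewrite r0 /= => E.
    by case: (dFP i i (x i) tb (mem_head _ _)); rewrite E mem_last.
  - by rewrite br bP (negbTE tb).
  - by rewrite lr.
  - by rewrite lr; move: cF; rewrite /w.
  - move=> v /hr[vF|[vP|vD]] vD'; last by case: (noTF v).
      case: (endF i v vF (DU _ _ (PF i tb) vD')) => E; first by left.
      by case: (noTF v) => //; rewrite E.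
    rewrite lr; case: (endP i v tb vP (DU _ _ (PF i tb) vD')) => E; last by right.
    by case: (noTF v) => //; rewrite E.
  exists C; split; first by split=> //; apply: hasS => v /sr; apply: sC.
  move=> v /hC[/hr[h|[h|h]]|h]; [left; rewrite /own h | left | right; exists true | right; exists false] => //.
    by rewrite /own tb h orbT.
  by split=> //; apply: PF.
have [cs hcs] := fchoice [::] (fun i (_ : True) => cyc i).
exists cs; split=> [i|i j ij v vi]; first by case: (hcs i I).
apply/negP => vj; move/eqP: ij; apply.
have [_ /(_ v vi) hi] := hcs i I; have [_ /(_ v vj) hj] := hcs j I.
case: hi hj => [oi|[b [bP vD]]] [oj|[b' [bP' vD']]].
- exact: ownE oi oj.
- exact/esym/(ownD i _ v oi bP' vD').
- exact: (ownD j _ v oj bP vD).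
- by have [] := Ddis _ _ v bP bP' vD vD'.
Qed.
End Assembly.

(** * Linked subsets of a maximum cut *)

Section Cut.
Variables (T : finType).
Implicit Types (e g : rel T) (A B U V X Y Z S : {set T}) (c : T -> bool).

Lemma massed_of_conn lam V g X : 2 * lam * #|V :\: X| < R V g (V :\: X) ->
  (forall A B, sepn V g A B -> #|A :&: B| < #|X| -> A \subset B \/ B \subset A) -> massed lam V g X.
Proof.
move=> M1 h; split=> // A B sAB XA c; case: (h A B sAB c) => [AB|BA].
  by move: c; rewrite (setIidPl AB) ltnNge subset_leq_card.
by move: BA; rewrite -setD_eq0 => /eqP->; rewrite R_set0.
Qed.

Lemma superset_card X U m : X \subset U -> #|X| <= m -> m <= #|U| -> exists X', [/\ X \subset X', X' \subset U & #|X'| = m].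
Proof.
move=> XU cX cU; pose Q X' := [/\ X \subset X', X' \subset U & #|X'| <= m].
have [X' [[h1 h2 h3] mx]] : exists X', Q X' /\ forall X'', Q X'' -> #|X''| <= #|X'|.
  by apply: (@ex_max _ Q (fun X' => #|X'|) m) => [|Y []]; first by exists X.
exists X'; split=> //; apply/eqP; rewrite eqn_leq h3 leqNgt; apply/negP => lt.
have [v] : exists v, v \in U :\: X' by apply/card_gt0P; have := cardsID X' U; rewrite (setIidPr h2); nlia.
rewrite inE => /andP[vX vU]; have /mx : Q (v |: X').
  by split; [rewrite (subset_trans h1) ?subsetUr | rewrite subUset sub1set vU | rewrite cardsU1 vX].
by rewrite cardsU1 vX add1n ltnn.
Qed.

Lemma linked_sub (I : finType) V g X X' : X \subset X' -> @linked T I V g X' -> @linked T I V g X.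
Proof.
move=> XX lk P w wX dw; have [|D [[D1 D2 D3 D4] D5]] := lk P w _ dw.
  by move=> i b iP; apply: (subsetP XX); apply: wX.
exists D; split; last by move=> i v iP vD vX; apply: D5; rewrite // (subsetP XX).
split=> // i iP; apply: connect_mono (D3 i iP) => x y /and3P[/andP[gxy nX] xD yD].
by rewrite /= /off gxy xD yD !andbT; apply: contra nX => /andP[xX yX]; rewrite !(subsetP XX).
Qed.

Lemma deg_sum V X g : X \subset V -> \sum_(u in X) #|nb g V u| <= R V g X.
Proof.
move=> XV; rewrite (eq_bigr (fun u => #|setX [set u] (nb g V u)|)); last by move=> u _; rewrite cardsX cards1 mul1n.
rewrite -card_bigcup_disj; last first.
  by move=> u u' [x y] _ _; rewrite !in_setX !in_set1 /= => /andP[/eqP<- _] /andP[/eqP-> _].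
apply: subset_leq_card; apply/subsetP => -[x y] /bigcupP[u uS]; rewrite in_setX in_set1 /= in_nb.
by move=> /and3P[/eqP-> yV exy]; rewrite in_set /= uS yV exy (subsetP XV).
Qed.

Lemma R_del U g v : symmetric g -> R U g U <= R (U :\ v) g (U :\ v) + 2 * #|nb g U v|.
Proof.
move=> gs; apply: leq_trans (_ : #|[set p : T * T | [&& p.1 \in U :\ v, p.2 \in U :\ v, g p.1 p.2 & (p.1 \in U :\ v) || (p.2 \in U :\ v)]] :|: setX [set v] (nb g U v) :|: setX (nb g U v) [set v]| <= _).
  apply: subset_leq_card; apply/subsetP => -[x y]; rewrite in_set /= => /and4P[xU yU gxy _].
  rewrite !in_setU !in_setX !in_set1 !in_nb in_set /= !in_setD1 xU yU gxy !andbT /=.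
  have [E|xv] := eqVneq x v; first by rewrite -E gxy /= ?orbT.
  by have [E|yv] := eqVneq y v; rewrite /= ?orbT // -E gs gxy.
apply: leq_trans (cardsU_le _ _) _; have := cardsU_le [set p : T * T | [&& p.1 \in U :\ v, p.2 \in U :\ v, g p.1 p.2 & (p.1 \in U :\ v) || (p.2 \in U :\ v)]] (setX [set v] (nb g U v)).
rewrite !cardsX !cards1 /R; nlia.
Qed.

Lemma R_sepU U g A B : symmetric g -> sepn U g A B -> R U g U <= R A g A + R B g B.
Proof.
move=> gs sAB; have sBA := sepn_C gs sAB; have [UE _] := sAB.
apply: leq_trans (cardsU_le _ _); apply: subset_leq_card; apply/subsetP => -[x y].
rewrite in_set /= => /and4P[xU yU gxy _]; apply/setUP; rewrite !in_set /= gxy /=.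
have inn v : v \in U -> v \notin B -> v \in A by rewrite -UE inE => /orP[//|->].
case: (boolP (x \in B)) => xB; last first.
  have yA : y \in A by apply: (sepn_nb gs sBA _ yU gxy); rewrite inE xB inn.
  by left; rewrite inn // yA.
case: (boolP (y \in B)) => yB; first by right.
have xA : x \in A by apply: (sepn_nb gs sBA (x := y) _ xU); rewrite ?(inE, yB, inn) // gs.
by left; rewrite xA inn.
Qed.

Lemma R_delX U g X : R U g U <= R U g (U :\: X) + R X g X.
Proof.
apply: leq_trans (cardsU_le _ _); apply: subset_leq_card; apply/subsetP => -[x y].
rewrite in_set /= => /and4P[xU yU gxy _]; apply/setUP; rewrite !in_set /= xU yU gxy /=.
by case: (x \in X); case: (y \in X); [right | left | left | left].
Qed.

Lemma R_bip U g c : (forall x y, g x y -> c x != c y) -> 2 * R U g U <= #|U| ^ 2.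
Proof.
move=> gc; pose U0 b := [set x in U | c x == b].
have cU : #|U0 true| + #|U0 false| = #|U|.
  rewrite -(cardsID (U0 true) U); congr (_ + _); apply: eq_card => x; rewrite !inE.
    by case: (x \in U).
  by case: (x \in U) => //=; case: (c x).
have : R U g U <= #|setX (U0 true) (U0 false)| + #|setX (U0 false) (U0 true)|.
  apply: leq_trans (cardsU_le _ _); apply: subset_leq_card; apply/subsetP => -[x y].
  rewrite in_set /= => /and4P[xU yU gxy _]; rewrite in_setU !in_setX !in_set xU yU /=.
  by have := gc x y gxy; case: (c x); case: (c y).
rewrite !cardsX -cU => h; have [+ _] := nat_AGM2 #|U0 true| #|U0 false|.
by apply: leq_trans; move: h; rewrite [#|U0 false| * _]mulnC; nlia.
Qed.

(* Mader's argument: [U] is a smallest set with at least [5 * k] vertices and enough edges. *)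
Lemma cut_subset (k : nat) V g c : 0 < k -> symmetric g -> irreflexive g -> (forall x y, g x y -> c x != c y) ->
  V != set0 -> (forall x, x \in V -> 49 * k <= 2 * #|nb g V x|) ->
  exists U, [/\ U \subset V, 24 * k <= #|U| & forall (I : finType) X, X \subset U -> #|X| <= 4 * k -> @linked T I U g X].
Proof.
move=> k0 gs gi gc Vn deg.
have nbl U x : x \in U -> #|nb g U x| < #|U|.
  move=> xU; apply: proper_card; apply/properP; split; first by apply/subsetP => v; rewrite in_nb => /andP[].
  by exists x; rewrite ?in_nb ?gi ?andbF.
(* As [196 = 49 * 4], this asks for more than [49 * k * (#|U| - 4 * k) / 4] edges. The shift by
   [4 * k] absorbs the overlap when the bounds for the two sides of a separation of order below
   [4 * k] are added. *)
pose Q U := [/\ U \subset V, 5 * k <= #|U| & 49 * k * #|U| < 2 * R U g U + 196 * (k * k)].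
have [U [[UV c5 rU] minU]] : exists U, Q U /\ forall U', Q U' -> #|U| <= #|U'|.
  apply: (@ex_min _ Q (fun U => #|U|)); exists V; split=> //.
    by have [x xV] := set0Pn _ Vn; have := deg x xV; have := nbl V x xV; nlia.
  have : 49 * k * #|V| <= \sum_(u in V) 2 * #|nb g V u|.
    by rewrite mulnC -sum_nat_const; apply: leq_sum => x /deg.
  rewrite -big_distrr /=; have := deg_sum g (subxx V); have : 0 < k * k by rewrite muln_gt0 k0.
  nlia.
have small U' : U' \subset V -> 5 * k <= #|U'| -> #|U'| < #|U| -> 2 * R U' g U' + 196 * (k * k) <= 49 * k * #|U'|.
  move=> UV' c5' lt; rewrite leqNgt; apply/negP => h; have /minU : Q U' by [].
  by rewrite leqNgt lt.
(* A bipartite graph on [n] vertices has at most [n ^ 2 / 4] edges, and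
   [n ^ 2 - 49 * k * n + 196 * k ^ 2] is negative for [n] from [5 * k] to [44 * k]. *)
have big : 44 * k <= #|U|.
  have := R_bip U gc; move: c5 rU; clear; move: #|U| (R U g U) => n r; rewrite expnS expn1 => h1 h2 h3.
  rewrite leqNgt; apply/negP => lt.
  have : (n - 5 * k) * (44 * k - n) + 0 >= 0 by [].
  by nia.
exists U; split=> //; first by nlia.
move=> I X XU cX.
have [|X' [XX XU' cX']] := superset_card XU cX; first by nlia.
apply: (linked_sub XX); apply: (@massed_linked _ _ (2 * k) (12 * k)) => //; [by nlia | by nlia |].
(* Deleting [v] leaves enough vertices, so by minimality it must destroy the edge bound. *)
have mindeg v : v \in U -> 49 * k < 4 * #|nb g U v|.
  move=> vU; have := R_del U v gs; have cv : #|U| = #|U :\ v|.+1 by rewrite (cardsD1 v) vU.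
  have := small (U :\ v) (subset_trans (subsetDl _ _) UV) _ _.
  move=> /(_ _ _) h; have {h}h : 2 * R (U :\ v) g (U :\ v) + 196 * (k * k) <= 49 * k * #|U :\ v| by apply: h; nlia.
  by move: h rU; rewrite cv mulnS; nlia.
apply: massed_of_conn.
  have := R_delX U g X'; have := R_bip X' gc; rewrite cX' expnS expn1 => h1 h2.
  have cD : #|U :\: X'| + 4 * k = #|U| by have := cardsID X' U; rewrite (setIidPr XU') cX'; nlia.
  move: h1 h2 rU; rewrite -cD => h1 h2 h3; have : 40 * k <= #|U :\: X'| by nlia.
  move: h1 h2 h3; clear; move: #|U :\: X'| (R U g (U :\: X')) (R U g U) (R X' g X') => n r1 r2 r3; nia.
(* Each side contains a vertex with all its neighbours, hence at least [5 * k] vertices, and by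
   minimality it has few edges. The two bounds together contradict [rU]. *)
move=> A B sAB cAB; apply: NNPP => /not_or_and[/negP nAB /negP nBA].
have AU := sepn_subl sAB; have BU := sepn_subr sAB.
have side A' B' : sepn U g A' B' -> ~~ (A' \subset B') -> ~~ (B' \subset A') -> 2 * R A' g A' + 196 * (k * k) <= 49 * k * #|A'|.
  move=> s /subsetPn[a aA aB] /subsetPn[b bB bA]; have s' := sepn_C gs s; have AU' := sepn_subl s.
  apply: small; first exact: subset_trans AU' UV.
    have : nb g U a \subset nb g A' a.
      apply/subsetP => y; rewrite !in_nb => /andP[yU gay]; rewrite gay andbT.
      by apply: (sepn_nb gs s' _ yU gay); rewrite inE aB.
    by move/subset_leq_card; have := mindeg a (subsetP AU' a aA); have := nbl A' a aA; nlia.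
  by apply: proper_card; apply/properP; split=> //; exists b; rewrite // (subsetP (sepn_subr s)).
have h1 := side A B sAB nAB nBA; have h2 := side B A (sepn_C gs sAB) nBA nAB.
have h3 := R_sepU gs sAB; have UE : A :|: B = U by case: sAB.
have cU : #|A| + #|B| = #|U| + #|A :&: B| by rewrite -UE -cardsUI.
move: h1 h2 h3 cU rU cAB; rewrite cX'; clear; move: #|A| #|B| #|U| #|A :&: B| (R A g A) (R B g B) (R U g U) => a b u i ra rb ru.
by nia.
Qed.

Lemma max_cut V e : symmetric e -> irreflexive e -> exists c, forall x, x \in V -> #|nb e V x| <= 2 * #|nb (cross e c) V x|.
Proof.
move=> es ei; have [c [_ mx]] : exists c : T -> bool, True /\ forall c', True -> R V (cross e c') V <= R V (cross e c) V.
  by apply: (@ex_max _ (fun _ => True) (fun c => R V (cross e c) V) (#|{: T * T}|)); [exists xpred0 | move=> *; apply: max_card].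
exists c => x xV; rewrite leqNgt; apply/negP => lt.
pose c' v := if v == x then ~~ c v else c v.
have := mx c' I; rewrite leqNgt => /negP; apply.
have h1 := R_del V x (cross_sym es c).
pose old := [set p : T * T | [&& p.1 \in V :\ x, p.2 \in V :\ x, cross e c p.1 p.2 & (p.1 \in V :\ x) || (p.2 \in V :\ x)]].
have cE : #|nb e V x| = #|nb (cross e c) V x| + #|nb (cross e c') V x|.
  rewrite -(cardsID (nb (cross e c) V x) (nb e V x)); congr (_ + _); apply: eq_card => v; rewrite !inE /cross.
    by case: (v \in V); case: (e x v); case: (c x == c v).
  case: (v \in V) => //=; case exv : (e x v); rewrite ?andbF //= /c' eqxx.
  have -> : (v == x) = false by apply/eqP => E; rewrite E ei in exv.
  by case: (c x); case: (c v).
have h2 : #|old| + #|setX [set x] (nb (cross e c') V x)| + #|setX (nb (cross e c') V x) [set x]| <= R V (cross e c') V.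
  have nbx v : v \in nb (cross e c') V x -> v \in V :\ x /\ cross e c' x v.
    rewrite in_nb => /andP[vV cv]; rewrite !inE vV cv; split=> //; rewrite andbT.
    by apply: contraTneq cv => ->; rewrite /cross ei.
  rewrite /R; apply: card3_le.
  - apply/subsetP => -[u v]; rewrite [(u, v) \in old]in_set /= => /and4P[/setD1P[ux uV] /setD1P[vx vV] exy _].
    have exy' : e u v && (c u != c v) := exy.
    by rewrite in_set /= uV vV /cross /c' (negbTE ux) (negbTE vx) exy'.
  - apply/subsetP => -[u v]; rewrite in_setX in_set1 /= => /andP[/eqP-> /nbx[/setD1P[_ vV] cv]].
    by rewrite in_set /= xV vV cv.
  - apply/subsetP => -[v u]; rewrite in_setX in_set1 /= => /andP[/nbx[/setD1P[_ vV] cv] /eqP->].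
    by rewrite in_set /= xV vV cross_sym // cv.
  - apply/pred0P => -[u v] /=; apply/negP => /andP[]; rewrite [(u, v) \in old]in_set in_setX in_set1 /= in_setD1.
    by move=> /and4P[/andP[/negbTE-> _]].
  - apply/pred0P => -[u v] /=; apply/negP => /andP[]; rewrite !in_setX !in_set1 /= => /andP[_ /nbx[/setD1P[/negbTE vx _] _]] /andP[_].
    by rewrite vx.
  - apply/pred0P => -[u v] /=; apply/negP => /andP[]; rewrite [(u, v) \in old]in_set in_setX in_set1 /= !in_setD1.
    by move=> /and4P[_ /andP[/negbTE-> _] _ _]; rewrite andbF.
move: h1 h2 lt; rewrite cE !cardsX !cards1 -/old /R; rewrite -/(R V (cross e c) V) -/(R V (cross e c') V) -/old; nlia.
Qed.
End Cut.

(** * Rerouting paths *)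

Section Reroute.
Variables (T : finType).
Implicit Types (e r : rel T) (A U V X Y Z S : {set T}) (c : T -> bool) (p q : seq T) (ps : seq (seq T)).

(* The number of steps along a path that are not made inside one of the given odd paths; [reroute] minimizes it. *)
Fixpoint cost r x p : nat := if p is y :: p' then (~~ r x y) + cost r y p' else 0.

Lemma cost_cat r x p1 p2 : cost r x (p1 ++ p2) = cost r x p1 + cost r (last x p1) p2.
Proof. by elim: p1 x => //= y p1 IH x; rewrite IH addnA. Qed.

Lemma cost_free r x p : (forall u v, u \in x :: p -> v \in x :: p -> r u v) -> cost r x p = 0.
Proof.
elim: p x => //= y p IH x h; rewrite h ?inE ?eqxx ?orbT //=.
by apply: IH => u v uy vy; apply: h; rewrite inE ?uy ?vy orbT.
Qed.

Lemma cost_stay r (D : seq T) x p : (forall u v, u \in D -> r u v -> v \in D) -> cost r x p = 0 -> x \in D ->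
  last x p \in D.
Proof.
move=> cl; elim: p x => //= y p IH x; case rxy : (r x y) => //= c0 xD.
by apply: IH => //; apply: cl rxy.
Qed.

Lemma has_split (a : pred T) p : has a p -> exists p1 y p2, [/\ p = p1 ++ y :: p2, a y & ~~ has a p1].
Proof.
elim: p => //= x p IH; have [ax _|nax /= /IH[p1 [y [p2 [-> ay np]]]]] := boolP (a x).
  by exists [::], x, p.
by exists (x :: p1), y, p2; rewrite /= negb_or nax.
Qed.

Lemma flatten_eq ps p p' v : uniq (flatten ps) -> p \in ps -> p' \in ps -> v \in p -> v \in p' -> p = p'.
Proof.
elim: ps => //= h ps IH; rewrite cat_uniq => /and3P[_ /hasPn dis up]; rewrite !inE.
have out l : l \in ps -> v \in h -> v \in l -> False.
  by move=> lps vh vl; have /negP := dis v (introT flattenP (ex_intro2 _ _ l lps vl)); apply.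
case/predU1P=> [->|pps] /predU1P[->|pps'] // h1 h2; [by case: (out p') | by case: (out p) | exact: IH].
Qed.

Lemma flatten_uniq ps : uniq (flatten ps) -> [::] \notin ps -> uniq ps.
Proof.
elim: ps => //= h ps IH; rewrite cat_uniq inE negb_or => /and3P[_ /hasPn dis up] /andP[hn nps].
rewrite IH // andbT; apply/negP => hps; case: h hn dis hps => // v h _ dis hps.
have /negP := dis v (introT flattenP (ex_intro2 _ _ (v :: h) hps (mem_head _ _))); apply.
exact: mem_head.
Qed.

Lemma reroute e V U A ps : symmetric e -> uniq (flatten ps) ->
  (forall p, p \in ps -> exists x q, [/\ p = x :: q, path e x q, x \in U & forall v, v \in p -> v \in V /\ (v \in U -> v = x \/ v = last x q)]) ->
  (exists Q, (forall a, a \in A -> hits (ind e V) U a (Q a)) /\ disj_paths A Q) ->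
  exists Q, [/\ forall a, a \in A -> hits (ind e V) U a (Q a), disj_paths A Q &
    size [seq p <- ps | has (fun v => [exists a in A, v \in a :: Q a]) p] <= #|A|].
Proof.
move=> es ups hp exQ; pose same : rel T := fun u v => has (fun p => (u \in p) && (v \in p)) ps.
pose good Q := (forall a, a \in A -> hits (ind e V) U a (Q a)) /\ disj_paths A Q.
have [Q [[hQ dQ] minQ]] : exists Q, good Q /\ forall Q', good Q' -> \sum_(a in A) cost same a (Q a) <= \sum_(a in A) cost same a (Q' a).
  exact: ex_min.
exists Q; split=> //; set hitv := fun v => [exists a in A, v \in a :: Q a].
have onU a v : a \in A -> v \in a :: Q a -> v \in U -> v = last a (Q a).
  by move=> aA vQ vU; have [_ _ _ bQ] := hQ a aA; case: (belast_last vQ) => // /bQ; rewrite vU.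
have ends p : p \in ps -> has hitv p -> exists a, a \in A /\ last a (Q a) \in p.
  move=> pps hpp; apply: NNPP => no.
  have noend a y : a \in A -> y \in a :: Q a -> y \in p -> y \notin U.
    by move=> aA yQ yp; apply/negP => /(onU a y aA yQ) E; apply: no; exists a; rewrite -E.
  have [x [q [pE pq xU hU]]] := hp p pps; have [p1 [y [p2 [pE' hy np1]]]] := has_split hpp.
  (* [y] is the first vertex of [p] on any of the paths, so the piece of [p] before [y] is free to
     be used backwards by [Q a]. *)
  have /existsP[a /andP[aA yQ]] := hy.
  have yp : y \in p by rewrite pE' mem_cat mem_head orbT.
  have yU := noend a y aA yQ yp.
  case: p1 pE' np1 => [|x' p1] pE' np1.
    by move: pE'; rewrite pE => -[E _]; rewrite -E xU in yU.
  move: (pE'); rewrite pE => -[Ex qE]; subst x'.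
  have up : uniq p.
    by move: ups; have /splitPr[l1 l2] := pps; rewrite flatten_cat /= !cat_uniq => /and3P[_ _ /and3P[]].
  have nh v : v \in x :: p1 -> v \in p -> ~~ hitv v by move=> v1 _; apply: (hasPn np1).
  have p1p v : v \in x :: p1 -> v \in p by move=> h; rewrite pE' mem_cat h.
  have [pQ uQ lQ bQ] := hQ a aA.
  case/splitPl: {-1}(Q a) / yQ (erefl (Q a)) => m1 m2 ly QE.
  pose Q' b := if b == a then m1 ++ rev (x :: p1) else Q b.
  have Q'a : Q' a = m1 ++ rev (x :: p1) by rewrite /Q' eqxx.
  have prev : path e y (rev (x :: p1)).
    move: pq; rewrite qE -cat_rcons cat_path => /andP[h _].
    have := rev_path e x (rcons p1 y); rewrite last_rcons belast_rcons => ->.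
    by apply: sub_path h => u v; rewrite es.
  have yV : y \in V by have [] := hU y yp.
  have m1Q v : v \in a :: m1 -> v \in a :: Q a.
    by rewrite QE -cat_cons mem_cat => ->.
  have lx : last y (rev (x :: p1)) = x by rewrite rev_cons last_rcons.
  have hitsa : hits (ind e V) U a (Q' a).
    rewrite Q'a; split.
    - move: pQ; rewrite QE !cat_path ly => /andP[-> _] /=; apply: path_ind => // v.
      rewrite inE mem_rev => /predU1P[->//|/p1p/hU[]] //.
    - rewrite -cat_cons cat_uniq rev_uniq; move: uQ; rewrite QE -cat_cons cat_uniq => /and3P[-> _ _] /=.
      apply/andP; split; last by move: up; rewrite pE' cat_uniq => /andP[].
      apply/hasPn => v; rewrite mem_rev => v1; apply/negP => vm; move/negP: (nh v v1 (p1p v v1)); apply.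
      by apply/existsP; exists a; rewrite aA m1Q.
    - by rewrite last_cat ly lx.
    move=> v; rewrite belast_cat mem_cat ly => /orP[vb|].
      by apply: bQ; rewrite QE belast_cat mem_cat vb.
    rewrite rev_cons belast_rcons inE mem_rev => /predU1P[->//|v1]; apply/negP => vU.
    have vp : v \in p by apply: p1p; rewrite inE v1 orbT.
    have [_ /(_ vU)[E|E]] := hU v vp; move: up; rewrite pE' cat_uniq /=.
      by rewrite -E v1.
    move=> /and3P[_ /norP[y1 /hasPn h2] _]; move: E; rewrite qE last_cat /= => E.
    have : last y p2 \in y :: p2 by apply: mem_last.
    rewrite -E inE => /predU1P[Ev|/h2 /=]; last by rewrite inE v1 orbT.
    by move: y1; rewrite inE -Ev v1 orbT.
  have Q'v b v : b \in A -> v \in b :: Q' b -> v \in b :: Q b \/ b = a /\ v \in x :: p1.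
    move=> bA; rewrite /Q'; case: eqVneq => [->|_]; last by left.
    by rewrite -cat_cons mem_cat mem_rev => /orP[/m1Q|]; [left | right].
  have Q'n b v : b \in A -> v \in b :: Q b -> v \in x :: p1 -> False.
    move=> bA vb v1; move/negP: (nh v v1 (p1p v v1)); apply.
    by apply/existsP; exists b; rewrite bA.
  have gQ' : good Q'.
    split=> [b bA|b b' v bA bA' vb vb'].
      by have [->//|ba] := eqVneq b a; rewrite /Q' (negbTE ba); apply: hQ.
    case: (Q'v b v bA vb) => [v1|[-> v1]]; case: (Q'v b' v bA' vb') => [v2|[-> v2]] //.
    + exact: dQ v1 v2.
    + by case: (Q'n b v).
    + by case: (Q'n b' v).
  (* The new end piece stays on [p] and is free of charge, whereas the old one had to leave [p], on
     which no [Q a] ends. *)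
  have := minQ Q' gQ'; rewrite leqNgt => /negP; apply.
  rewrite (bigD1 a) //= [X in _ < X](bigD1 a) //= Q'a (eq_bigr (fun b => cost same b (Q b))); last first.
    by move=> b /andP[_ /negbTE ba]; rewrite /Q' ba.
  rewrite ltn_add2r QE !cost_cat ly ltn_add2l cost_free.
    rewrite lt0n; apply/eqP => c0; apply: no; exists a; split=> //.
    rewrite QE last_cat ly; apply: cost_stay c0 yp => u v uP /hasP[p' p'ps /andP[up' vp']].
    by rewrite (flatten_eq ups pps p'ps uP up').
  have sub u : u \in y :: rev (x :: p1) -> u \in p by rewrite inE mem_rev => /predU1P[->|/p1p].
  by move=> u v /sub up' /sub vp'; apply/hasP; exists p; rewrite ?up'.
set hs := [seq p <- ps | has hitv p].
have hE p : p \in hs -> exists a, a \in A /\ last a (Q a) \in p.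
  by rewrite mem_filter => /andP[h pps]; apply: ends.
have uhs : uniq hs.
  apply: filter_uniq; apply: flatten_uniq ups _; apply/negP => /hp[x [q []]] //.
case hsE : hs => [|p0 hs'] //; have [a0 _] := hE p0 (eq_ind_r (fun s => p0 \in s) (mem_head p0 hs') hsE).
have [f hf] := fchoice a0 hE; rewrite -hsE -(size_map f) cardE; apply: uniq_leq_size.
  rewrite map_inj_in_uniq // => p p' ph ph' E; have [_ l1] := hf p ph; have [_ l2] := hf p' ph'.
  move: ph ph'; rewrite !mem_filter => /andP[_ pps] /andP[_ pps'].
  by apply: flatten_eq ups pps pps' l1 _; rewrite E.
by move=> a /mapP[p ph ->]; rewrite mem_enum; case: (hf p ph).
Qed.

End Reroute.

(** * The two stages of the proof *)

Section Main.
Variables (T : finType) (e : rel T) (k : nat).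
Hypotheses (es : symmetric e) (ei : irreflexive e) (k0 : 0 < k) (ek : k_connected e (50 * k)).
Implicit Types (A U V X Y Z S : {set T}) (c : T -> bool).

Lemma conn_minus Z x y : #|Z| < 50 * k -> x \notin Z -> y \notin Z -> connect (ind e (~: Z)) x y.
Proof.
move=> cZ xZ yZ; have [_ h] := ek; apply: connect_mono (h Z cZ x y xZ yZ) => u v /and3P[euv uZ vZ].
by rewrite /= euv !in_setC uZ vZ.
Qed.

Lemma min_deg x : 50 * k <= #|nb e setT x|.
Proof.
have [cT _] := ek; rewrite leqNgt; apply/negP => lt.
have [y] : exists y, y \in ~: (x |: nb e setT x).
  by apply/card_gt0P; have := cardsC (x |: nb e setT x); have := cardsU_le [set x] (nb e setT x); rewrite cards1; nlia.
rewrite in_setC in_setU1 negb_or => /andP[yx yN].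
have xN : x \notin nb e setT x by rewrite in_nb ei andbF.
have /connectP[[|z p] /=] := conn_minus lt xN yN; first by move=> _ E; rewrite E eqxx in yx.
by move=> /andP[/and3P[exz _] + _] _; rewrite in_setC in_nb exz inE.
Qed.

Lemma deg_ge Z x : 50 * k <= #|nb e (~: Z) x| + #|Z|.
Proof.
apply: leq_trans (min_deg x) _; apply: leq_trans (cardsU_le _ _); apply: subset_leq_card.
by apply/subsetP => y; rewrite in_setU !in_nb !inE => /= ->; rewrite andbT orNb.
Qed.

Definition cycles S := exists cs : 'I_k -> seq T, (forall i, odd_S_cycle e S (cs i)) /\
  (forall i j, i != j -> forall v, v \in cs i -> v \notin cs j).

Lemma last_rev_belast (x : T) p : last (last x p) (rev (belast x p)) = x.
Proof. by case: p => //= z p; rewrite rev_cons last_rcons. Qed.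

Lemma stage1 S : k <= #|S| -> cycles S \/
  exists Y, #|Y| <= 7 * k /\ exists f : T -> bool, forall x y, x \notin Y -> y \notin Y -> e x y -> f x != f y.
Proof.
move=> kS; have [|S1 [_ S1S cS1]] := superset_card (sub0set S) _ kS; first by rewrite cards0.
pose V := ~: S1; have cT : 50 * k < #|T| by case: ek.
have cV : #|V| + #|S1| = #|T| by rewrite addnC /V cardsC.
have connV Z x y : #|Z| <= 6 * k -> x \in V :\: Z -> y \in V :\: Z -> connect (ind e (V :\: Z)) x y.
  move=> cZ xV yV; have E : V :\: Z = ~: (S1 :|: Z) by rewrite setCU setDE.
  have := cardsU_le S1 Z; rewrite E in xV yV *; move: xV yV; rewrite !in_setC => xV yV h.
  by apply: conn_minus => //; nlia.
have degV x : 49 * k <= #|nb e V x| by have := deg_ge S1 x; rewrite cS1 -/V; nlia.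
have [c hc] := max_cut V es ei.
have [||||U [UV cU lkU]] := @cut_subset T k V (cross e c) c k0 (cross_sym es c).
- by move=> x; rewrite /cross ei.
- by move=> x y /andP[].
- by rewrite -card_gt0; nlia.
- by move=> x xV; apply: leq_trans (degV x) (hc x xV).
have [x0 x0S] : exists x, x \in S1 by apply/card_gt0P; rewrite cS1.
pose s (i : 'I_k) := nth x0 (enum S1) i.
have sz : size (enum S1) = k by rewrite -cardE cS1.
have sS1 i : s i \in S1 by rewrite -mem_enum mem_nth // sz.
have si i j : s i = s j -> i = j.
  by move=> E; apply/val_inj/eqP; rewrite /= -(nth_uniq x0 (s := enum S1)) ?sz ?enum_uniq //; apply/eqP.
(* Two private neighbours of each [s i], where its two legs to [U] start. *)
have [|rho [rhoN rhoi]] := @greedy_sdr T ('I_k * bool)%type x0 setT (fun t => nb e V (s t.1)).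
  move=> t _; apply: leq_trans (degV _); rewrite cardsT card_prod card_ord card_bool; nlia.
have {}rhoi t t' : rho t = rho t' -> t = t' by apply: rhoi.
have rV t : rho t \in V /\ e (s t.1) (rho t) by apply/andP; rewrite -in_nb; apply: rhoN.
pose A := [set rho t | t in setT].
have cA : #|A| = 2 * k by rewrite card_imset ?cardsT ?card_prod ?card_ord ?card_bool 1?mulnC.
have AV : A \subset V by apply/subsetP => x /imsetP[t _ ->]; case: (rV t).
have rA t : rho t \in A by apply: imset_f.
have exQ : exists Q, (forall a, a \in A -> hits (ind e V) U a (Q a)) /\ disj_paths A Q.
  apply: menger; first exact: ind_sym.
  move=> Z sZ; rewrite cA leqNgt; apply/negP => ltZ.
  have [a /setDP[aA aZ]] : exists a, a \in A :\: Z by apply/card_gt0P; have := cardsD_ge A Z; nlia.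
  have [u /setDP[uU uZ]] : exists u, u \in U :\: Z by apply/card_gt0P; have := cardsD_ge U Z; nlia.
  move/negP: (sZ a u aA aZ uU uZ); apply.
  have : connect (ind e (V :\: Z)) a u.
    by apply: connV; [nlia | rewrite in_setD aZ (subsetP AV) | rewrite in_setD uZ (subsetP UV)].
  by apply: connect_mono => x y /and3P[exy /setDP[xV xZ] /setDP[yV yZ]]; rewrite /= exy xV yV !in_setC xZ yZ.
have [f of_] := optimal_ex (dadj e) (dbl V U c).
(* If the matching is too small for [3 * k] odd paths, fewer than [6 * k] vertices from [odd_hit]
   together with [S1] form the required set. *)
case: (leqP (#|fixed (dbl V U c) f| + 2 * (3 * k)) #|U|) => [le|lt]; last first.
  right; have [||Y [cY [col hcol]]] := @odd_hit T e es ei (3 * k) V U c f UV of_ lt.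
  - by nlia.
  - by move=> Z cZ x y; apply: connV; nlia.
  exists (Y :|: S1); split; first by have := cardsU_le Y S1; nlia.
  exists col => x y; rewrite !in_setU !negb_or => /andP[xY xS] /andP[yY yS]; apply: hcol; by rewrite !inE ?xY ?yY.
left; have [ps [sps ups hps]] := odd_paths es ei UV (proj1 of_) le.
have [|Q [hQ dQ szQ]] := reroute es ups _ exQ.
  move=> p /hps[x [q [pE pq /andP[/andP[_ xU] _] _ h]]]; by exists x, q.
pose hit (p : seq T) := has (fun v => [exists a in A, v \in a :: Q a]) p; pose us := [seq p <- ps | ~~ hit p].
have szu : k <= size us.
  have h : size [seq p <- ps | hit p] + size us = size ps by rewrite /us !size_filter; apply: count_predC.
  have {}szQ : size [seq p <- ps | hit p] <= #|A| by [].
  by nlia.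
pose p (i : 'I_k) := nth [::] us i.
have pu i : p i \in us by apply: mem_nth; apply: leq_trans (ltn_ord i) szu.
have pps i : p i \in ps by move: (pu i); rewrite mem_filter => /andP[].
have pnh i : ~~ hit (p i) by move: (pu i); rewrite mem_filter => /andP[].
have nps : [::] \notin ps by apply/negP => /hps[x [q []]].
have uus : uniq us by apply: filter_uniq; apply: flatten_uniq.
have pinj i j : p i = p j -> i = j.
  move=> E; apply/val_inj/eqP; rewrite /= -(nth_uniq [::] (s := us)) // ?(leq_trans (ltn_ord _) szu) //.
  exact/eqP.
pose W t := rho t :: Q (rho t); pose en t := last (rho t) (Q (rho t)).
have WV t v : v \in W t -> v \in V.
  by move=> h; have [pQ _ _ _] := hQ _ (rA t); apply: (path_ind_in pQ (subsetP AV _ (rA t))) h.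
have Winj t t' v : v \in W t -> v \in W t' -> t = t' by move=> h1 h2; apply: rhoi; apply: dQ h1 h2.
have WU t v : v \in W t -> v \in U -> v = en t.
  by move=> vW vU; have [_ _ _ bQ] := hQ _ (rA t); case: (belast_last vW) => // /bQ; rewrite vU.
have enW t : en t \in W t by apply: mem_last.
have enU t : en t \in U by have [] := hQ _ (rA t).
have sV i : s i \notin V by rewrite in_setC negbK.
(* The rail of [s i]: backwards along one leg, through [s i], and out along the other. *)
pose q i := rev (belast (rho (i, true)) (Q (rho (i, true)))) ++ s i :: W (i, false).
have fE i : en (i, true) :: q i = rev (W (i, true)) ++ s i :: W (i, false).
  by rewrite /W (lastI (rho (i, true))) rev_rcons.
have fM i v : v \in en (i, true) :: q i -> v \in W (i, true) \/ v = s i \/ v \in W (i, false).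
  by rewrite fE mem_cat mem_rev inE => /or3P[|/eqP|]; auto.
have lq i : last (en (i, true)) (q i) = en (i, false) by rewrite /q last_cat.
have sF i : s i \in en (i, true) :: q i by rewrite fE mem_cat mem_head orbT.
have railF i : rail e U (en (i, true)) (q i).
  have [pt ut _ _] := hQ _ (rA (i, true)); have [pf uf _ _] := hQ _ (rA (i, false)).
  split.
  + have [_ e1] := rV (i, true); have [_ e2] := rV (i, false).
    rewrite /q cat_path last_rev_belast; apply/andP; split.
      by rewrite rev_path; apply: sub_path (path_ind_sub pt) => a b; rewrite es.
    by rewrite /= es e1 e2 (path_ind_sub pf).
  + rewrite fE cat_uniq rev_uniq ut andTb; apply/andP; split.
      apply/hasPn => v; rewrite inE => /predU1P[->|vf]; apply/negP; rewrite /= mem_rev => vt.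
        by move/negP: (sV i); apply; apply: WV vt.
      by have := Winj _ _ v vf vt.
    by rewrite cons_uniq uf andbT; apply: contra (sV i); apply: (WV (i, false)).
  + by rewrite /q; case: (rev _).
  + by rewrite lq !enU.
  + move=> v /fM[h|[->|h]] vU; first by left; apply: WU.
      by case/negP: (sV i); apply: (subsetP UV).
    by right; rewrite lq; apply: WU.
apply: (@assemble T e c k U S (fun i => en (i, true)) (fun i => head x0 (p i)) q (fun i => behead (p i))).
- by move=> X XU cX; apply: lkU.
- by move=> i; split; [exact: railF | apply/hasP; exists (s i); [exact: sF | exact: (subsetP S1S)]].
- move=> i _; have [x [l [pE pl /andP[/andP[ln xU] lU] par h]]] := hps _ (pps i); rewrite pE /=; split.
    split=> //; last by move=> v vp vU; have [_] := h v (eq_ind_r (fun s => v \in s) vp pE); apply.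
      rewrite -pE; move: ups; have /splitPr[l1 l2] := pps i.
      by rewrite flatten_cat /= !cat_uniq => /and3P[_ _ /and3P[]].
    by rewrite xU lU.
  by rewrite /bend par; case: (c x == _).
- move=> i j v /fM h1 /fM h2; case: h1 => [h1|[h1|h1]]; case: h2 => [h2|[h2|h2]];
    try by [case: (Winj _ _ v h1 h2)];
    try by [move: (WV _ v h1); rewrite h2 (negbTE (sV j))];
    try by [move: (WV _ v h2); rewrite h1 (negbTE (sV i))].
  by apply: si; rewrite -h1.
- move=> i j v _ /fM h1; have [x [l [pE pl _ _ h]]] := hps _ (pps j); rewrite pE /= -pE => vp.
  have vh t : v \in W t -> False.
    move=> vW; move/negP: (pnh j); apply; apply/hasP; exists v => //.
    by apply/existsP; exists (rho t); rewrite rA.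
  case: h1 => [/vh //|[E|/vh //]]; have [vV _] := h v vp; by move: (sV i); rewrite -E vV.
- move=> i j v; have [x [l [pE _ _ _ _]]] := hps _ (pps i); have [x' [l' [pE' _ _ _ _]]] := hps _ (pps j).
  rewrite pE pE' /= -pE -pE' => v1 v2 _ _; apply: pinj; exact: flatten_eq ups (pps i) (pps j) v1 v2.
Qed.

(** * Colourings that are proper outside a small set *)

Section Stage2.
Variables (Y : {set T}) (c : T -> bool).
Hypothesis cY : #|Y| <= 7 * k.
Local Notation g := (cross e c).
Hypothesis cross_off : forall x y, x \notin Y -> y \notin Y -> e x y -> c x != c y.
Hypothesis cross_deg : forall x, 43 * k <= 2 * #|nb g (~: Y) x|.

Lemma cross_deg_off x : x \notin Y -> 43 * k <= #|nb g (~: Y) x|.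
Proof.
move=> xY; have := deg_ge Y x; have : #|nb e (~: Y) x| <= #|nb g (~: Y) x|; last by nlia.
apply: subset_leq_card; apply/subsetP => y; rewrite !in_nb in_setC => /andP[yY exy].
by rewrite yY /= /cross exy cross_off.
Qed.

(** Both ends first step along a crossing edge to a vertex outside [Y] and [Z]. Outside [Y] every
    edge crosses, so the connectivity of the graph, with [Y :|: Z] deleted, joins the two. *)
Lemma cross_conn Z x y : #|Z| <= 5 * k -> x \notin Z -> y \notin Z -> connect (ind g (~: Z)) x y.
Proof.
move=> cZ xZ yZ.
have near v : v \notin Z -> exists v', [/\ v' \notin Y, v' \notin Z & connect (ind g (~: Z)) v v'].
  move=> vZ; have [v'] : exists v', v' \in nb g (~: Y) v :\: Z.
    by apply/card_gt0P; have := cardsD_ge (nb g (~: Y) v) Z; have := cross_deg v; nlia.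
  rewrite in_setD in_nb in_setC => /and3P[v'Z v'Y gv]; exists v'; split=> //.
  by apply: connect1; rewrite /= gv !in_setC vZ v'Z.
have [x' [xY xZ' cx]] := near x xZ; have [y' [yY yZ' cy]] := near y yZ.
apply: connect_trans cx _; apply: connect_trans (connect_symr (ind_sym _ (cross_sym es c)) cy).
apply: connect_mono (_ : connect (ind e (~: (Y :|: Z))) x' y') => [u v /and3P[euv]|].
  rewrite !in_setC !in_setU !negb_or => /andP[uY uZ] /andP[vY vZ].
  by rewrite /= /cross euv !in_setC uZ vZ cross_off.
apply: conn_minus; rewrite ?in_setU ?negb_or ?xY ?yY //.
by have := cardsU_le Y Z; nlia.
Qed.

(** The density comes from the vertices outside [Y], each with at least [42 * k] crossing neighbours
    off [E]. At most [7 * k] of at least [45 * k] vertices are lost to [Y], so the average stays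
    above [24 * k]. *)
Lemma cross_linked (I : finType) (E X : {set T}) : #|E| <= k -> X \subset ~: E -> #|X| <= 4 * k ->
  @linked T I (~: E) g X.
Proof.
move=> cE XE cX; have gs := cross_sym es c; have cT : 50 * k < #|T| by case: ek.
apply: (@massed_linked _ _ (2 * k) (12 * k)) => //; [by move=> x; rewrite /cross ei | by nlia | by nlia |].
have cV : #|~: E| + #|E| = #|T| by rewrite addnC cardsC.
have cVX : #|~: E :\: X| + #|X| = #|~: E| by have := cardsID X (~: E); rewrite (setIidPr XE); nlia.
apply: massed_of_conn => [|A B sAB cAB].
  have h1 := deg_sum g (subsetDl (~: E) X).
  have h2 : 42 * k * #|(~: E :\: X) :\: Y| <= \sum_(u in ~: E :\: X) #|nb g (~: E) u|.
    rewrite mulnC -sum_nat_const; apply: leq_trans (_ : \sum_(u in (~: E :\: X) :\: Y) #|nb g (~: E) u| <= _).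
      apply: leq_sum => u /setDP[_ uY]; have := cross_deg_off uY; have := cardsD_ge (nb g (~: Y) u) E.
      have : #|nb g (~: Y) u :\: E| <= #|nb g (~: E) u|; last by nlia.
      by apply: subset_leq_card; apply/subsetP => v; rewrite in_setD !in_nb !in_setC => /and3P[-> _ ->].
    rewrite [X in _ <= X](big_setID Y) /= addnC; exact: leq_addr.
  have h3 := cardsD_ge (~: E :\: X) Y.
  have : 45 * k <= #|~: E :\: X| by nlia.
  move: h1 h2 h3 cY k0; clear; set n := #|_ :\: X|; set n' := #|_|; set r := R _ _ _; set t := \sum_(i in _) _; nia.
apply: NNPP => /not_or_and[/negP/subsetPn[a aA aB] /negP/subsetPn[b bB bA]].
have [VE nc] := sAB; have aV := subsetP (sepn_subl sAB) a aA; have bV := subsetP (sepn_subr sAB) b bB.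
have : connect (ind g (~: (E :|: (A :&: B)))) a b.
  apply: cross_conn; first by have := cardsU_le E (A :&: B); nlia.
    by move: aV; rewrite in_setC in_setU in_setI negb_or => ->; rewrite (negbTE aB) andbF.
  by move: bV; rewrite in_setC in_setU in_setI negb_or => ->; rewrite (negbTE bA).
move=> cn; move/negP: bA; apply.
apply: (connect_inv (P := fun v => v \in A) _ cn aA) => u v uA /and3P[guv].
rewrite !in_setC !in_setU !in_setI !negb_or uA /= => /andP[_ uB] /andP[vE vAB]; apply/negPn/negP => vA.
have vB : v \in B by have : v \in A :|: B by [rewrite VE in_setC]; rewrite in_setU (negbTE vA).
by move/negP: (nc u v uA uB vB vA).
Qed.

(** A monochromatic edge is a bent rail. If [s i] lies on its edge, this edge alone closes to an odd
    cycle. Otherwise [s i] is deleted from the linked part, which makes a path of two crossing edges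
    through [s i] a rail; it is not bent, and the edge is its partner. *)
Lemma cycles_of_pairs S (a b s : 'I_k -> T) : (forall i, e (a i) (b i)) -> (forall i, c (a i) = c (b i)) ->
  (forall i j v, v \in [:: a i; b i] -> v \in [:: a j; b j] -> i = j) ->
  (forall i, s i \in S) -> injective s ->
  (forall i, s i \in [:: a i; b i] \/ forall j, s i \notin [:: a j; b j]) -> cycles S.
Proof.
move=> eab cab dab sS si loc.
pose ext i := s i \notin [:: a i; b i].
have extN i j : ext i -> s i \notin [:: a j; b j] by move=> xi; case: (loc i) => [h|//]; rewrite /ext h in xi.
pose E := [set s i | i in [set i | ext i]]; pose Z := [set a i | i : 'I_k] :|: [set b i | i : 'I_k] :|: [set s i | i : 'I_k].
have cI (f : 'I_k -> T) : #|[set f i | i : 'I_k]| <= k by apply: leq_trans (leq_imset_card _ _) _; rewrite card_ord.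
have cE : #|E| <= k by apply: leq_trans (leq_imset_card _ _) _; apply: leq_trans (max_card _) _; rewrite card_ord.
have cZ : #|Z| <= 3 * k.
  have := cardsU_le [set a i | i : 'I_k] [set b i | i : 'I_k].
  have := cardsU_le ([set a i | i : 'I_k] :|: [set b i | i : 'I_k]) [set s i | i : 'I_k].
  by have := cI a; have := cI b; have := cI s; rewrite -/Z; nlia.
have i0 : 'I_k := Ordinal k0.
have [|z [zN zi]] := @greedy_sdr T ('I_k * bool)%type (a i0) setT (fun t => nb g (~: Z) (s t.1)).
  move=> t _; rewrite cardsT card_prod card_ord card_bool.
  have := cross_deg (s t.1); have := cardsD_ge (nb g (~: Y) (s t.1)) Z.
  have : #|nb g (~: Y) (s t.1) :\: Z| <= #|nb g (~: Z) (s t.1)|; last by nlia.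
  by apply: subset_leq_card; apply/subsetP => v; rewrite in_setD !in_nb !in_setC => /and3P[-> _ ->].
have zP t : z t \notin Z /\ g (s t.1) (z t) by apply/andP; rewrite -in_setC -in_nb; apply: zN; rewrite in_setT.
have {}zi t t' : z t = z t' -> t = t' by apply: zi; rewrite in_setT.
have zs t i : z t <> s i.
  by move=> h; have [/negP zZ _] := zP t; apply: zZ; rewrite h !inE; apply/orP; right; apply: imset_f.
have zab t i : z t \notin [:: a i; b i].
  have [zZ _] := zP t; apply: contra zZ; rewrite !inE => /orP[]/eqP->; rewrite imset_f ?orbT //.
have sE i : ext i -> s i \in E by move=> xi; apply: imset_f; rewrite inE.
have zE t : z t \notin E by apply/negP => /imsetP[i _]; apply: zs.
have abE i v : v \in [:: a i; b i] -> v \notin E.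
  by move=> vab; apply/negP => /imsetP[j]; rewrite inE => xj Ev; move: vab; rewrite Ev (negbTE (extN j i xj)).
have aab i : a i \in [:: a i; b i] by rewrite mem_head.
have bab i : b i \in [:: a i; b i] by rewrite !inE eqxx orbT.
have aNb i : a i != b i by apply: contraTneq (eab i) => ->; rewrite ei.
have bendab i : bend c (a i) [:: b i] by rewrite /bend /= cab eqxx.
have rab i : rail e (~: E) (a i) [:: b i].
  split=> //.
  - by rewrite /= eab.
  - by rewrite /= inE andbT.
  - by rewrite /= !in_setC (abE i (a i)) // (abE i (b i)).
  by move=> v; rewrite !inE => /orP[]/eqP->; auto.
have bends i : ext i -> bend c (z (i, true)) [:: s i; z (i, false)] = false.
  have [_ /andP[_ h1]] := zP (i, true); have [_ /andP[_ h2]] := zP (i, false).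
  by move=> _; rewrite /bend /=; move: h1 h2; case: (c _); case: (c _); case: (c _).
have rs i : ext i -> rail e (~: E) (z (i, true)) [:: s i; z (i, false)].
  move=> xi; have [_ /andP[h1 _]] := zP (i, true); have [_ /andP[h2 _]] := zP (i, false).
  split=> //=.
  - by rewrite es h1 h2.
  - rewrite !inE negb_or !andbT -andbA; apply/and3P; split; first exact/eqP/zs.
      by apply/eqP => /zi.
    by apply/eqP => /esym; apply: zs.
  - by rewrite !in_setC !zE.
  - move=> v; rewrite !inE => /or3P[/eqP->|/eqP->|/eqP->]; auto.
    by rewrite sE.
pose x i := if ext i then z (i, true) else a i.
pose q i := if ext i then [:: s i; z (i, false)] else [:: b i].
have bq i : ~~ bend c (x i) (q i) -> ext i.
  by rewrite /x /q; case: (ext i); rewrite ?bendab.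
have inF i v : v \in x i :: q i -> ext i /\ (v = s i \/ exists b0, v = z (i, b0)) \/ ~~ ext i /\ v \in [:: a i; b i].
  rewrite /x /q; case: (ext i) => h; [left | by right].
  by split=> //; move: h; rewrite !inE => /or3P[/eqP->|/eqP->|/eqP->]; [right; exists true | left | right; exists false].
apply: (@assemble T e c k (~: E) S x a q (fun i => [:: b i])).
- by move=> X XE cX; apply: cross_linked.
- move=> i; rewrite /x /q; case: (boolP (ext i)) => xi.
    by split; [exact: rs | apply/hasP; exists (s i); [rewrite !inE eqxx orbT | exact: sS]].
  split; first exact: rab.
  by move: xi; rewrite /ext negbK => h; apply/hasP; exists (s i); [exact: h | exact: sS].
- by move=> i _; split; [exact: rab | exact: bendab].
- move=> i j v /inF[[xi h1]|[xi h1]] /inF[[xj h2]|[xj h2]].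
  + case: h1 => [h1|[b1 h1]]; case: h2 => [h2|[b2 h2]].
    * by apply: si; rewrite -h1.
    * by case: (zs (j, b2) i); rewrite -h2.
    * by case: (zs (i, b1) j); rewrite -h1.
    * by have [] : (i, b1) = (j, b2) by apply: zi; rewrite -h1.
  + case: h1 => [h1|[b1 h1]]; first by move: (extN i j xi); rewrite -h1 h2.
    by move: (zab (i, b1) j); rewrite -h1 h2.
  + case: h2 => [h2|[b2 h2]]; first by move: (extN j i xj); rewrite -h2 h1.
    by move: (zab (j, b2) i); rewrite -h2 h1.
  + exact: dab h1 h2.
- move=> i j v /bq xj /inF[[xi h1]|[xi h1]] h2.
    case: h1 => [h1|[b1 h1]]; first by move: (extN i j xi); rewrite -h1 h2.
    by move: (zab (i, b1) j); rewrite -h1 h2.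
  by move: xi; rewrite (dab i j v h1 h2) xj.
- by move=> i j v h1 h2 _ _; apply: dab h1 h2.
Qed.

(** An edge that meets [S] uses a vertex of [S] on itself; the other indices choose distinct
    vertices of [S] off the matching, and the inequality says that there are enough. *)
Lemma cycles_of_matching S (a b : 'I_k -> T) : (forall i, e (a i) (b i)) -> (forall i, c (a i) = c (b i)) ->
  (forall i j v, v \in [:: a i; b i] -> v \in [:: a j; b j] -> i = j) ->
  k <= #|S :\: \bigcup_i [set a i; b i]| + #|[set i | (a i \in S) || (b i \in S)]| -> cycles S.
Proof.
move=> eab cab dab le; pose M := \bigcup_i [set a i; b i]; pose P := [set i | (a i \in S) || (b i \in S)].
have i0 : 'I_k := Ordinal k0.
have [|h [hS hi]] := @greedy_sdr T 'I_k (a i0) (~: P) (fun=> S :\: M).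
  by move=> i _; have le' : k <= #|S :\: M| + #|P| := le; have := cardsC P; rewrite card_ord => E; rewrite -(leq_add2l #|P|) E addnC.
have hN i j : i \in ~: P -> h i \notin [:: a j; b j].
  move=> iP; have := hS i iP; rewrite in_setD => /andP[hM _]; apply: contra hM => h1; apply/bigcupP; exists j => //.
  by move: h1; rewrite !inE.
pose s i := if a i \in S then a i else if b i \in S then b i else h i.
have sP i : s i \in S /\ (s i \in [:: a i; b i] \/ s i = h i /\ i \in ~: P).
  rewrite /s; case aS : (a i \in S); first by rewrite mem_head; auto.
  case bS : (b i \in S); first by rewrite bS !inE eqxx orbT; auto.
  have iP : i \in ~: P by rewrite !inE aS bS.
  by have := hS i iP; rewrite in_setD => /andP[_ ->]; auto.
apply: (cycles_of_pairs eab cab dab (s := s)) => [i|i j E|i].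
- by case: (sP i).
- case: (sP i) => _ [h1|[h1 iP]]; case: (sP j) => _ [h2|[h2 jP]].
  + by apply: dab h1 _; rewrite E.
  + by move: (hN j i jP); rewrite -h2 -E h1.
  + by move: (hN i j iP); rewrite -h1 E h2.
  + by apply: hi; rewrite -?h1 // -h2.
- by case: (sP i) => _ [h1|[h1 iP]]; [left | right=> j; rewrite h1 hN].
Qed.

Lemma odd_matching (W : {set T}) : (exists a b : 'I_k -> T, [/\ forall i, e (a i) (b i), forall i, c (a i) = c (b i),
    forall i, a i \in W /\ b i \in W & forall i j v, v \in [:: a i; b i] -> v \in [:: a j; b j] -> i = j]) \/
  exists Z, #|Z| <= 2 * k - 2 /\ forall x y, x \in W :\: Z -> y \in W :\: Z -> e x y -> c x != c y.
Proof.
pose l (p : T * T) := [:: p.1; p.2].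
(* Greedy extension. If [n] edges cannot be extended, their ends form a set of at most [2 * n],
   which is the bound [2 * n.+1 - 2] for the next size. *)
have main n : (exists ms : seq (T * T), [/\ size ms = n, uniq (flatten (map l ms)) &
     forall p, p \in ms -> [/\ e p.1 p.2, c p.1 = c p.2, p.1 \in W & p.2 \in W]]) \/
  exists Z, #|Z| <= 2 * n - 2 /\ forall x y, x \in W :\: Z -> y \in W :\: Z -> e x y -> c x != c y.
  elim: n => [|n [[ms [sm um hm]]|[Z [cZ hZ]]]]; [by left; exists [::] | | by right; exists Z; split=> //; nlia].
  pose Z := [set v in flatten (map l ms)].
  have cZ : #|Z| <= 2 * n.
    rewrite cardsE; apply: leq_trans (card_size _) _; rewrite -sm; clear.
    by elim: ms => //= p ms IH; nlia.
  have [ok|no] := classic (forall x y, x \in W :\: Z -> y \in W :\: Z -> e x y -> c x != c y).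
    by right; exists Z; split=> //; nlia.
  left; apply: NNPP => nms; apply: no => x y; rewrite !inE => /andP[xZ xW] /andP[yZ yW] exy; apply/negP => /eqP cxy.
  apply: nms; exists ((x, y) :: ms); split; first by rewrite /= sm.
    by rewrite /= inE negb_or um xZ yZ !andbT; apply: contraTneq exy => ->; rewrite ei.
  by move=> p; rewrite inE => /predU1P[->|/hm].
case: (main k) => [[ms [sm um hm]]|]; [left | by right].
case: ms sm um hm => [|p0 ms'] sm um hm; first by have := k0; rewrite -sm.
set ms := p0 :: ms' in sm um hm.
have mi (i : 'I_k) : nth p0 ms i \in ms by apply: mem_nth; rewrite sm.
have uml : uniq (map l ms) by apply: flatten_uniq um _; apply/negP => /mapP[].
exists (fun i => (nth p0 ms i).1), (fun i => (nth p0 ms i).2); split=> [i|i|i|i j v h1 h2].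
- by case: (hm _ (mi i)).
- by case: (hm _ (mi i)).
- by case: (hm _ (mi i)).
have E : l (nth p0 ms i) = l (nth p0 ms j).
  by apply: (flatten_eq um _ _ h1 h2); apply: map_f; apply: mi.
apply/val_inj/eqP; rewrite /= -(nth_uniq (l p0) (s := map l ms)) ?size_map ?sm //.
by rewrite !(nth_map p0) ?sm // E.
Qed.

Lemma no_odd_cycle Z S : (forall x y, x \notin Z -> y \notin Z -> e x y -> c x != c y) -> no_odd_S_cycle_minus e S Z.
Proof.
move=> h [|x p] [[_ _ cy] od _] //; have : path g x (rcons p x).
  apply: sub_path cy => u v /= /and3P[euv uZ vZ]; by rewrite /cross euv h.
move/bend_cross; rewrite /bend last_rcons size_rcons eqxx addbF => /negbT.
by rewrite -[(size p).+1]/(size (x :: p)) od.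
Qed.

Lemma stage2 S : k <= #|S| -> ~ cycles S ->
  (exists X : {set T}, #|X| <= 2 * k - 2 /\ no_odd_S_cycle_minus e S X) /\
  (exists Z : {set T}, #|Z| <= 3 * k - 3 /\ bipartite_minus e Z).
Proof.
move=> kS nc; split.
  (* A small [S] is itself a suitable [X]; from [2 * k - 1] vertices on, the count below works. *)
  have [le|gt] := leqP #|S| (2 * k - 2).
    by exists S; split=> // C [[_ _ cy] _ /hasP[x xC xS]]; have /and3P[_ + _] := next_cycle cy xC; rewrite (xS : x \in S).
  case: (odd_matching setT) => [[a [b [eab cab _ dab]]]|[Z [cZ hZ]]]; last first.
    by exists Z; split=> //; apply: no_odd_cycle => x y xZ yZ; apply: hZ; rewrite !inE ?xZ ?yZ.
  (* The edges in [P] cover at most [2 * #|P|] vertices of [S], so the required sum is at least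
     [2 * k - 1 - #|P|]. This is at least [k] unless [#|P| = k], when [P] alone suffices. *)
  exfalso; apply: nc; apply: (cycles_of_matching eab cab dab).
  set M := \bigcup_i _; set P := [set i | _].
  have h1 : #|S :&: M| <= 2 * #|P|.
    apply: leq_trans (_ : #|\bigcup_(i in P) [set a i; b i]| <= _).
      apply: subset_leq_card; apply/subsetP => v /setIP[vS /bigcupP[i _ vi]]; apply/bigcupP; exists i => //.
      by rewrite inE; move: vi; rewrite in_set2 => /orP[]/eqP<-; rewrite vS ?orbT.
    apply: leq_trans (card_bigcup_le _ _) _; rewrite mulnC -sum_nat_const; apply: leq_sum => i _.
    by rewrite cards2; case: (_ != _).
  have := cardsID M S; have : #|P| <= k by rewrite -[X in _ <= X]card_ord max_card.
  by move: h1 gt; nlia.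
(* These [k - 1] vertices are kept off the matching. With one edge meeting [S] they make [k]; if no
   edge meets [S], all of [S] is available. A failing matching gives the bound
   [(k - 1) + (2 * k - 2)]. *)
have [||S2 [_ S2S cS2]] := @superset_card T set0 S k.-1 (sub0set S); [by rewrite cards0 | by nlia |].
case: (odd_matching (~: S2)) => [[a [b [eab cab abW dab]]]|[Z [cZ hZ]]]; last first.
  exists (S2 :|: Z); split; first by have := cardsU_le S2 Z; nlia.
  exists c => x y /and3P[exy]; rewrite !in_setU !negb_or => /andP[x2 xZ] /andP[y2 yZ].
  by apply: hZ; rewrite // !inE ?xZ ?yZ ?x2 ?y2.
exfalso; apply: nc; apply: (cycles_of_matching eab cab dab).
set M := \bigcup_i _; set P := [set i | _].
have S2M v : v \in S2 -> v \notin M.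
  move=> v2; apply/negP => /bigcupP[i _]; have [] := abW i; rewrite !in_setC in_set2 => h1 h2 /orP[]/eqP E.
    by rewrite -E v2 in h1.
  by rewrite -E v2 in h2.
have [P0|[i iP]] := set_0Vmem P.
  have -> : S :\: M = S.
    apply/setP => v; rewrite in_setD andbC; case: (boolP (v \in S)) => //= vS; apply/negP => /bigcupP[i _ vi].
    have : i \in P by rewrite inE; move: vi; rewrite in_set2 => /orP[]/eqP<-; rewrite vS ?orbT.
    by rewrite P0 inE.
  by nlia.
have : S2 \subset S :\: M by apply/subsetP => v v2; rewrite in_setD S2M // (subsetP S2S).
move/subset_leq_card; have : 0 < #|P| by apply/card_gt0P; exists i.
by nlia.
Qed.
End Stage2.

(** A vertex of [Y] takes the colour opposite to the majority of its neighbours outside [Y], so that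
    at least half of its [50 * k - 7 * k] edges leaving [Y] cross. Outside [Y] all of them cross. *)
Lemma majority_colour Y (f : T -> bool) : #|Y| <= 7 * k ->
  (forall x y, x \notin Y -> y \notin Y -> e x y -> f x != f y) ->
  exists c, (forall x y, x \notin Y -> y \notin Y -> e x y -> c x != c y) /\
    forall x, 43 * k <= 2 * #|nb (cross e c) (~: Y) x|.
Proof.
move=> cY hf; pose cl x b := [set y in nb e (~: Y) x | f y == b].
pose c x := if x \in Y then #|cl x true| <= #|cl x false| else f x.
have cE x : x \notin Y -> c x = f x by rewrite /c => /negbTE->.
have cl2 x : #|cl x true| + #|cl x false| = #|nb e (~: Y) x|.
  rewrite -(cardsID (cl x true) (nb e (~: Y) x)); congr (_ + _); apply: eq_card => y; rewrite !inE.
    by case: (y \in Y); case: (e x y).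
  by case: (y \in Y); case: (e x y) => //=; case: (f y).
have clc x : cl x (~~ c x) \subset nb (cross e c) (~: Y) x.
  apply/subsetP => y; rewrite inE in_nb => /andP[/andP[yY exy] /eqP fy]; rewrite in_nb yY /= /cross exy.
  by rewrite (cE y) ?fy -?in_setC //; case: (c x).
exists c; split=> [x y xY yY exy|x]; first by rewrite !cE ?hf.
have := subset_leq_card (clc x); have := cl2 x; have := deg_ge Y x.
have [xY|xY] := boolP (x \in Y).
  have : c x = (#|cl x true| <= #|cl x false|) by rewrite /c xY.
  by case: (c x) => /=; case: leqP => // h _; nlia.
have : #|cl x (c x)| = 0.
  apply/eqP; rewrite cards_eq0; apply/eqP/setP => y; rewrite !inE; apply/negP => /andP[/andP[yY exy] /eqP fy].
  by have := hf x y xY yY exy; rewrite fy cE // eqxx.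
by case: (c x) => /=; nlia.
Qed.

End Main.

Theorem theorem1 (T : finType) (e : rel T) (k : nat) (S : {set T}) :
  simple_graph e -> 0 < k -> k_connected e (50 * k) ->
  (exists cs : 'I_k -> seq T,
      (forall i, odd_S_cycle e S (cs i)) /\
      (forall i j, i != j -> forall v, v \in cs i -> v \notin cs j))
  \/
  ((exists X : {set T}, #|X| <= 2 * k - 2 /\ no_odd_S_cycle_minus e S X) /\
   (k <= #|S| -> exists Y : {set T}, #|Y| <= 3 * k - 3 /\ bipartite_minus e Y)).
Proof.
move=> [es ei] k0 ek; have [kS|Sk] := leqP k #|S|; last first.
  right; split=> //; exists S; split; first by lia.
  by move=> C [[_ _ cy] _ /hasP[x xC xS]]; have /and3P[_ + _] := next_cycle cy xC; rewrite (xS : x \in S).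
have [cS|ncS] := classic (cycles e k S); [by left | right].
case: (stage1 es ei k0 ek kS) => [//|[Y [cY [f hf]]]].
have [c [h1 h2]] := majority_colour ei k0 ek cY hf.
by have [hX hY] := stage2 es ei k0 ek cY h1 h2 kS ncS; split.
Qed.
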